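(* Let $\mathcal{O}$ be an unpunctured orbifold of genus $1$ whose boundary has exactly one marked point, and let $\mathcal{A}(\mathcal{O})$ be the cluster algebra with principal coefficients associated to $\mathcal{O}$. Then the Laurent polynomial associated to the essential loop around the boundary of $\mathcal{O}$ belongs to $\mathcal{A}(\mathcal{O})$.
   Context: An orbifold here is a connected oriented surface with non-empty boundary, a finite set of marked points on the boundary (here exactly one, hence a single boundary component), no punctures (no interior marked points), and finitely many orbifold points of weight $1/2$ in the interior. Triangulations of such an orbifold may contain pending arcs, i.e. arcs joining a marked point to an orbifold point. The associated cluster algebra $\mathcal{A}(\mathcal{O})$ is the (generally skew-symmetrizable) cluster algebra of Felikson–Shapiro–Tumarkin whose cluster variables correspond to arcs and whose clusters correspond to triangulations. It is taken with principal coefficients $y_1,\dots,y_n$ at an initial triangulation $T$, and it contains the coefficients $y_i$ (which are not assumed invertible). The flip of a pending arc $\tau'$ to a pending arc $\tau$ in a quadrilateral-type region with sides $a,b$ gives the exchange relation $x_\tau x_{\tau'}=x_a^2+x_b^2$ (with appropriate coefficients). To every arc and every closed curve $\gamma$ one associates a Laurent polynomial in the initial cluster variables $x_1,\dots,x_n$ with coefficients in $\mathbb{Z}[y_1,\dots,y_n]$, obtained from the perfect-matching (snake graph / band graph) expansion formula of Musiker–Schiffler–Williams applied to a suitable lift of $\gamma$ in an unfolding of $\mathcal{O}$ (a branched cover that is a surface), followed by specialization of the variables. The essential loop around the boundary is the simple closed curve in the interior of $\mathcal{O}$ homotopic to the boundary component. *)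

(* Defs.v *)
From HB Require Import structures.
From mathcomp Require Import all_boot all_order all_algebra.
From mathcomp Require Import mpoly.

Set Implicit Arguments.
Unset Strict Implicit.
Unset Printing Implicit Defensive.

Import GRing.Theory Num.Theory.
Local Open Scope ring_scope.

(* A triangulation with arcs tau_0, ..., tau_(n-1) is a collection of oriented
   triangles.  A dart is a side of a triangle, directed so that the triangle
   lies on its left; [rot] is the counterclockwise next side of the same
   triangle.  [side d] is the arc carried by d, or None when d is a boundary
   segment, and [opp d] is the other side carrying that arc.

   A pending arc appears as a dart with opp d = d.  The triangle side is then
   the loop based at the marked point and enclosing the orbifold point; it is
   folded about its midpoint onto the pending arc, and the midpoint becomes the
   orbifold point (cone angle pi).  A curve that goes half way around the
   orbifold point crosses the pending arc once, so it leaves the triangle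
   through d and comes back through the same d.

   Maximality of a triangulation forces exactly one pending arc at every
   orbifold point, so pending arcs and orbifold points are in bijection. *)
Record triangulation (n : nat) := Triangulation {
  dart : finType;
  rot : dart -> dart;
  opp : dart -> dart;
  side : dart -> option 'I_n;
  rot3 : forall d, rot (rot (rot d)) = d;
  rot_neq : forall d, rot d != d;
  oppK : forall d, opp (opp d) = d;
  opp_boundary : forall d, side d = None -> opp d = d;
  side_arc : forall d d' k,
    side d = Some k -> (side d' = Some k <-> d' = d \/ d' = opp d);
  side_onto : forall k, exists d, side d = Some k }.

Section Topology.

Variables (n : nat) (T : triangulation n).

Definition boundary (d : dart T) : bool := side d == None.

Definition pending (k : 'I_n) : bool :=
  [exists d : dart T, (side d == Some k) && (opp d == d)].

Definition connected : Prop :=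
  (0 < #|dart T|)%N /\
  forall d e : dart T, connect [rel a b | (b == rot a) || (b == opp a)] d e.

(* Turning around the starting point of d across the (non-boundary) side d
   leads to the dart rot (opp d), which has the same starting point; the fold
   at a pending arc identifies both ends of d, in accordance with this rule.
   Marked points are the classes of darts under the generated equivalence. *)
Definition turn : rel (dart T) :=
  [rel d e | (~~ boundary d && (e == rot (opp d)))
          || (~~ boundary e && (d == rot (opp e)))].

Definition marked_points : nat := n_comp turn (dart T).

Definition unpunctured : Prop :=
  forall d : dart T, exists e, boundary e /\ connect turn d e.

Definition orbifold : Prop := connected /\ unpunctured.

Definition orbifold_points : nat := #|[pred k | pending k]|.

Definition triangles : nat := (#|dart T| %/ 3)%N.

Definition boundary_segments : nat := #|[pred d : dart T | boundary d]|.

(* Consecutive boundary segments: one ends at the starting point of the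
   other. *)
Definition bnext : rel (dart T) :=
  [rel d e | [&& boundary d, boundary e
              & connect turn (rot d) e || connect turn (rot e) d]].

Definition boundary_components : nat := n_comp bnext [pred d | boundary d].

(* V - E + F = 2 - 2 g - b for the underlying surface, whose cell structure has
   the marked points and the orbifold points as vertices, and the arcs (pending
   ones included) and the boundary segments as edges. *)
Definition has_genus (g : nat) : Prop :=
  (marked_points + orbifold_points)%:Z - (n + boundary_segments)%:Z
    + triangles%:Z = 2 - g%:Z *+ 2 - boundary_components%:Z.

(* Signed adjacency: the number of triangles in which tau_j follows tau_i
   clockwise minus the number of those in which it follows it
   counterclockwise.  For orbifold points of weight 1/2 the columns of pending
   arcs are doubled: flipping a pending arc tau in a digon with sides a and b
   gives x_tau x_tau' = x_a^2 + x_b^2. *)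
Definition adjacency (i j : 'I_n) : int :=
  #|[pred d : dart T | (side (rot d) == Some i) && (side d == Some j)]|%:Z
  - #|[pred d : dart T | (side d == Some i) && (side (rot d) == Some j)]|%:Z.

Definition exchange_matrix : 'M[int]_n :=
  \matrix_(i, j) (adjacency i j *+ (if pending j then 2 else 1)).

End Topology.

Section ClusterAlgebra.

Variable n : nat.

Definition ambient : fieldType := {fraction {mpoly int[n + n]}}.

Definition xvar (i : 'I_n) : ambient := FracField.tofrac ('X_(lshift n i)).
Definition yvar (i : 'I_n) : ambient := FracField.tofrac ('X_(rshift n i)).

(* The last n rows of the extended exchange matrix are those of the frozen
   variables y_0, ..., y_(n-1). *)
Record seed := Seed {
  cluster : 'I_n -> ambient;
  exmatrix : 'M[int]_(n + n, n) }.

Definition extended_cluster (S : seed) (i : 'I_(n + n)) : ambient :=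
  match split i with inl j => cluster S j | inr j => yvar j end.

Definition mutated_variable (S : seed) (k : 'I_n) : ambient :=
  let b i := exmatrix S i k in
  ((\prod_(i | 0 < b i) extended_cluster S i ^+ `|b i|)
   + (\prod_(i | b i < 0) extended_cluster S i ^+ `|b i|)) / cluster S k.

Definition mutated_matrix (B : 'M[int]_(n + n, n)) (k : 'I_n) :
    'M[int]_(n + n, n) :=
  \matrix_(i, j)
    if (i == lshift n k) || (j == k) then - B i j
    else B i j + Num.sg (B i k) * Num.max 0 (B i k * B (lshift n k) j).

Definition mutation (k : 'I_n) (S : seed) : seed :=
  Seed (fun i => if i == k then mutated_variable S k else cluster S i)
       (mutated_matrix (exmatrix S) k).

Definition principal_seed (B : 'M[int]_n) : seed := Seed xvar (col_mx B 1%:M).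

Inductive reachable (S0 : seed) : seed -> Prop :=
  | reach_initial : reachable S0 S0
  | reach_mutation S k : reachable S0 S -> reachable S0 (mutation k S).

(* The subring generated by the coefficients y_i (but not their inverses) and
   all the cluster variables. *)
Inductive cluster_algebra (S0 : seed) : ambient -> Prop :=
  | ca_one : cluster_algebra S0 1
  | ca_coefficient i : cluster_algebra S0 (yvar i)
  | ca_variable S i : reachable S0 S -> cluster_algebra S0 (cluster S i)
  | ca_sub a b : cluster_algebra S0 a -> cluster_algebra S0 b ->
      cluster_algebra S0 (a - b)
  | ca_mul a b : cluster_algebra S0 a -> cluster_algebra S0 b ->
      cluster_algebra S0 (a * b).

End ClusterAlgebra.

Section Curves.

Variables (n : nat) (T : triangulation n) (N : nat).

(* A closed curve, in minimal position with the triangulation, is given by the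
   cyclic sequence w of the sides through which it successively leaves the
   triangles it traverses; indices are taken modulo N (ord_pred is the cyclic
   predecessor).  In the i-th triangle it enters through [entry i], leaves
   through [exit i], and cuts off the common endpoint of these two sides, which
   lies on its right exactly when [exit i] follows [entry i]
   counterclockwise. *)
Variable w : N.-tuple (dart T).

Definition exit (i : 'I_N) : dart T := tnth w i.
Definition entry (i : 'I_N) : dart T := opp (tnth w (ord_pred i)).
Definition right (i : 'I_N) : bool := exit i == rot (entry i).
Definition third (i : 'I_N) : dart T :=
  if right i then rot (rot (entry i)) else rot (entry i).

Definition closed_curve : Prop :=
  (0 < N)%N /\
  forall i, ~~ boundary (exit i) /\
    (exit i = rot (entry i) \/ exit i = rot (rot (entry i))).

(* The simple closed curve which runs once along a boundary component, keeping
   it on its right: in each triangle the part lying to the right of the curve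
   contains no arc, being either a corner at a marked point or a strip along a
   boundary segment. *)
Definition essential_loop : Prop :=
  [/\ closed_curve, uniq w
    & forall i, exit i = rot (entry i) \/
        (boundary (rot (entry i)) /\ exit i = rot (rot (entry i)))].

(* The band graph (Musiker-Schiffler-Williams).  Tile G_i is the quadrilateral
   formed by the i-th and (i+1)-st triangles, with the arc of [exit i] as
   diagonal; G_(i-1) and G_i are glued along the third side of the i-th
   triangle.  Every vertex of the band graph is an endpoint of the diagonal of
   exactly one tile: (i, true) and (i, false) are the right and left endpoints
   of the diagonal of G_i, with respect to the curve. *)
Definition vertex : finType := ('I_N * bool)%type.

(* The i-th triangle contributes the following edges, whose labels are the
   three sides of that triangle:
     (i, None)       the edge shared by G_(i-1) and G_i (third side);
     (i, Some false) the boundary edge of G_i labelled by the arc of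
                     [entry i], i.e. by the diagonal of G_(i-1);
     (i, Some true)  the boundary edge of G_(i-1) labelled by the arc of
                     [exit i], i.e. by the diagonal of G_i. *)
Definition edge : finType := ('I_N * option bool)%type.

Definition ends (e : edge) : {set vertex} :=
  let: (i, kind) := e in
  let prev := ord_pred i in
  match kind with
  | None => [set (prev, ~~ right i); (i, ~~ right i)]
  | Some false => [set (prev, ~~ right i); (i, right i)]
  | Some true => [set (prev, right i); (i, ~~ right i)]
  end.

Definition label (e : edge) : option 'I_n :=
  let: (i, kind) := e in
  match kind with
  | None => side (third i)
  | Some false => side (entry i)
  | Some true => side (exit i)
  end.

Definition perfect_matching (M : {set edge}) : bool :=
  [forall v, #|[set e in M | v \in ends e]| == 1%N].

(* M is good for the cut along the shared edge (i, None) if that edge belongs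
   to M, or if its two endpoints are matched on the same side of the cut.  Apart
   from the cut edge, the only edge on the G_i side at the endpoint
   (i-1, ~~ right i) is (i, Some false), and the only edge on the G_(i-1) side
   at the endpoint (i, ~~ right i) is (i, Some true); hence "same side" means
   that exactly one of these two edges is in M.  The condition does not depend
   on the cut. *)
Definition good_matching (M : {set edge}) : bool :=
  perfect_matching M &&
  [forall i, ((i, None) \in M)
          || (((i, Some false) \in M) (+) ((i, Some true) \in M))].

(* The minimal matching: all boundary edges not lying counterclockwise from the
   diagonal of their tile (tiles being oriented as in the surface).  It joins
   (i-1, false) to (i, true) for all i. *)
Definition minimal_matching : {set edge} :=
  [set e : edge | e.2 == Some (~~ right e.1)].

(* The boundary edge (i, Some false) belongs to no tile but G_i, so it is in
   the symmetric difference of M and the minimal matching exactly when this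
   symmetric difference encloses G_i. *)
Definition enclosed (M : {set edge}) (i : 'I_N) : bool :=
  ((i, Some false) \in M) (+) ((i, Some false) \in minimal_matching).

(* The expansion formula, at given values of the initial cluster variables and
   coefficients; boundary segments have weight 1. *)
Definition band_expansion (K : fieldType) (x y : 'I_n -> K) : K :=
  let x1 (s : option 'I_n) := if s is Some k then x k else 1 in
  let y1 (s : option 'I_n) := if s is Some k then y k else 1 in
  (\sum_(M : {set edge} | good_matching M)
      (\prod_(e in M) x1 (label e))
      * (\prod_(i | enclosed M i) y1 (side (exit i))))
  / \prod_i x1 (side (exit i)).

End Curves.

(* A finite cover of the orbifold by a surface (no pending arcs), with the
   lifted triangulation.  It is ramified, with index 2, exactly over the
   orbifold points: if opp d = d is a pending arc, two different triangles meet
   along each of its lifts. *)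
Record unfolding (n : nat) (T : triangulation n) := Unfolding {
  unf_arcs : nat;
  unf_cover : triangulation unf_arcs;
  unf_orbifold : orbifold unf_cover;
  unf_surface : forall k, ~~ pending unf_cover k;
  unf_proj : dart unf_cover -> dart T;
  unf_proj_arc : 'I_unf_arcs -> 'I_n;
  unf_proj_rot : forall d, unf_proj (rot d) = rot (unf_proj d);
  unf_proj_opp : forall d, unf_proj (opp d) = opp (unf_proj d);
  unf_proj_side : forall d,
    side (unf_proj d) = omap unf_proj_arc (side d) }.

(* A lift of w that closes up after one turn around w. *)
Definition closed_lift (n : nat) (T : triangulation n) (U : unfolding T)
    (N : nat) (w : N.-tuple (dart T)) (v : N.-tuple (dart (unf_cover U))) :
    Prop :=
  closed_curve v /\ forall i, unf_proj (tnth v i) = tnth w i.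

(* The variables of the lifts of an arc are specialized to that of the arc. *)
Definition lift_laurent (n : nat) (T : triangulation n) (U : unfolding T)
    (N : nat) (v : N.-tuple (dart (unf_cover U))) : ambient n :=
  band_expansion v (fun k => xvar (unf_proj_arc k))
                   (fun k => yvar (unf_proj_arc k)).

(* Main.v *)
(* Cutting the surface at its only marked point turns a triangulation into the
   list of its triangle sides in the order in which they leave that point.  Such
   a list carries one term per triangle corner, and the good matchings of the
   band graph of the boundary loop correspond to the corners, so the loop is the
   sum of all corner terms.  A flip only splits or merges neighbouring corners:
   partial corner sums up to an arc that is not flipped are invariant, and
   flipping away everything between two arcs yields a cluster variable equal to
   the partial sum between them, times the two arcs, divided by coefficients.

   Counting sides shows that in genus 1 some triangle has sides x, y, z leaving
   the marked point in the interlaced order z y x z y x.  Cutting along these and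
   a few further arcs expresses partial sums by cluster variables, first with
   denominators x, y or z.  There are cluster variables z_1 and y_1 satisfying
   z z_1 = 1 + c and y y_1 = 1 + c' with c and c' multiples of products of
   partial sums, by which the denominators can be removed without inverting any
   coefficient. *)
Require Import Defs.
From mathcomp Require Import all_boot all_order all_algebra.
From mathcomp Require Import mpoly zify ring.

Set Implicit Arguments.
Unset Strict Implicit.
Unset Printing Implicit Defensive.

Import Order.TTheory GRing.Theory Num.Theory.

(** * Coefficient monomials in the cluster algebra, and nonvanishing by positivity *)

Section Subring.

Local Open Scope ring_scope.

Variables (n : nat) (S0 : seed n).
Local Notation A := (cluster_algebra S0).

(** The term of a corner is the side opposite to it divided by the two sides that meet there, times
    a monomial in the coefficients. It is Penner's horocycle length, and the exchange relation is
    what makes it additive when a flip merges two corners. The exponents count crossings with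
    laminations and change by minima, so they depend on the flips chosen. What survives is a lower
    bound for the exponents in a gap; it suffices, because a surplus power of a coefficient stays in
    the algebra. The obstacle is a gap whose ends are the two sides of one arc: no triangle has such
    a corner, so the sums between the two z and between the two y are not read off from a single
    corner. Instead, if [q z] and [q c] lie in the algebra, where [z z_1 = 1 + c], then so does
    [q = (q z) z_1 - q c]. The constant term 1, in place of a monomial, is what spares the inversion
    of coefficients. *)

Lemma ca_exp a k : A a -> A (a ^+ k).
Proof.
by move=> Aa; elim: k => [|k IH]; rewrite ?expr0 ?exprS;
  [exact: ca_one | exact: ca_mul].
Qed.

Definition ymon (v : 'I_n -> nat) : ambient n := \prod_j yvar j ^+ v j.

Lemma ca_ymon v : A (ymon v).
Proof.
rewrite /ymon; elim/big_rec: _ => [|j b _ Ab]; first exact: ca_one.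
by apply: ca_mul => //; apply: ca_exp; exact: ca_coefficient.
Qed.

Lemma ymonD v w : ymon (fun j => v j + w j)%N = ymon v * ymon w.
Proof. by rewrite /ymon -big_split; apply: eq_bigr => j _; rewrite exprD. Qed.

Lemma eq_ymon v w : v =1 w -> ymon v = ymon w.
Proof. by move=> vw; apply: eq_bigr => j _; rewrite vw. Qed.

(* Cluster variables are nonzero because subtraction-free expressions do not
   vanish where all variables are 1. *)
Definition positive (f : ambient n) : Prop :=
  exists p q : {mpoly int[n + n]},
    [/\ 0 < p.@[fun=> 1], 0 < q.@[fun=> 1]
      & f = FracField.tofrac p / FracField.tofrac q].

Lemma meval_gt0_tofrac (p : {mpoly int[n + n]}) :
  0 < p.@[fun=> 1] -> FracField.tofrac p != 0 :> ambient n.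
Proof.
move=> p0; rewrite tofrac_eq0.
by apply: contraTneq p0 => ->; rewrite meval0 ltxx.
Qed.

Lemma positive_neq0 f : positive f -> f != 0.
Proof.
case=> p [q [p0 q0 ->]].
by rewrite mulf_neq0 ?invr_eq0 ?meval_gt0_tofrac.
Qed.

Lemma positive_poly (p : {mpoly int[n + n]}) :
  0 < p.@[fun=> 1] -> positive (FracField.tofrac p).
Proof.
by move=> p0; exists p, 1; rewrite rmorph1 rmorph1 divr1 ltr01.
Qed.

Lemma positive1 : positive 1.
Proof. by have := @positive_poly 1; rewrite !rmorph1; apply. Qed.

Lemma positive_mul f g : positive f -> positive g -> positive (f * g).
Proof.
case=> p [q [p0 q0 ->]] [p' [q' [p'0 q'0 ->]]].
by exists (p * p'), (q * q'); rewrite !mevalM !mulr_gt0 // !rmorphM /= mulf_div.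
Qed.

Lemma positive_inv f : positive f -> positive f^-1.
Proof.
by case=> p [q [p0 q0 ->]]; exists q, p; rewrite invf_div.
Qed.

Lemma positive_add f g : positive f -> positive g -> positive (f + g).
Proof.
case=> p [q [p0 q0 ->]] [p' [q' [p'0 q'0 ->]]].
exists (p * q' + p' * q), (q * q'); split.
- by rewrite mevalD !mevalM addr_gt0 // mulr_gt0.
- by rewrite mevalM mulr_gt0.
by rewrite rmorphD !rmorphM /= addf_div // meval_gt0_tofrac.
Qed.

Lemma positive_exp f k : positive f -> positive (f ^+ k).
Proof.
move=> f0; elim: k => [|k IH]; rewrite ?expr0 ?exprS; first exact: positive1.
exact: positive_mul.
Qed.

Lemma positive_xvar i : positive (xvar i).
Proof. by apply: positive_poly; rewrite mevalXU. Qed.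

Lemma positive_yvar i : positive (yvar i).
Proof. by apply: positive_poly; rewrite mevalXU. Qed.

Lemma positive_ymon v : positive (ymon v).
Proof.
rewrite /ymon; elim/big_rec: _ => [|j b _ b0]; first exact: positive1.
by apply: positive_mul => //; apply: positive_exp; exact: positive_yvar.
Qed.

Lemma ymon_neq0 v : ymon v != 0.
Proof. exact/positive_neq0/positive_ymon. Qed.

Lemma ymonB v w : (forall j, w j <= v j)%N ->
  ymon (fun j => v j - w j)%N = ymon v / ymon w.
Proof.
move=> wv; apply: (canRL (mulfK (ymon_neq0 w))); rewrite -ymonD.
by apply: eq_ymon => j; rewrite subnK.
Qed.

End Subring.

(** * Cyclic words *)

Section CyclicWords.

Variable D : eqType.
Implicit Types (s : seq D) (a b e p q v : D).

(** Deleting sides and reinserting them before or after a given side is all that flips and new arcs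
    do to a word: [insb] puts [e] before [v], and [insa] puts it after [p]. *)
Fixpoint insb e v s :=
  if s is a :: s' then if a == v then e :: s else a :: insb e v s' else [::].

Fixpoint insa p e s :=
  if s is a :: s' then if a == p then a :: e :: s' else a :: insa p e s'
  else [::].

Lemma insb_cat e v s1 s2 : v \notin s1 ->
  insb e v (s1 ++ v :: s2) = s1 ++ e :: v :: s2.
Proof.
elim: s1 => [|a s1 IH] /=; first by rewrite eqxx.
by rewrite inE negb_or eq_sym => /andP[/negPf-> /IH->].
Qed.

Lemma insa_cat p e s1 s2 : p \notin s1 ->
  insa p e (s1 ++ p :: s2) = s1 ++ p :: e :: s2.
Proof.
elim: s1 => [|a s1 IH] /=; first by rewrite eqxx.
by rewrite inE negb_or eq_sym => /andP[/negPf-> /IH->].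
Qed.

Lemma filter_insb (P : pred D) e v s : ~~ P e ->
  filter P (insb e v s) = filter P s.
Proof.
move=> /negPf Pe; elim: s => //= a s IH; case: ifP => _ /=; first by rewrite Pe.
by rewrite IH.
Qed.

Lemma perm_insb e v s : v \in s -> perm_eq (insb e v s) (e :: s).
Proof.
elim: s => //= a s IH; rewrite inE eq_sym; case: eqP => [->|_] //= /IH eq_s.
by rewrite -(perm_cons a) in eq_s; apply: (perm_trans eq_s);
  apply/permP => P /=; rewrite addnCA.
Qed.

Lemma last_insb e v x s : last x (insb e v s) = last x s.
Proof.
by elim: s x => //= a s IH x; case: ifP => //= _; exact: IH.
Qed.

Lemma size_next_gt s a : uniq s -> a \in s -> (1 < size s)%N -> next s a != a.
Proof.
move=> Us sa; have [i s' def_s] := rot_to sa.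
rewrite -(next_rot i Us) def_s -(size_rot i) def_s.
have: uniq (a :: s') by rewrite -def_s rot_uniq.
case: s' {def_s} => //= b s'; rewrite eqxx inE negb_or eq_sym.
by case/andP=> /andP[].
Qed.

Lemma size_next2_gt s a : uniq s -> a \in s -> (2 < size s)%N ->
  next s (next s a) != a.
Proof.
move=> Us sa; have [i s' def_s] := rot_to sa.
rewrite -(next_rot i Us) -(next_rot i Us a) def_s -(size_rot i) def_s.
have: uniq (a :: s') by rewrite -def_s rot_uniq.
case: s' {def_s} => [|b [|c s']] //=; rewrite !inE !negb_or.
case/andP=> /and3P[ab ac _] _ _; rewrite !eqxx.
by rewrite (eq_sym b a) (negPf ab) eq_sym.
Qed.

Lemma next_inj s : uniq s -> injective (next s).
Proof. by move=> Us; exact: can_inj (prev_next Us). Qed.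

Lemma filter_rot_ex (P : pred D) i s :
  exists j, filter P (rot i s) = rot j (filter P s).
Proof.
exists (size (filter P (take i s))).
have -> : filter P s = filter P (take i s) ++ filter P (drop i s).
  by rewrite -filter_cat cat_take_drop.
by rewrite filter_cat rot_size_cat.
Qed.

Lemma next_filter1 s e a : uniq s -> a \in s -> a != e ->
  next (filter (predC1 e) s) a = if next s a == e then next s e else next s a.
Proof.
move=> Us sa ae; have [i s' def_s] := rot_to sa.
have [j] := filter_rot_ex (predC1 e) i s.
rewrite -!(next_rot i Us) -(next_rot j (filter_uniq _ Us)) => <-.
have: uniq (a :: s') by rewrite -def_s rot_uniq.
rewrite def_s /= ae /=; case: s' {def_s} => [|b s'] /=.
  by rewrite !eqxx (negPf ae).
rewrite eqxx; have [->|be] /= := eqVneq b e; last by rewrite eqxx.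
rewrite eq_sym (negPf ae) => /and3P[_ es' _].
have ->: [seq x <- s' | x != e] = s'.
  by apply/all_filterP/allP => x xs'; apply: contraNneq es' => <-.
by case: s' es' => [|c s'] _ /=; rewrite !eqxx.
Qed.

Lemma next_insb s e v a : uniq s -> v \in s -> e \notin s -> a \in s ->
  next (insb e v s) a = if next s a == v then e else next s a.
Proof.
move=> Us sv se sa.
have [s1 [s2 def_s]] : exists s1 s2, s = s1 ++ v :: s2.
  by case/splitPr: sv => s1 s2; exists s1, s2.
have Pt := perm_insb e sv; set t := insb e v s in Pt *.
have Ut : uniq t by rewrite (perm_uniq Pt) /= se.
have ae : a != e by apply: contraNneq se => <-.
have fs : s = filter (predC1 e) t.
  rewrite filter_insb ?inE ?eqxx //; apply/esym/all_filterP/allP => x xs /=.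
  by apply: contraNneq se => <-.
have te : next t e = v.
  have s1v : v \notin s1 by move: Us; rewrite def_s cat_uniq /=; case/and3P=> _;
    rewrite negb_or => /andP[].
  have dt : t = s1 ++ e :: v :: s2 by rewrite /t def_s insb_cat.
  have := next_rot (size s1) Ut e; rewrite dt rot_size_cat => <- /=.
  by rewrite eqxx.
have ta : a \in t by rewrite (perm_mem Pt) inE sa orbT.
have := next_filter1 Ut ta ae; rewrite -fs te.
case: eqP => [ne ->|ne ->]; first by rewrite eqxx ne.
case: eqP => // nv; case/eqP: ae; apply: (next_inj Ut).
by rewrite nv te.
Qed.

Lemma next_insb_new s e v : uniq s -> v \in s -> e \notin s ->
  next (insb e v s) e = v.
Proof.
move=> Us sv se; have Pt := perm_insb e sv.
have Ut : uniq (insb e v s) by rewrite (perm_uniq Pt) /= se.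
case/splitPr: sv Us se Pt Ut => s1 s2 Us _ _.
have s1v : v \notin s1 by move: Us; rewrite cat_uniq /=; case/and3P=> _;
  rewrite negb_or => /andP[].
rewrite insb_cat // => Ut; have := next_rot (size s1) Ut e.
by rewrite rot_size_cat => <- /=; rewrite eqxx.
Qed.

Lemma index_filter_lt (P : pred D) s p q : P p -> P q ->
  (index p (filter P s) < index q (filter P s)) = (index p s < index q s).
Proof.
move=> Pp Pq; elim: s => //= a s IH.
have [->|ap] := eqVneq a p.
  by rewrite Pp /= eqxx; case: eqP.
have [->|aq] := eqVneq a q; first by rewrite Pq /= eqxx.
case: (P a) => /=; first by rewrite (negPf ap) (negPf aq) !ltnS.
by rewrite ltnS.
Qed.

Lemma index_next s a : uniq s -> a \in s -> a != last a s ->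
  index (next s a) s = (index a s).+1.
Proof.
move=> Us sa; case/splitPr: sa Us => s1 [|b s2] Us.
  by rewrite last_cat /= eqxx.
move=> _; have s1a : a \notin s1 by move: Us; rewrite cat_uniq /=; case/and3P=> _;
  rewrite negb_or => /andP[].
have -> : next (s1 ++ a :: b :: s2) a = b.
  have := next_rot (size s1) Us a; rewrite rot_size_cat => <- /=.
  by rewrite eqxx.
have s1b : b \notin rcons s1 a.
  move: Us; rewrite -cat_rcons cat_uniq /=; case/and3P=> _.
  by rewrite negb_or => /andP[].
rewrite -cat_rcons !index_cat (negPf s1b) /= eqxx mem_rcons inE eqxx /=.
by rewrite size_rcons -cats1 index_cat (negPf s1a) /= eqxx !addn0.
Qed.

End CyclicWords.

(** * Identities for merging and splitting corners *)

Section FieldIdentities.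

Local Open Scope ring_scope.

(** [k] is the old diagonal of a quadrilateral with opposite sides [X], [U] and [Y], [V]; the
    fraction over [k] is the new diagonal. [t] is the common factor of the monomials of the two
    corners, [cp] and [cm] are the cofactors. *)
Lemma merge_corners (F : fieldType) (cp cm t X Y U V k : F) :
  k != 0 -> Y != 0 -> U != 0 ->
  t * ((cp * (X * U) + cm * (Y * V)) / k) / (U * Y)
  = cp * t * X / (k * Y) + cm * t * V / (U * k).
Proof. by move=> k0 Y0 U0; field; rewrite k0 Y0 U0. Qed.

Lemma split_corner (F : fieldType) (cp cm t X Y U V k f : F) :
  f != 0 -> k != 0 -> Y != 0 -> X != 0 ->
  f * k = cp * (X * U) + cm * (Y * V) ->
  t * cm * V / (f * X) + t * cp * U / (Y * f) = t * k / (Y * X).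
Proof.
move=> f0 k0 Y0 X0 E; apply: (mulfI f0).
transitivity (t * (f * k) / (X * Y)); first by rewrite E; field; rewrite ?f0 ?Y0 ?X0.
by field; rewrite ?X0 ?Y0.
Qed.

(** The booleans tell which of the corners at the four sides of a quadrilateral lie in an interval.
    A corner at the diagonal has the same membership as the corner it merges with or is split from,
    so everything cancels. *)
Lemma regroup6 (R : comRingType) (bu bv bx by_ : bool)
    (c1 c2 cx cy cu cv c1' c2' cx' cy' cu' cv' : R) :
  cu' = c1 + cu -> cx' = c2 + cx -> c2' + cy' = cy -> c1' + cv' = cv ->
  ((if bv then c1' else 0) - (if bu then c1 else 0))
  + (((if by_ then c2' else 0) - (if bx then c2 else 0))
  + (((if bx then cx' else 0) - (if bx then cx else 0))
  + (((if by_ then cy' else 0) - (if by_ then cy else 0))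
  + (((if bu then cu' else 0) - (if bu then cu else 0))
  + (((if bv then cv' else 0) - (if bv then cv else 0)) + 0))))) = 0.
Proof.
move=> -> -> <- <-; case: bu; case: bv; case: bx; case: by_; ring.
Qed.

Lemma regroup3 (R : comRingType) (bx by_ : bool) (c1 cx cy c1' cx' cy' : R) :
  cx' = c1 + cx -> c1' + cy' = cy ->
  ((if by_ then c1' else 0) - (if bx then c1 else 0))
  + (((if bx then cx' else 0) - (if bx then cx else 0))
  + (((if by_ then cy' else 0) - (if by_ then cy else 0)) + 0)) = 0.
Proof. by move=> -> <-; case: bx; case: by_; ring. Qed.

End FieldIdentities.

(** * Flips of triangulations with one marked point *)

Section Flips.

Local Open Scope ring_scope.

Variables (n : nat) (T : triangulation n) (B : dart T).
Hypothesis boundaryE : forall d : dart T, boundary d = (d == B).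
Local Notation D := (dart T).
Local Notation opp := (@Defs.opp n T).
Local Notation K := (ambient n).
Local Notation S0 := (principal_seed (exchange_matrix T)).

(* A triangulation with one marked point, encoded by the list [wd] of its sides
   in the order in which they leave the marked point, the boundary segment [B]
   coming last.  [th st d] counts the crossings of the corner preceding d by the
   elementary laminations of the initial triangulation. *)
Record state := State {
  wd : seq D;
  lam : 'I_n -> K;
  th : D -> 'I_n -> nat }.

Definition srot st (d : D) : D := next (wd st) (opp d).
Definition xl st (d : D) : K := if side d is Some k then lam st k else 1.
Definition corner st (d : D) : K :=
  ymon (th st d) * xl st (srot st d) / (xl st d * xl st (srot st (srot st d))).
(** In the triangle of [d], a lamination crossing [d] cuts off one of the two ends of [d], so this
    is the number of crossings of [d]; [wf_cross] says that the triangles on both sides of the arc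
    agree on it. *)
Definition cross st (d : D) j := (th st d j + th st (srot st d) j)%N.

Definition nind (d : D) (i : 'I_n) : nat := side d == Some i.
Definition ind d i : int := (nind d i)%:Z.
Definition adj (r : D -> D) i j : int :=
  \sum_d (ind (r d) i * ind d j - ind d i * ind (r d) j).
Definition wgt k : int := if pending T k then 2 else 1.

(** The coefficient rows hold shear coordinates: the difference between the crossings of the two
    corners adjacent to [d] at its starting point. By [wf_cross] the other end of the arc gives the
    same number. *)
Definition realized st : Prop := exists S, [/\ reachable S0 S,
  forall k, cluster S k = lam st k,
  forall i k, exmatrix S (lshift n i) k = adj (srot st) i k * wgt k
  & forall j k d, side d = Some k -> exmatrix S (rshift n j) k =
      (th st d j)%:Z - (th st (next (wd st) d) j)%:Z].

Record wf st : Prop := Wf {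
  wf_uniq : uniq (wd st);
  wf_all : forall d, d \in wd st;
  wf_last : forall d, last d (wd st) = B;
  wf_rot3 : forall d, srot st (srot st (srot st d)) = d;
  wf_rot_neq : forall d, srot st d != d;
  wf_cross : forall d, cross st (opp d) =1 cross st d;
  wf_pos : forall k, positive (lam st k);
  wf_real : realized st }.

Lemma side_opp (d : D) : side (opp d) = side d.
Proof.
case E: (side d) => [k|]; last by rewrite (opp_boundary E).
by apply/(side_arc (opp d) E); right.
Qed.

Lemma sideP (d d' : D) : d' != B -> side d = side d' -> d = d' \/ d = opp d'.
Proof.
rewrite -boundaryE /boundary; case E: (side d') => [k|] // _.
by move/(side_arc d E).
Qed.

Lemma oppB : opp B = B.
Proof. by apply: opp_boundary; apply/eqP; move: (boundaryE B); rewrite eqxx. Qed.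

Lemma opp_inj : injective opp.
Proof. exact: can_inj (@oppK n T). Qed.

Lemma oppB_eq d : (opp d == B) = (d == B).
Proof. by rewrite -{1}oppB (inj_eq opp_inj). Qed.

Lemma xl_opp st d : xl st (opp d) = xl st d.
Proof. by rewrite /xl side_opp. Qed.

Lemma xlB st : xl st B = 1.
Proof.
by rewrite /xl; move: (boundaryE B); rewrite eqxx /boundary => /eqP->.
Qed.

Lemma nB_side d : d != B -> exists k, side d = Some k.
Proof. by rewrite -boundaryE /boundary; case: (side d) => [k|] //; exists k. Qed.

Section WellFormed.

Variables (st : state) (wst : wf st).

Lemma xl_positive d : positive (xl st d).
Proof.
rewrite /xl; case: (side d) => [k|]; [exact: wf_pos | exact: positive1].
Qed.

Lemma xl_neq0 d : xl st d != 0.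
Proof. exact/positive_neq0/xl_positive. Qed.

Lemma srot_inj : injective (srot st).
Proof. by move=> d e /(next_inj (wf_uniq wst)) /opp_inj. Qed.

Lemma size_wd : (2 < size (wd st))%N.
Proof.
have Us : uniq [:: B; srot st B; srot st (srot st B)].
  rewrite /= !inE negb_or /= !andbT -andbA; apply/and3P.
  split; rewrite 1?eq_sym ?(wf_rot_neq wst) //.
  by apply: contraNneq (wf_rot_neq wst B) => {1}<-; rewrite (wf_rot3 wst).
by have := uniq_leq_size Us (fun d _ => wf_all wst d).
Qed.

Lemma next_neq d : next (wd st) d != d.
Proof.
by apply: size_next_gt; [exact: wf_uniq | exact: wf_all | exact: ltnW size_wd].
Qed.

Lemma next2_neq d : next (wd st) (next (wd st) d) != d.
Proof. by apply: size_next2_gt; [exact: wf_uniq | exact: wf_all | exact: size_wd]. Qed.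

Lemma next_opp d : next (wd st) (opp d) = srot st d. Proof. by []. Qed.

Lemma next_srot d : next (wd st) d = srot st (opp d).
Proof. by rewrite /srot oppK. Qed.

(** Gluing consecutive sides of a triangle would produce a fixed point of [next], that is, a second
    marked point. *)
Lemma opp_neq_srot d : opp d != srot st d.
Proof. by apply: contra (next_neq (opp d)) => /eqP {2}->; rewrite next_opp. Qed.

Lemma opp_neq_srot2 d : opp d != srot st (srot st d).
Proof.
apply/eqP => E; have := next_neq d.
by rewrite next_srot E (wf_rot3 wst) eqxx.
Qed.

End WellFormed.

(** * A single flip: the new word, its corners and its seed *)

Section Flip.

Variables (st : state) (wst : wf st) (d1 : D).
Hypothesis d1B : d1 != B.

Local Notation d2 := (opp d1).
Local Notation x := (srot st d1).
Local Notation y := (srot st x).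
Local Notation u := (srot st d2).
Local Notation v := (srot st u).
Local Notation w := (wd st).

(** Strands that cut off both corners next to [d1] at its start; they still cut off the merged
    corner. The excesses [cplus] and [cminus] are the positive and negative part of the shear
    coordinate of [d1]. *)
Definition tmin j := minn (th st d1 j) (th st u j).
Definition cplus j := (th st d1 j - tmin j)%N.
Definition cminus j := (th st u j - tmin j)%N.

(** The new diagonal joins the starting points of [v] and [y], so its sides are reinserted just
    before these. For a pending arc [d2 = d1] and [v = y], and one insertion remains. *)
Definition flip_wd :=
  let w0 := filter (predC1 d1) (filter (predC1 d2) w) in
  if d2 == d1 then insb d1 y w0 else insb d1 v (insb d2 y w0).

Definition flip_var : K :=
  (ymon cplus * (xl st x * xl st u) + ymon cminus * (xl st y * xl st v))
  / xl st d1.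

Definition flip_lam k := if side d1 == Some k then flip_var else lam st k.

(** Strands running between opposite sides of the quadrilateral, counted by [cplus] and [cminus],
    turn into strands around the corners cut by the new diagonal. Strands around a corner that is
    split cross both halves; of two merged corners only the common strands remain. *)
Definition flip_th d j : nat :=
  if d == d1 then th st v j + cminus j
  else if d == d2 then th st y j + cminus j
  else if d == u then tmin j
  else if d == x then minn (th st d2 j) (th st x j)
  else if d == y then th st y j + cplus j
  else if d == v then th st v j + cplus j
  else th st d j.

Definition flip := State flip_wd flip_lam flip_th.

Local Notation st' := flip.

Lemma next_x : next w d2 = x. Proof. by []. Qed.
Lemma next_u : next w d1 = u. Proof. exact: next_srot. Qed.
Lemma srot_y : srot st y = d1. Proof. exact: wf_rot3. Qed.
Lemma srot_v : srot st v = d2. Proof. exact: wf_rot3. Qed.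

Lemma x_d1 : x != d1. Proof. exact: wf_rot_neq. Qed.
Lemma y_d1 : y != d1.
Proof. by apply: contra x_d1 => /eqP E; rewrite -{1}E srot_y. Qed.
Lemma x_y : x != y. Proof. by rewrite eq_sym; exact: wf_rot_neq. Qed.
Lemma x_d2 : x != d2. Proof. by rewrite eq_sym; exact: opp_neq_srot. Qed.
Lemma y_d2 : y != d2. Proof. by rewrite eq_sym; exact: opp_neq_srot2. Qed.
Lemma u_d2 : u != d2. Proof. exact: wf_rot_neq. Qed.
Lemma v_d2 : v != d2.
Proof. by apply: contra u_d2 => /eqP E; rewrite -{1}E srot_v. Qed.
Lemma u_v : u != v. Proof. by rewrite eq_sym; exact: wf_rot_neq. Qed.
Lemma u_d1 : u != d1. Proof. by have := opp_neq_srot wst d2; rewrite oppK eq_sym. Qed.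
Lemma v_d1 : v != d1. Proof. by have := opp_neq_srot2 wst d2; rewrite oppK eq_sym. Qed.

Lemma x_u_ne : d2 != d1 -> x != u.
Proof. by apply: contra => /eqP /(srot_inj wst) <-. Qed.
Lemma y_v_ne : d2 != d1 -> y != v.
Proof. by move/x_u_ne; apply: contra => /eqP /(srot_inj wst) ->. Qed.
Lemma x_v_ne : x != v.
Proof.
by apply: contra u_d1 => /eqP /(srot_inj wst) <-.
Qed.
Lemma u_y_ne : u != y.
Proof.
by apply: contra x_d2 => /eqP /(srot_inj wst) <-.
Qed.

Lemma mem_flip d : d \in flip_wd.
Proof.
rewrite /flip_wd; set w0 := filter _ _.
have m0 e : e != d1 -> e != d2 -> e \in w0.
  by move=> e1 e2; rewrite !mem_filter /= e1 e2 (wf_all wst).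
case: (eqVneq d2 d1) => [E|ne].
  rewrite (perm_mem (perm_insb _ _)) ?m0 ?y_d1 ?y_d2 // inE.
  by case: eqVneq => //= dd1; rewrite m0 // E.
have y0 : y \in w0 by rewrite m0 ?y_d1 ?y_d2.
have v0 : v \in insb d2 y w0.
  by rewrite (perm_mem (perm_insb _ y0)) inE m0 ?orbT // ?v_d1 ?v_d2.
rewrite (perm_mem (perm_insb _ v0)) inE (perm_mem (perm_insb _ y0)) inE.
by case: (eqVneq d d1) => //= ?; case: (eqVneq d d2) => //= ?; rewrite m0.
Qed.

Lemma flip_size : size flip_wd = size w /\ uniq flip_wd.
Proof.
have Uw := wf_uniq wst; have Aw := wf_all wst.
pose w0 := filter (predC1 d1) (filter (predC1 d2) w).
have U0 : uniq w0 by rewrite !filter_uniq.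
have m0 e : e \in w0 = (e != d1) && (e != d2).
  by rewrite !mem_filter /= Aw andbT.
have y0 : y \in w0 by rewrite m0 y_d1 y_d2.
have d10 : d1 \notin w0 by rewrite m0 eqxx.
have d20 : d2 \notin w0 by rewrite m0 eqxx andbF.
have Uf : uniq flip_wd.
  rewrite /flip_wd -/w0; case: (eqVneq d2 d1) => [E|ne].
    by rewrite (perm_uniq (perm_insb _ y0)) /= d10.
  have v0 : v \in insb d2 y w0.
    by rewrite (perm_mem (perm_insb _ y0)) inE m0 v_d1 v_d2 orbT.
  rewrite (perm_uniq (perm_insb _ v0)) /= (perm_uniq (perm_insb _ y0)) /=.
  by rewrite (perm_mem (perm_insb _ y0)) inE negb_or d20 d10 U0 eq_sym ne.
split=> //; apply/perm_size/uniq_perm => // e; by rewrite mem_flip Aw.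
Qed.

Lemma flip_filter (P : pred D) : ~~ P d1 -> ~~ P d2 ->
  filter P flip_wd = filter P w.
Proof.
move=> P1 P2; have -> : filter P w =
    filter P (filter (predC1 d1) (filter (predC1 d2) w)).
  rewrite -!filter_predI; apply: eq_filter => e /=.
  case Pe: (P e) => //=; symmetry; apply/andP.
  by split; [apply: contraNneq P1 | apply: contraNneq P2] => <-.
by rewrite /flip_wd; case: ifP => _; rewrite !filter_insb.
Qed.

Lemma flip_last d : last d flip_wd = B.
Proof.
rewrite /flip_wd; set w0 := filter _ _.
have l0 e : last e w0 = B.
  have : last e w0 = last e (filter (predC1 d1) (filter (predC1 d2) w)) by [].
  have [s ->] : exists s, w = rcons s B.
    have := wf_last wst d1; have := wf_all wst d1.
    by case/lastP: w => // s b _; rewrite last_rcons => ->; exists s.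
  by rewrite !filter_rcons /= eq_sym oppB_eq d1B /= filter_rcons /= eq_sym d1B
    last_rcons.
by case: ifP => _; rewrite !last_insb.
Qed.

Lemma flip_next e : next flip_wd e =
  if e == d1 then (if d2 == d1 then y else v)
  else if e == d2 then y
  else let e0 := next w e in
       let e1 := if e0 == d2 then x else if e0 == d1 then u else e0 in
       if e1 == v then d1 else if e1 == y then d2 else e1.
Proof.
have Uw := wf_uniq wst; have Aw := wf_all wst.
have Uw2 : uniq (filter (predC1 d2) w) by rewrite filter_uniq.
pose w0 := filter (predC1 d1) (filter (predC1 d2) w).
have U0 : uniq w0 by rewrite !filter_uniq.
have m0 a : a \in w0 = (a != d1) && (a != d2).
  by rewrite !mem_filter /= Aw andbT.
have y0 : y \in w0 by rewrite m0 y_d1 y_d2.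
have d10 : d1 \notin w0 by rewrite m0 eqxx.
have d20 : d2 \notin w0 by rewrite m0 eqxx andbF.
have n0 a : a != d1 -> a != d2 -> next w0 a =
    let e0 := next w a in
    if e0 == d2 then x else if e0 == d1 then u else e0.
  move=> a1 a2 /=; case: (eqVneq d2 d1) => [E|ne].
    have -> : w0 = filter (predC1 d1) w.
      by rewrite /w0 E -filter_predI; apply: eq_filter => b /=; rewrite andbb.
    by rewrite next_filter1 // next_u E; case: ifP.
  rewrite /w0 next_filter1 ?mem_filter /= ?a2 ?Aw // !next_filter1 // 1?eq_sym //.
  rewrite next_x next_u (negPf u_d2).
  by rewrite [d1 == _]eq_sym; case: (next w a == d2); rewrite ?(negPf x_d1).
rewrite /flip_wd -/w0; case: (eqVneq d2 d1) => [E|ne].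
  case: (eqVneq e d1) => [->|e1]; first by rewrite next_insb_new.
  have e2 : e != d2 by rewrite E.
  have e0 : e \in w0 by rewrite m0 e1.
  rewrite (negPf e2) (next_insb U0 y0 d10 e0) (n0 e e1 e2) /=.
  by rewrite E; case: ifP.
have U1 : uniq (insb d2 y w0) by rewrite (perm_uniq (perm_insb _ y0)) /= d20.
have v0 : v \in insb d2 y w0.
  by rewrite (perm_mem (perm_insb _ y0)) inE m0 v_d1 v_d2 orbT.
have d11 : d1 \notin insb d2 y w0.
  by rewrite (perm_mem (perm_insb _ y0)) inE m0 eqxx orbF eq_sym.
case: (eqVneq e d1) => [->|e1]; first by rewrite next_insb_new.
case: (eqVneq e d2) => [->|e2].
  rewrite (next_insb U1 v0 d11) ?(perm_mem (perm_insb _ y0)) ?inE ?eqxx //.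
  by rewrite next_insb_new // (negPf (y_v_ne ne)).
have e0 : e \in w0 by rewrite m0 e1.
have e3 : e \in insb d2 y w0 by rewrite (perm_mem (perm_insb _ y0)) inE e0 orbT.
rewrite (next_insb U1 v0 d11 e3) (next_insb U0 y0 d20 e0) (n0 e e1 e2) /=.
move: (if next w e == d2 then x else if next w e == d1 then u else next w e).
move=> e'.
case: (eqVneq e' y) => [->|ney] //.
by rewrite [d2 == v]eq_sym (negPf v_d2) (negPf (y_v_ne ne)).
Qed.

Lemma flip_rot_d1 : srot st' d1 = y.
Proof.
rewrite /srot /= flip_next eqxx; case: eqVneq => //.
Qed.

Lemma flip_rot_d2 : srot st' d2 = v.
Proof.
have -> : srot st' d2 = next flip_wd d1 by rewrite /srot oppK.
by rewrite flip_next eqxx; case: (eqVneq d2 d1) => // ->.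
Qed.

Lemma opp_ne12 e : e != d1 -> e != d2 -> (opp e != d1) * (opp e != d2).
Proof.
move=> e1 e2; split; last by rewrite (inj_eq opp_inj).
by apply: contra e2 => /eqP <-; rewrite oppK.
Qed.

Lemma flip_rot_other e : e != d1 -> e != d2 ->
  srot st' e = let e0 := srot st e in
       let e1 := if e0 == d2 then x else if e0 == d1 then u else e0 in
       if e1 == v then d1 else if e1 == y then d2 else e1.
Proof.
move=> e1 e2; rewrite /srot /= flip_next.
by case: (opp_ne12 e1 e2) => /negPf -> /negPf ->.
Qed.

Lemma flip_rot_x : srot st' x = d2.
Proof.
rewrite flip_rot_other ?x_d1 ?x_d2 //= (negPf y_d2) (negPf y_d1).
case: (eqVneq y v) => [Eyv|_]; last by rewrite eqxx.
case: (eqVneq d2 d1) => [->|ne] //.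
by have := y_v_ne ne; rewrite Eyv eqxx.
Qed.

Lemma flip_rot_u : srot st' u = d1.
Proof.
by rewrite flip_rot_other ?u_d1 ?u_d2 //= (negPf v_d2) (negPf v_d1) eqxx.
Qed.

Lemma flip_rot_y : srot st' y = u.
Proof.
rewrite flip_rot_other ?y_d1 ?y_d2 //= srot_y eqxx.
case: (eqVneq d1 d2) => [E|ne].
  by rewrite (negPf x_v_ne) (negPf x_y) -E.
by rewrite (negPf u_v) (negPf u_y_ne).
Qed.

Lemma flip_rot_v : srot st' v = x.
Proof.
rewrite flip_rot_other ?v_d1 ?v_d2 //= srot_v eqxx.
by rewrite (negPf x_v_ne) (negPf x_y).
Qed.

Lemma flip_rot_id e : e \notin [:: d1; d2; x; y; u; v] ->
  srot st' e = srot st e.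
Proof.
rewrite !inE !negb_or => /and5P[e1 e2 ex ey /andP[eu ev]].
have N a : e != a -> srot st e != srot st a by rewrite (inj_eq (srot_inj wst)).
move: (N _ ev) (N _ ey) (N _ eu) (N _ ex); rewrite srot_v srot_y.
rewrite flip_rot_other //= => /negPf-> /negPf-> /negPf-> /negPf->.
by [].
Qed.

Definition six := [:: d1; d2; x; y; u; v].

Lemma six_rot e : (srot st e \in six) = (e \in six).
Proof.
have E1 a : srot st a \in six -> a \in six.
  have I b : (srot st a == srot st b) = (a == b) by rewrite (inj_eq (srot_inj wst)).
  move: (I y) (I v) (I d1) (I x) (I d2) (I u); rewrite srot_y srot_v !inE.
  by do 6 move=> ->; case/or4P=> [|||/or3P[]] ->; rewrite ?orbT.
apply/idP/idP => [|E]; first exact: E1.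
by apply/E1/E1; rewrite (wf_rot3 wst).
Qed.

Lemma flip_rot3 e : srot st' (srot st' (srot st' e)) = e.
Proof.
have [|e6] := boolP (e \in six).
  rewrite !inE; case/or4P=> [||| /or3P[]] /eqP->;
  by rewrite ?(flip_rot_d1, flip_rot_y, flip_rot_u, flip_rot_d2, flip_rot_v,
               flip_rot_x).
by rewrite !flip_rot_id ?six_rot // (wf_rot3 wst).
Qed.

Lemma flip_rot_neq e : srot st' e != e.
Proof.
have [|e6] := boolP (e \in six); last by rewrite flip_rot_id // (wf_rot_neq wst).
rewrite !inE; case/or4P=> [||| /or3P[]] /eqP->;
rewrite ?(flip_rot_d1, flip_rot_y, flip_rot_u, flip_rot_d2, flip_rot_v,
               flip_rot_x).
- exact: y_d1.
- exact: v_d2.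
- by rewrite eq_sym x_d2.
- exact: u_y_ne.
- by rewrite eq_sym u_d1.
- exact: x_v_ne.
Qed.

Lemma flip_xl e : xl st' e =
  if (e == d1) || (e == d2) then flip_var else xl st e.
Proof.
rewrite /xl /= /flip_lam; case: ifP => [/orP[]/eqP-> |/norP[e1 e2]].
- by have [k ->] := nB_side d1B; rewrite eqxx.
- by rewrite side_opp; have [k ->] := nB_side d1B; rewrite eqxx.
case E: (side e) => [k|] //; case: eqP => // Ek.
have [E1|E1] := sideP d1B (etrans E (esym Ek)); first by rewrite E1 eqxx in e1.
by rewrite E1 eqxx in e2.
Qed.

Lemma flip_th_d1 j : th st' d1 j = (th st v j + cminus j)%N.
Proof. by rewrite /= /flip_th eqxx. Qed.

Lemma flip_th_d2 j : th st' d2 j = (th st y j + cminus j)%N.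
Proof.
rewrite /= /flip_th eqxx; case: (eqVneq d2 d1) => // E; congr (th st _ _ + _)%N.
by rewrite E.
Qed.

Lemma flip_th_u j : th st' u j = tmin j.
Proof. by rewrite /= /flip_th (negPf u_d1) (negPf u_d2) eqxx. Qed.

Lemma flip_th_x j : th st' x j = minn (th st d2 j) (th st x j).
Proof.
rewrite /= /flip_th (negPf x_d1) (negPf x_d2) eqxx; case: (eqVneq x u) => // E.
by rewrite /tmin; move/(srot_inj wst): (E) => <-.
Qed.

Lemma flip_th_y j : th st' y j = (th st y j + cplus j)%N.
Proof.
rewrite /= /flip_th (negPf y_d1) (negPf y_d2) eqxx eq_sym (negPf u_y_ne) eq_sym.
by rewrite (negPf x_y).
Qed.

Lemma flip_th_v j : th st' v j = (th st v j + cplus j)%N.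
Proof.
rewrite /= /flip_th (negPf v_d1) (negPf v_d2) eqxx eq_sym (negPf u_v) eq_sym.
by rewrite (negPf x_v_ne); case: eqP => // ->.
Qed.

Lemma flip_th_id e j : e \notin six -> th st' e j = th st e j.
Proof.
rewrite !inE !negb_or => /and5P[e1 e2 ex ey /andP[eu ev]].
by rewrite /= /flip_th (negPf e1) (negPf e2) (negPf ex) (negPf ey) (negPf eu)
  (negPf ev).
Qed.

Lemma cross_d1 j : (th st d1 j + th st x j = th st d2 j + th st u j)%N.
Proof. exact: esym (wf_cross wst d1 j). Qed.

Lemma flip_cross e : e != d1 -> e != d2 -> cross st' e =1 cross st e.
Proof.
move=> e1 e2 j; have := cross_d1 j; rewrite /cross.
have [|e6] := boolP (e \in six).
  rewrite !inE (negPf e1) (negPf e2) !orFb => /or4P[]/eqP->.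
  - by rewrite flip_rot_x flip_th_x flip_th_d2 /cminus /tmin; lia.
  - by rewrite flip_rot_y flip_th_y flip_th_u srot_y /cplus /tmin; lia.
  - by rewrite flip_rot_u flip_th_u flip_th_d1 /cminus /tmin; lia.
  - by rewrite flip_rot_v flip_th_v flip_th_x srot_v /cplus /tmin; lia.
by rewrite flip_rot_id // !flip_th_id ?six_rot.
Qed.

Lemma flip_cross_opp e : cross st' (opp e) =1 cross st' e.
Proof.
move=> j; case: (eqVneq e d1) => [->|e1].
  by rewrite /cross flip_rot_d1 flip_rot_d2 flip_th_d1 flip_th_d2 flip_th_y
    flip_th_v; lia.
case: (eqVneq e d2) => [->|e2].
  by rewrite oppK /cross flip_rot_d1 flip_rot_d2 flip_th_d1 flip_th_d2 flip_th_y
    flip_th_v; lia.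
by rewrite !flip_cross ?(opp_ne12 e1 e2) // (wf_cross wst).
Qed.

Lemma flip_var_positive : positive flip_var.
Proof.
by apply: positive_mul; last (exact/positive_inv/xl_positive);
   apply: positive_add; (apply: positive_mul; first exact: positive_ymon);
   apply: positive_mul; apply: xl_positive.
Qed.

Lemma flip_pos k : positive (lam st' k).
Proof.
rewrite /= /flip_lam; case: ifP => _; [exact: flip_var_positive | exact: wf_pos].
Qed.

Lemma ymon_d1 : ymon (th st d1) = ymon cplus * ymon tmin.
Proof. by rewrite -ymonD; apply: eq_ymon => j; rewrite /cplus /tmin; lia. Qed.

Lemma ymon_u : ymon (th st u) = ymon cminus * ymon tmin.
Proof. by rewrite -ymonD; apply: eq_ymon => j; rewrite /cminus /tmin; lia. Qed.

(** The counterpart of [tmin] at the other end of the diagonal. By [wf_cross] the shear coordinate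
    is the same there, so [cplus] and [cminus] serve both ends. *)
Definition tmin2 j := minn (th st d2 j) (th st x j).

Lemma ymon_d2 : ymon (th st d2) = ymon cplus * ymon tmin2.
Proof.
rewrite -ymonD; apply: eq_ymon => j; have := cross_d1 j.
by rewrite /cplus /tmin /tmin2; lia.
Qed.

Lemma ymon_x : ymon (th st x) = ymon cminus * ymon tmin2.
Proof.
rewrite -ymonD; apply: eq_ymon => j; have := cross_d1 j.
by rewrite /cminus /tmin /tmin2; lia.
Qed.

Lemma flip_varE :
  flip_var * xl st d1
  = ymon cplus * (xl st x * xl st u) + ymon cminus * (xl st y * xl st v).
Proof. by rewrite divfK // xl_neq0. Qed.

Let flip_var_neq0 : flip_var != 0.
Proof. exact/positive_neq0/flip_var_positive. Qed.

Lemma flip_xls : (xl st' d1 = flip_var) * (xl st' d2 = flip_var) *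
  (xl st' x = xl st x) * (xl st' y = xl st y) * (xl st' u = xl st u) *
  (xl st' v = xl st v).
Proof.
rewrite !flip_xl !eqxx orbT (negPf x_d1) (negPf x_d2) (negPf y_d1) (negPf y_d2).
by rewrite (negPf u_d1) (negPf u_d2) (negPf v_d1) (negPf v_d2).
Qed.

Lemma flip_corner_u : corner st' u = corner st d1 + corner st u.
Proof.
rewrite /corner flip_rot_u flip_rot_d1 !flip_xls srot_v (eq_ymon flip_th_u).
by rewrite ymon_d1 ymon_u xl_opp merge_corners ?xl_neq0.
Qed.

Lemma flip_corner_x : corner st' x = corner st d2 + corner st x.
Proof.
rewrite /corner flip_rot_x flip_rot_d2 !flip_xls srot_y (eq_ymon flip_th_x).
rewrite ymon_d2 ymon_x xl_opp -/tmin2 /flip_var.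
by rewrite [xl st x * _]mulrC [xl st y * _]mulrC merge_corners ?xl_neq0.
Qed.

Lemma flip_corner_y : corner st' d2 + corner st' y = corner st y.
Proof.
rewrite /corner flip_rot_y flip_rot_u flip_rot_d2 flip_rot_v !flip_xls.
rewrite srot_y (eq_ymon flip_th_y) (eq_ymon flip_th_d2) !ymonD.
by apply: split_corner; rewrite ?xl_neq0 // flip_varE.
Qed.

Lemma flip_corner_v : corner st' d1 + corner st' v = corner st v.
Proof.
rewrite /corner flip_rot_v flip_rot_x flip_rot_d1 flip_rot_y !flip_xls.
rewrite srot_v (eq_ymon flip_th_v) (eq_ymon flip_th_d1) !ymonD xl_opp.
apply: split_corner; rewrite ?xl_neq0 // flip_varE.
by rewrite [xl st x * _]mulrC [xl st y * _]mulrC.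
Qed.

Lemma flip_corner_id e : e \notin six -> corner st' e = corner st e.
Proof.
move=> e6; have e6' : srot st e \notin six by rewrite six_rot.
have X a : a \notin six -> xl st' a = xl st a.
  by rewrite flip_xl !inE !negb_or => /and3P[/negPf-> /negPf->].
rewrite /corner !flip_rot_id // !X ?six_rot //.
by congr (_ * _ / _); apply: eq_ymon => j; rewrite flip_th_id.
Qed.

Lemma pendingE k d : side d = Some k -> pending T k = (opp d == d).
Proof.
move=> dk; apply/existsP/idP => [[e /andP[/eqP ek /eqP ee]]|od].
  case/(side_arc e dk): ek => E; first by rewrite -E ee.
  by rewrite -E -{1}ee E oppK.
by exists d; rewrite dk od eqxx.
Qed.

Lemma ind_sum d k (F : D -> int) : side d = Some k ->
  \sum_e F e * ind e k = F d + (if opp d == d then 0 else F (opp d)).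
Proof.
move=> dk; have indE e : ind e k = (((e == d) || (e == opp d)) : nat)%:Z.
  congr Posz; congr nat_of_bool; apply/eqP/orP.
    by move/(side_arc e dk) => [] ->; [left | right].
  by case=> /eqP ->; rewrite ?side_opp.
rewrite (bigD1 d) //= indE eqxx mulr1; congr (_ + _).
case: (eqVneq (opp d) d) => [E|ne].
  by rewrite big1 // => e /negPf ed; rewrite indE E ed mulr0.
rewrite (bigD1 (opp d)) //= indE eqxx orbT mulr1 big1 ?addr0 // => e.
by case/andP=> /negPf ed /negPf eo; rewrite indE ed eo mulr0.
Qed.

Lemma adj_col (r : D -> D) (r3 : forall d, r (r (r d)) = d) i k d :
  side d = Some k ->
  adj r i k = ind (r d) i - ind (r (r d)) i
    + (if opp d == d then 0 else ind (r (opp d)) i - ind (r (r (opp d))) i).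
Proof.
move=> dk; rewrite /adj sumrB.
have -> : \sum_e ind e i * ind (r e) k = \sum_e ind (r (r e)) i * ind e k.
  rewrite (reindex_onto (fun e => r (r e)) r) => [|e _]; last exact: r3.
  by apply: eq_big => [e|e _]; rewrite r3 ?eqxx.
rewrite !(ind_sum _ dk); case: ifP => _; first by rewrite !addr0.
by rewrite opprD addrACA.
Qed.

Lemma adj_anti r i j : adj r j i = - adj r i j.
Proof.
rewrite /adj -sumrN; apply: eq_bigr => d _.
by rewrite opprB [ind _ j * _]mulrC [ind d j * _]mulrC.
Qed.

Lemma sum_change (V : zmodType) (F F' : D -> V) (s : seq D) : uniq s ->
  (forall d, d \notin s -> F' d = F d) ->
  \sum_d F' d = \sum_d F d + \sum_(d <- s) (F' d - F d).
Proof.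
move=> Us E; apply/eqP; rewrite addrC -subr_eq; apply/eqP.
rewrite -sumrB (big_uniq _ Us) /= [RHS]big_mkcond /=.
apply: eq_bigr => d _; case: ifPn => // /E ->; exact: subrr.
Qed.

(** Up to the factor [fmul], which doubles the column of a pending arc, [pnum] and [mnum] are the
    positive and negative parts of the exchange column at [d1]. *)
Definition pnum i : nat := (nind x i + (if d2 == d1 then 0 else nind u i))%N.
Definition mnum i : nat := (nind y i + (if d2 == d1 then 0 else nind v i))%N.

Lemma nind_disj a b i : a != b -> opp a != b -> (nind a i * nind b i = 0)%N.
Proof.
rewrite /nind => ab oab; case: eqP => // ai; case: eqP => // bi.
case/(side_arc b ai): bi => E; first by rewrite E eqxx in ab.
by rewrite E eqxx in oab.
Qed.

Lemma opp_x_v : opp x != v.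
Proof.
apply/eqP => E; have := next2_neq wst d2.
by rewrite next_x next_srot E srot_v eqxx.
Qed.

Lemma opp_u_y : opp u != y.
Proof.
apply/eqP => E; have := next2_neq wst d1.
by rewrite next_u next_srot E srot_y eqxx.
Qed.

(** If one of [x], [u] were glued to one of [y], [v], then [next] would have a cycle of length at
    most two. So no cancellation occurs in the exchange column, and exponents can be read off from
    its two parts. *)
Lemma pm_disj i : (pnum i * mnum i = 0)%N.
Proof.
have H1 := nind_disj i x_y (opp_neq_srot wst x).
have H2 := nind_disj i x_v_ne opp_x_v.
have H3 := nind_disj i u_y_ne opp_u_y.
have H4 := nind_disj i u_v (opp_neq_srot wst u).
rewrite /pnum /mnum; case: ifP => _; first by rewrite !addn0.
by rewrite mulnDl !mulnDr H1 H2 H3 H4.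
Qed.

Definition fmul : nat := if d2 == d1 then 2 else 1.

Lemma adj_k i k : side d1 = Some k ->
  adj (srot st) i k = (pnum i)%:Z - (mnum i)%:Z.
Proof.
move=> dk; rewrite (adj_col (wf_rot3 wst) i dk) /pnum /mnum /ind.
by case: ifP => _; lia.
Qed.

Lemma adj_k' i k : side d1 = Some k -> adj (srot st') i k = - adj (srot st) i k.
Proof.
move=> dk; rewrite (adj_k i dk) (adj_col flip_rot3 i dk) /pnum /mnum.
rewrite flip_rot_d1 flip_rot_y flip_rot_d2 flip_rot_v /ind.
by case: (eqVneq d2 d1) => [->|ne]; lia.
Qed.

Lemma uniq_six : uniq (if d2 == d1 then [:: d1; x; y] else six).
Proof.
case: ifPn => [_|ne] /=; rewrite !inE !negb_or.
  by rewrite !(eq_sym d1) x_d1 y_d1 x_y.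
rewrite !(eq_sym d1) !(eq_sym d2) x_d1 y_d1 u_d1 v_d1 x_d2 y_d2 u_d2 v_d2.
rewrite (eq_sym d1) ne.
by rewrite x_y u_v x_v_ne (x_u_ne ne) (y_v_ne ne) (eq_sym y) u_y_ne.
Qed.

Lemma adj_flip i j k : side d1 = Some k -> i != k -> j != k ->
  adj (srot st') i j = adj (srot st) i j
    + (fmul * (pnum i * mnum j))%:Z - (fmul * (mnum i * pnum j))%:Z.
Proof.
move=> dk ik jk.
have n1 i' : i' != k -> ind d1 i' = 0.
  by rewrite /ind /nind dk eq_sym => ne; case: eqP => // - [E]; rewrite E eqxx in ne.
have n2 i' : i' != k -> ind d2 i' = 0 by rewrite /ind /nind side_opp; exact: n1.
pose s := if d2 == d1 then [:: d1; x; y] else six.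
have Us : uniq s by exact: uniq_six.
have Es d : d \notin s -> srot st' d = srot st d.
  move=> ds; apply: flip_rot_id; move: ds; rewrite /s; case: eqP => // ->.
  by rewrite !inE !negb_or => /and3P[-> -> ->].
rewrite /adj (@sum_change _ (fun d => ind (srot st d) i * ind d j
  - ind d i * ind (srot st d) j) _ s Us) => [|d ds]; last by rewrite Es.
rewrite -addrA; congr (_ + _); rewrite /s /fmul /pnum /mnum.
case: (eqVneq d2 d1) => [E|ne].
  have eu : u = x by rewrite E.
  rewrite !big_cons big_nil flip_rot_d1 flip_rot_x flip_rot_y srot_y eu.
  by rewrite !n1 // !n2 // /ind; lia.
rewrite /six !big_cons big_nil flip_rot_d1 flip_rot_x flip_rot_y flip_rot_d2.
rewrite flip_rot_u flip_rot_v srot_y srot_v !n1 // !n2 // /ind; lia.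
Qed.

Lemma wgt_k k : side d1 = Some k -> wgt k = fmul%:Z.
Proof. by move=> dk; rewrite /wgt (pendingE dk) /fmul; case: ifP. Qed.

Lemma sg_max_ge0 (a b : int) : 0 <= a ->
  Num.sg a * Num.max 0 (a * b) = a * Num.max 0 b.
Proof.
rewrite le_eqVlt => /orP[/eqP<-|a0]; first by rewrite sgr0 !mul0r.
by rewrite gtr0_sg // mul1r maxr_pMr ?ltW // mulr0.
Qed.

Lemma sg_max_le0 (a b : int) : a <= 0 ->
  Num.sg a * Num.max 0 (a * b) = a * Num.max 0 (- b).
Proof.
move=> a0; have := sg_max_ge0 (- b) (a := - a); rewrite oppr_ge0 sgrN mulrNN.
by move/(_ a0)/eqP; rewrite !mulNr eqr_opp => /eqP.
Qed.

(** Once positive and negative parts are disjoint, the sign and the maximum in the mutation rule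
    reduce to products: [p] pairs with [m'], and [m] with [p']. *)
Lemma mutation_entry (f w p m p' m' : nat) : (p * m = 0)%N -> (p' * m' = 0)%N ->
  Num.sg ((p%:Z - m%:Z) * f%:Z)
    * Num.max 0 ((p%:Z - m%:Z) * f%:Z * (- (p'%:Z - m'%:Z) * w%:Z))
  = (f * (p * m'))%:Z * w%:Z - (f * (m * p'))%:Z * w%:Z.
Proof.
move=> /eqP; rewrite muln_eq0 => pm /eqP; rewrite muln_eq0 => pm'.
have mx (a b : nat) : Num.max 0 (a%:Z * b%:Z) = a%:Z * b%:Z.
  by rewrite max_r // mulr_ge0.
have mxN (a b : nat) : Num.max 0 (- (a%:Z * b%:Z)) = 0.
  by rewrite max_l // oppr_le0 mulr_ge0.
case/orP: pm => /eqP->; last first.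
  rewrite subr0 sg_max_ge0 ?mulr_ge0 //.
  case/orP: pm' => /eqP->.
    by rewrite sub0r opprK mx !PoszM; ring.
  by rewrite subr0 mulNr mxN !PoszM; ring.
rewrite sub0r sg_max_le0 ?mulNr ?oppr_le0 ?mulr_ge0 //.
rewrite opprK mul0n muln0 mul0r sub0r; congr (- _).
case/orP: pm' => /eqP->.
  have -> : (0%:Z - m'%:Z) * w%:Z = - (m'%:Z * w%:Z) by ring.
  by rewrite mxN !muln0 mulr0 mul0r.
have -> : (p'%:Z - 0%:Z) * w%:Z = p'%:Z * w%:Z by ring.
by rewrite mx !PoszM; ring.
Qed.

Lemma mutation_coef (cp cm w p m : nat) : (cp * cm = 0)%N -> (p * m = 0)%N ->
  Num.sg (cp%:Z - cm%:Z)
    * Num.max 0 ((cp%:Z - cm%:Z) * (- (p%:Z - m%:Z) * w%:Z))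
  = (cp%:Z * m%:Z - cm%:Z * p%:Z) * w%:Z.
Proof.
move=> cc pm; have := mutation_entry 1 w cc pm.
by rewrite !mulr1 => ->; rewrite !mul1n !PoszM mulrBl.
Qed.

Lemma cpm j : (cplus j * cminus j = 0)%N.
Proof. by rewrite /cplus /cminus /tmin; case: leqP; lia. Qed.

Lemma flip_th_change d j : d != d1 -> d != d2 ->
  (th st' d j)%:Z - (th st d j)%:Z
  = (cplus j)%:Z * (((d == y) + (if d2 == d1 then 0 else d == v))%N)%:Z
    - (cminus j)%:Z * (((d == x) + (if d2 == d1 then 0 else d == u))%N)%:Z.
Proof.
move=> e1 e2; have C := cross_d1 j.
have [|d6] := boolP (d \in six); last first.
  rewrite flip_th_id // subrr; move: d6; rewrite !inE !negb_or.
  case/and5P=> _ _ /negPf-> /negPf-> /andP[/negPf-> /negPf->].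
  by rewrite !if_same /= !mulr0 subrr.
rewrite !inE (negPf e1) (negPf e2) !orFb => /or4P[]/eqP->.
- rewrite flip_th_x eqxx (negPf x_y) (negPf x_v_ne) !if_same.
  case: (eqVneq d2 d1) => [_|/x_u_ne/negPf->];
  by rewrite /cminus /tmin; lia.
- rewrite flip_th_y eqxx !(eq_sym y) (negPf x_y) (negPf u_y_ne) !if_same.
  case: (eqVneq d2 d1) => [_|/y_v_ne/negPf]; first by lia.
  by rewrite eq_sym => ->; lia.
- rewrite flip_th_u eqxx (negPf u_y_ne) (negPf u_v) !if_same.
  rewrite /cminus /tmin; case: (eqVneq d2 d1) => [E|/x_u_ne/negPf].
    by rewrite E eqxx; lia.
  by rewrite eq_sym => ->; lia.
- rewrite flip_th_v eqxx !(eq_sym v) (negPf u_v) (negPf x_v_ne) !if_same.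
  case: (eqVneq d2 d1) => [->|/y_v_ne/negPf->]; first by rewrite eqxx; lia.
  by lia.
Qed.

Lemma diff_change (a a' b b' o o' : nat) : (o' + b' = o + b)%N ->
  a'%:Z - b'%:Z = (a%:Z - b%:Z) + ((a'%:Z - a%:Z) + (o'%:Z - o%:Z)) :> int.
Proof. by lia. Qed.

Lemma prod_pos (m : nat) (F : 'I_m -> K) (b : 'I_m -> int) (p q : 'I_m -> nat) :
  (forall i, p i * q i = 0)%N -> (forall i, b i = (p i)%:Z - (q i)%:Z) ->
  (\prod_(i | (0 < b i)%R) F i ^+ `|b i|%N = \prod_i F i ^+ p i) *
  (\prod_(i | (b i < 0)%R) F i ^+ `|b i|%N = \prod_i F i ^+ q i).
Proof.
move=> pq bE; rewrite !(big_mkcond (fun i => _ < _)) /=.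
split; apply: eq_bigr => i _; have := pq i; rewrite bE => /eqP;
  rewrite muln_eq0; case: (p i) (q i) => [|a] [|c] //= _.
  by rewrite addn0.
by rewrite subn0.
Qed.

Lemma prod_nind (F : 'I_n -> K) d : \prod_i F i ^+ nind d i =
  if side d is Some k then F k else 1.
Proof.
rewrite /nind; case E: (side d) => [k|]; last by rewrite big1.
rewrite (bigD1 k) //= eqxx expr1 big1 ?mulr1 // => i ik.
by case: eqP => // - [E']; rewrite E' eqxx in ik.
Qed.

Lemma split_ext (F : 'I_(n + n) -> K) (P : pred 'I_(n + n)) :
  \prod_(i | P i) F i =
  (\prod_(i | P (lshift n i)) F (lshift n i))
  * (\prod_(i | P (rshift n i)) F (rshift n i)).
Proof. by rewrite big_split_ord. Qed.

Lemma ext_lshift (S : seed n) i : extended_cluster S (lshift n i) = cluster S i.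
Proof. by rewrite /extended_cluster (unsplitK (inl i)). Qed.

Lemma ext_rshift (S : seed n) i : extended_cluster S (rshift n i) = yvar i.
Proof. by rewrite /extended_cluster (unsplitK (inr i)). Qed.

(** Mutation at the arc [k] of [d1] is the flip. The exchange column shows the sides of the
    quadrilateral in its upper half and the shear coordinates of [d1] in its lower half, hence gives
    [flip_var]; the other columns change only through arcs bounding the quadrilateral. *)
Lemma realized_flip : realized st'.
Proof.
have [S [rS clS topS botS]] := wf_real wst.
have [k dk] := nB_side d1B.
exists (mutation k S); split; first exact: reach_mutation.
- move=> i /=; rewrite /flip_lam dk; case: (eqVneq i k) => [->|ik].
    rewrite eqxx /mutated_variable /flip_var; congr (_ / _); last first.
      by rewrite clS /xl dk.
    have top i0 : exmatrix S (lshift n i0) k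
        = (pnum i0 * fmul)%:Z - (mnum i0 * fmul)%:Z.
      by rewrite topS (adj_k _ dk) (wgt_k dk) mulrBl !PoszM.
    have bot j0 : exmatrix S (rshift n j0) k = (cplus j0)%:Z - (cminus j0)%:Z.
      by rewrite (botS j0 k d1 dk) next_u /cplus /cminus /tmin; lia.
    have pmf i0 : (pnum i0 * fmul * (mnum i0 * fmul) = 0)%N.
      by rewrite mulnACA pm_disj.
    (* For a pending arc [u = x] and [v = y], and the doubled column yields the squares of the
       exchange relation. *)
    have pe (a b : D) : (d2 == d1 -> b = a) ->
        \prod_i0 cluster S i0 ^+ ((nind a i0 + (if d2 == d1 then 0 else nind b i0))
           * fmul) = xl st a * xl st b.
      have X c : \prod_i0 cluster S i0 ^+ nind c i0 = xl st c.
        rewrite prod_nind /xl; case: (side c) => // c'; exact: clS.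
      rewrite /fmul; case: ifP => [_ /(_ isT) -> |_ _].
        by rewrite -X -big_split; apply: eq_bigr => i0 _; rewrite addn0 muln2
          -addnn exprD.
      by rewrite -!X -big_split; apply: eq_bigr => i0 _; rewrite muln1 exprD.
    rewrite !split_ext.
    under eq_bigr => i0 _ do rewrite ext_lshift.
    under [X in _ * X + _]eq_bigr => i0 _ do rewrite ext_rshift.
    under [X in _ + X * _]eq_bigr => i0 _ do rewrite ext_lshift.
    under [X in _ + _ * X]eq_bigr => i0 _ do rewrite ext_rshift.
    rewrite !(prod_pos _ pmf top) !(prod_pos _ cpm bot).
    rewrite !pe => [|/eqP->|/eqP->] //.
    by rewrite [ymon cplus * _]mulrC [ymon cminus * _]mulrC.
  by case: eqP => [[E]|_]; [rewrite E eqxx in ik | exact: clS].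
- move=> i j /=; rewrite mxE.
  case: (eqVneq j k) => [->|jk].
    by rewrite orbT topS adj_k' // mulNr.
  rewrite orbF (inj_eq (@lshift_inj n n)); case: (eqVneq i k) => [->|ik].
    by rewrite topS ![adj _ k j]adj_anti adj_k' // !mulNr opprK.
  rewrite (adj_flip dk ik jk) !topS (adj_k i dk) (wgt_k dk).
  rewrite [adj _ k j]adj_anti (adj_k j dk) -[wgt j]/(wgt j).
  have -> : wgt j = (if pending T j then 2 else 1)%N%:Z by rewrite /wgt; case: ifP.
  rewrite mutation_entry ?pm_disj //; ring.
move=> j i d di /=; rewrite mxE.
case: (eqVneq i k) => [E|ik].
  rewrite orbT E; move: di; rewrite E => di.
  rewrite (botS j k d1 dk) next_u.
  have C := cross_d1 j.
  have [->|->] : d = d1 \/ d = d2 by apply: sideP => //; rewrite di dk.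
    have -> : next flip_wd d1 = v by rewrite -flip_rot_d2 /srot oppK.
    by rewrite -[flip_th _ _]/(th st' d1 j) -[flip_th v _]/(th st' v j)
      flip_th_d1 flip_th_v /cplus /cminus /tmin; lia.
  have -> : next flip_wd d2 = y by rewrite -flip_rot_d1 /srot.
  by rewrite -[flip_th _ _]/(th st' d2 j) -[flip_th y _]/(th st' y j)
    flip_th_d2 flip_th_y /cplus /cminus /tmin; lia.
rewrite orbF eq_rlshift.
have dn e : side e = Some i -> (e != d1) && (e != d2).
  move=> ei; apply/andP; split; apply: contraNneq ik => E;
  by move: ei; rewrite E ?side_opp dk => - [->].
have /andP[e1 e2] := dn d di.
have oi : side (opp d) = Some i by rewrite side_opp.
have /andP[o1 o2] := dn _ oi.
have nE s : next (wd s) d = srot s (opp d) by rewrite /srot oppK.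
rewrite (botS j i d di) (botS j k d1 dk) next_u topS adj_anti (adj_k i dk).
have -> : wgt i = (if pending T i then 2 else 1)%N%:Z by rewrite /wgt; case: ifP.
have -> : (th st d1 j)%:Z - (th st u j)%:Z = (cplus j)%:Z - (cminus j)%:Z.
  by rewrite /cplus /cminus /tmin; lia.
rewrite mutation_coef ?cpm ?pm_disj // -[flip_wd]/(wd st') !nE.
rewrite -[flip_th _ _]/(th st' d j) -[flip_th (srot _ _) _]/(th st' (srot st' (opp d)) j).
have := flip_cross o1 o2 j; rewrite /cross => Co.
have H1 := flip_th_change j e1 e2; have H2 := flip_th_change j o1 o2.
have ndE (a : D) : nind a i = if opp d == d then (a == d) : nat
                      else ((d == a) + (opp d == a))%N.
  rewrite /nind; have -> : (side a == Some i) = (a == d) || (a == opp d).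
    apply/eqP/orP => [/(side_arc a di) [->|->]|[]/eqP->] //; rewrite ?eqxx; auto.
  case: (eqVneq (opp d) d) => [->|ne]; first by rewrite orbb.
  rewrite !(eq_sym a); case: eqP => [<-|//] /=; by rewrite (negPf ne).
(* The crossing number of [opp d] is unchanged, so the corner after [d] changes by the negative of
   the change at [opp d]. *)
have -> : (th st' d j)%:Z - (th st' (srot st' (opp d)) j)%:Z
    = ((th st d j)%:Z - (th st (srot st (opp d)) j)%:Z)
      + (((th st' d j)%:Z - (th st d j)%:Z)
         + ((th st' (opp d) j)%:Z - (th st (opp d) j)%:Z)).
  exact: diff_change.
congr (_ + _); rewrite {}H1 {}H2 /pnum /mnum !ndE (pendingE di).
rewrite !(eq_sym _ d); move: (cplus j) (cminus j) => cp cm.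
case: (eqVneq (opp d) d) => [->|ne]; case: (d2 == d1);
  rewrite ?(eq_sym x d) ?(eq_sym y d) ?(eq_sym u d) ?(eq_sym v d) !PoszD.
- ring.
- ring.
- ring.
- ring.
Qed.

Lemma wf_flip : wf st'.
Proof.
split=> [||||||| ]; rewrite ?[wd _]/flip_wd.
- by have [] := flip_size.
- exact: mem_flip.
- exact: flip_last.
- exact: flip_rot3.
- exact: flip_rot_neq.
- by move=> d j; apply: flip_cross_opp.
- exact: flip_pos.
- exact: realized_flip.
Qed.

End Flip.

(* [rin s p q d]: the corner of [d] lies after [p] and not after [q]; the
   boundary segment, although last in the list, also stands for its start. *)
Definition rin (s : seq D) p q d :=
  ((p == B) || (index p s < index d s)%N) && (index d s <= index q s)%N.

Definition psum st q : K := \sum_(d | rin (wd st) B q d) corner st d.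

Definition low st p q (b : 'I_n -> nat) :=
  forall d, rin (wd st) p q d -> forall j, (b j <= th st d j)%N.

(** What flips of arcs outside [P] preserve. Individual exponents are not preserved; a common lower
    bound over an interval is. *)
Record frame (P : pred D) st st' : Prop := Frame {
  fr_filter : filter P (wd st') = filter P (wd st);
  fr_xl : forall d, P d -> xl st' d = xl st d;
  fr_psum : forall d, P d -> psum st' d = psum st d;
  fr_low : forall p q b, P p -> P q -> low st p q b -> low st' p q b;
  fr_cross : forall d, P d -> cross st' d =1 cross st d }.

Lemma frame_refl P st : frame P st st.
Proof. by []. Qed.

Lemma frame_trans P st1 st2 st3 :
  frame P st1 st2 -> frame P st2 st3 -> frame P st1 st3.
Proof.
move=> [f1 x1 s1 l1 c1] [f2 x2 s2 l2 c2]; split.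
- by rewrite f2 f1.
- by move=> d Pd; rewrite x2 ?x1.
- by move=> d Pd; rewrite s2 ?s1.
- by move=> p q b Pp Pq /l1 L; apply: l2 => //; apply: L.
- by move=> d Pd j; rewrite c2 ?c1.
Qed.

(** * Intervals of corners and their invariance under flips *)

Section Runs.

Variables (st : state) (wst : wf st).

Lemma index_wd_inj p q : index p (wd st) = index q (wd st) -> p = q.
Proof.
move=> E; have := nth_index B (wf_all wst p).
by rewrite E nth_index ?(wf_all wst).
Qed.

Lemma index_next_wd d : d != B ->
  index (next (wd st) d) (wd st) = (index d (wd st)).+1.
Proof.
move=> dB; apply: index_next; rewrite ?(wf_uniq wst) ?(wf_all wst) //.
by rewrite (wf_last wst).
Qed.

Lemma rin_next d p q : d != B -> p != d -> q != d ->
  rin (wd st) p q d = rin (wd st) p q (next (wd st) d).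
Proof.
move=> dB pd qd; rewrite /rin index_next_wd // ltnS.
congr (_ && _); first congr (_ || _).
  rewrite [RHS]leq_eqVlt; case: eqP => // E.
  by rewrite (index_wd_inj E) eqxx in pd.
rewrite [LHS]leq_eqVlt; case: eqP => // E.
by rewrite (index_wd_inj E) eqxx in qd.
Qed.

Lemma rin_filter (P : pred D) (s s' : seq D) p q d : P p -> P q -> P d ->
  filter P s' = filter P s -> rin s' p q d = rin s p q d.
Proof.
move=> Pp Pq Pd E; rewrite /rin (leqNgt (index d s')) (leqNgt (index d s)).
rewrite -(index_filter_lt s' Pp Pd) -(index_filter_lt s Pp Pd).
by rewrite -(index_filter_lt s' Pq Pd) -(index_filter_lt s Pq Pd) E.
Qed.

End Runs.

Lemma next_flip_d1 st (wst : wf st) d1 :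
  next (flip_wd st d1) d1 = srot st (srot st (opp d1)).
Proof. by rewrite -(flip_rot_d2 wst) /srot oppK. Qed.

Lemma next_flip_d2 st (wst : wf st) d1 :
  next (flip_wd st d1) (opp d1) = srot st (srot st d1).
Proof. by rewrite -(flip_rot_d1 wst). Qed.

Section FrameFlip.

Variables (st : state) (wst : wf st) (d1 : D) (d1B : d1 != B).

Local Notation d2 := (opp d1).
Local Notation x := (srot st d1).
Local Notation y := (srot st x).
Local Notation u := (srot st d2).
Local Notation v := (srot st u).
Local Notation st' := (flip st d1).

Let d2B : d2 != B. Proof. by rewrite oppB_eq. Qed.

Section Ends.

Variables (p q : D).
Hypotheses (p1 : p != d1) (p2 : p != d2) (q1 : q != d1) (q2 : q != d2).

Lemma rin_d1 : rin (wd st) p q d1 = rin (wd st) p q u.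
Proof. by rewrite (rin_next wst d1B p1 q1) next_srot. Qed.

Lemma rin_d2 : rin (wd st) p q d2 = rin (wd st) p q x.
Proof. by rewrite (rin_next wst d2B p2 q2). Qed.

Lemma rin_flip d : d != d1 -> d != d2 ->
  rin (wd st') p q d = rin (wd st) p q d.
Proof.
move=> e1 e2; apply: (rin_filter (P := predC (pred2 d1 d2)));
  rewrite /= ?negb_or ?p1 ?q1 ?e1 //.
by apply: flip_filter; rewrite /= eqxx ?orbT.
Qed.

Lemma rin_flip_d1 : rin (wd st') p q d1 = rin (wd st) p q v.
Proof.
rewrite (rin_next (wf_flip wst d1B) d1B p1 q1) next_flip_d1 // rin_flip //.
  exact: v_d1.
exact: v_d2.
Qed.

Lemma rin_flip_d2 : rin (wd st') p q d2 = rin (wd st) p q y.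
Proof.
rewrite (rin_next (wf_flip wst d1B) d2B p2 q2) next_flip_d2 // rin_flip //.
  exact: y_d1.
exact: y_d2.
Qed.

End Ends.

(** As [q] is not flipped, it separates neither two corners that merge nor the two halves of a
    corner that is split. *)
Lemma psum_flip q : q != d1 -> q != d2 -> psum st' q = psum st q.
Proof.
move=> q1 q2; rewrite /psum.
have [B1 B2] : B != d1 /\ B != d2 by rewrite !(eq_sym B).
have R1 := rin_d1 B1 q1; have R2 := rin_d2 B2 q2.
have R1' := rin_flip_d1 B1 B2 q1 q2; have R2' := rin_flip_d2 B1 B2 q1 q2.
have RR := rin_flip B1 B2 q1 q2.
rewrite big_mkcond [RHS]big_mkcond /=.
pose s := if d2 == d1 then [:: d1; x; y] else six st d1.
have [x1 x2 y1 y2] : [/\ x != d1, x != d2, y != d1 & y != d2].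
  by split; [exact: x_d1|exact: x_d2|exact: y_d1|exact: y_d2].
have [u1 u2 v1 v2] : [/\ u != d1, u != d2, v != d1 & v != d2].
  by split; [exact: u_d1|exact: u_d2|exact: v_d1|exact: v_d2].
have Us : uniq s by exact: uniq_six.
rewrite (sum_change (F := fun d => if rin (wd st) B q d then corner st d else 0)
  Us) => [|d ds].
  rewrite /s /six; case: (eqVneq d2 d1) => [E|ne]; rewrite !big_cons big_nil;
    rewrite R1 R1' ?R2 ?R2' !RR //.
    have -> : u = x by rewrite E.
    rewrite regroup3 ?addr0 //; first by rewrite flip_corner_x // E.
    by rewrite -(flip_corner_y wst d1B) E.
  rewrite regroup6 ?addr0 //.
  - exact: flip_corner_u.
  - exact: flip_corner_x.
  - exact: flip_corner_y.
  - exact: flip_corner_v.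
have d6 : d \notin six st d1.
  move: ds; rewrite /s; case: eqP => // E; rewrite /six E !inE !negb_or.
  by case/and3P=> -> -> ->.
have /andP[dd1 dd2] : (d != d1) && (d != d2).
  by move: d6; rewrite !inE !negb_or => /and3P[-> ->].
by rewrite RR // flip_corner_id.
Qed.

(** A merged corner takes the minimum of two exponents from the same interval, and a split corner
    only passes on larger ones. *)
Lemma low_flip p q b : p != d1 -> p != d2 -> q != d1 -> q != d2 ->
  low st p q b -> low st' p q b.
Proof.
move=> p1 p2 q1 q2 L d; case: (eqVneq d d1) => [->|dd1].
  rewrite rin_flip_d1 // => /L bv j; rewrite flip_th_d1.
  exact: leq_trans (bv j) (leq_addr _ _).
case: (eqVneq d d2) => [->|dd2].
  rewrite rin_flip_d2 // => /L bv j; rewrite flip_th_d2.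
  exact: leq_trans (bv j) (leq_addr _ _).
rewrite rin_flip // => Rd j.
have [|d6] := boolP (d \in six st d1); last by rewrite flip_th_id // L.
rewrite !inE (negPf dd1) (negPf dd2) !orFb => /or4P[]/eqP E; rewrite E in Rd *.
- by rewrite flip_th_x // leq_min !L // rin_d2.
- by rewrite flip_th_y // (leq_trans (L _ Rd j)) ?leq_addr.
- by rewrite flip_th_u // leq_min !L // rin_d1.
- by rewrite flip_th_v // (leq_trans (L _ Rd j)) ?leq_addr.
Qed.

Lemma frame_flip (P : pred D) : ~~ P d1 -> ~~ P d2 -> frame P st st'.
Proof.
move=> P1 P2; have N d : P d -> (d != d1) * (d != d2).
  by move=> Pd; split; [apply: contraNneq P1 | apply: contraNneq P2] => <-.
split.
- exact: flip_filter.
- by move=> d /N Pd; rewrite flip_xl // !(negPf (Pd.1), negPf (Pd.2)).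
- by move=> d /N Pd; apply: psum_flip; rewrite Pd.
- by move=> p q b /N Pp /N Pq; apply: low_flip; rewrite ?Pp ?Pq.
- by move=> d /N Pd; apply: flip_cross; rewrite ?Pd.
Qed.

End FrameFlip.

Lemma clean_arith (q e r : bool) (c m : nat) : (c <= (q && ~~ e) + m)%N ->
  (e -> r) -> (2 * c + ~~ q < 2 * ((~~ e && r) + m).+1 + ~~ r)%N.
Proof. by case: q; case: e; case: r => /= le_c er; rewrite ?er //; lia. Qed.

Lemma index_next_B st (wst : wf st) : index (next (wd st) B) (wd st) = 0%N.
Proof.
have s0 : (0 < size (wd st))%N by apply: ltn_trans (size_wd wst).
pose h := nth B (wd st) 0.
have h0 : index h (wd st) = 0%N by rewrite index_uniq ?(wf_uniq wst).
have nh : next (wd st) (prev (wd st) h) = h by rewrite next_prev ?(wf_uniq wst).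
case: (eqVneq (prev (wd st) h) B) => [E|ne]; first by rewrite -E nh.
by have := index_next_wd wst ne; rewrite nh h0.
Qed.

Lemma index_lt_B st (wst : wf st) d : (index B (wd st) < index d (wd st))%N = false.
Proof.
have [s E] : exists s, wd st = rcons s B.
  have := wf_last wst B; have := wf_all wst B.
  by case/lastP: (wd st) => // s b _; rewrite last_rcons => ->; exists s.
have Bs : B \notin s by have := wf_uniq wst; rewrite E rcons_uniq => /andP[].
have iB : index B (wd st) = size s.
  by rewrite E -cats1 index_cat (negPf Bs) /= eqxx addn0.
have := wf_all wst d; rewrite -index_mem iB E size_rcons ltnS => le_d.
by apply/negbTE; rewrite -leqNgt.
Qed.

(** Consecutive sides bound a single corner, the one of [b]. For [a = B] this corner is the first of
    the list, whence the value 0. *)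
Lemma xl_next st (wst : wf st) a b : next (wd st) a = b ->
  [/\ srot st (opp a) = b, srot st (srot st b) = opp a
    & psum st b - (if a == B then 0 else psum st a) = corner st b].
Proof.
move=> ab; have r1 : srot st (opp a) = b by rewrite /srot oppK.
split=> //; first by rewrite -r1 (wf_rot3 wst).
have Rb d : rin (wd st) B b d = (d == b) || (if a == B then false else rin (wd st) B a d).
  rewrite /rin eqxx /= leq_eqVlt; congr (_ || _).
    apply/eqP/eqP => [|->] //; exact: index_wd_inj.
  case: (eqVneq a B) => [aB|aB]; first by rewrite -ab aB index_next_B.
  by rewrite -ab index_next_wd // ltnS.
rewrite /psum (bigD1 b) ?Rb ?eqxx //=; set X := (if _ then _ else _).
suff -> : \sum_(d | rin (wd st) B b d && (d != b)) corner st d = X.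
  by rewrite addrK.
rewrite /X; case: (eqVneq a B) Rb => [_|aB] Rb.
  by rewrite big1 // => d; rewrite Rb orbF andbN.
apply: eq_bigl => d; rewrite Rb; case: (eqVneq d b) => [->|_] /=.
  by rewrite /rin eqxx -ab index_next_wd // ltnn.
by rewrite andbT.
Qed.

(** * Flipping away everything between two arcs *)

Section Clean.

Variables (P : pred D) (a b : D).
Hypotheses (PB : P B) (Popp : forall d, P (opp d) = P d).
Hypotheses (Pa : P a) (Pb : P b) (oab : opp a != b).

Definition btw (s : seq D) d :=
  ((a == B) || (index a s < index d s)%N) && (index d s < index b s)%N.

Let Bt st := [set d | btw (wd st) d].

(** Flipping [d1 = next a] moves [d2] in front of [opp a], out of the gap, and [d1] can stay in the
    gap only if [opp u] lies there, [u] being the new side after [a]. So if the number of sides in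
    the gap does not drop, then [d2] was outside, [opp u] is inside, and the second summand falls
    from 1 to 0. *)
Let mu st := (2 * #|Bt st| + (opp (next (wd st) a) \notin Bt st))%N.

Lemma btw_next st (wst : wf st) :
  (a == B) || (index a (wd st) < index b (wd st))%N ->
  next (wd st) a != b -> btw (wd st) (next (wd st) a).
Proof.
move=> ab nb; rewrite /btw; case: (eqVneq a B) ab nb => [->|aB] /= ab nb.
  rewrite index_next_B // lt0n; apply: contra nb => /eqP ib.
  by apply/eqP; apply: (index_wd_inj wst); rewrite ib index_next_B.
rewrite index_next_wd // leqnn /= ltn_neqAle ab andbT.
apply: contra nb => /eqP ib; apply/eqP; apply: (index_wd_inj wst).
by rewrite index_next_wd.
Qed.

Section Step.

Variables (st : state) (wst : wf st).
Hypothesis free : forall d, btw (wd st) d -> ~~ P d.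
Hypothesis d1btw : btw (wd st) (next (wd st) a).

Local Notation d1 := (next (wd st) a).
Local Notation d2 := (opp d1).
Local Notation u := (srot st d2).
Local Notation v := (srot st u).
Local Notation st' := (flip st d1).

Lemma step_P1 : ~~ P d1. Proof. exact: free. Qed.
Lemma step_P2 : ~~ P d2. Proof. by rewrite Popp step_P1. Qed.
Lemma step_ne d : P d -> (d != d1) * (d != d2).
Proof.
by move=> Pd; split; [apply: contraNneq step_P1 | apply: contraNneq step_P2] => <-.
Qed.
Lemma step_d1B : d1 != B. Proof. by rewrite eq_sym step_ne. Qed.
Let d2B : d2 != B. Proof. by rewrite oppB_eq step_d1B. Qed.

Lemma step_y : srot st (srot st d1) = opp a.
Proof.
apply: (srot_inj wst); rewrite (srot_y wst).
by rewrite /srot oppK.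
Qed.

Lemma step_index p q : p != d1 -> p != d2 -> q != d1 -> q != d2 ->
  (index p (wd st') < index q (wd st'))%N = (index p (wd st) < index q (wd st))%N.
Proof.
move=> p1 p2 q1 q2; pose Q := predC (pred2 d1 d2).
have Qp : Q p by rewrite /Q /= negb_or p1.
have Qq : Q q by rewrite /Q /= negb_or q1.
rewrite -(index_filter_lt _ Qp Qq) -(index_filter_lt (wd st) Qp Qq).
by rewrite flip_filter // /Q /= eqxx ?orbT.
Qed.

Lemma step_btw d : d != d1 -> d != d2 -> btw (wd st') d = btw (wd st) d.
Proof.
move=> e1 e2; have [a1 a2] := step_ne Pa; have [b1 b2] := step_ne Pb.
by rewrite /btw !step_index.
Qed.

Let wst' := wf_flip wst step_d1B.

(** With [d2] in the gap, its successor [opp a] would be in the gap as well or equal to [b]. The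
    former contradicts [opp a] being in [P], the latter [oab]. *)
Lemma step_d2_out : ~~ btw (wd st') d2.
Proof.
apply/negP => /andP[ad db].
have iy : index (opp a) (wd st') = (index d2 (wd st')).+1.
  by rewrite -(index_next_wd wst' d2B) next_flip_d2 // step_y.
have Py : P (opp a) by rewrite Popp.
have [y1 y2] := step_ne Py.
have yb : (index (opp a) (wd st') < index b (wd st'))%N.
  rewrite ltn_neqAle iy db andbT -iy; apply: contra oab => /eqP E.
  by apply/eqP; apply: (index_wd_inj wst' E).
case: (eqVneq a B) ad => [aB|aB] /= ad.
  have E : opp a = B by rewrite aB oppB.
  by rewrite E index_lt_B in yb.
have: btw (wd st') (opp a) by rewrite /btw yb andbT iy ltnW ?orbT.
by rewrite step_btw // => /free; rewrite Py.
Qed.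

Lemma step_d1_in : btw (wd st') d1 -> btw (wd st) (opp u).
Proof.
case/andP=> ad db.
have iv : index v (wd st') = (index d1 (wd st')).+1.
  by rewrite -(index_next_wd wst' step_d1B) next_flip_d1.
have [a1 a2] := step_ne Pa; have [b1 b2] := step_ne Pb.
have [v1 v2] : v != d1 /\ v != d2 by split; [exact: v_d1 | exact: v_d2].
have vb : (index v (wd st) <= index b (wd st))%N.
  by rewrite leqNgt -step_index // -leqNgt iv.
have av : (a == B) || (index a (wd st) < index v (wd st))%N.
  case: (eqVneq a B) ad => //= _ ad.
  by rewrite -step_index // iv ltnW.
have uy := u_y_ne wst d1; rewrite step_y in uy.
case: (eqVneq (opp u) B) => [E|uB].
  have uB : u = B by apply: opp_inj; rewrite E oppB.
  have v0 : index v (wd st) = 0%N by rewrite uB /srot oppB index_next_B.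
  move: av; rewrite v0 ltn0 orbF => /eqP aB.
  have E' : opp a = u by rewrite uB aB oppB.
  by rewrite E' eqxx in uy.
have it : index v (wd st) = (index (opp u) (wd st)).+1.
  by rewrite -index_next_wd.
rewrite /btw; move: vb; rewrite it => ->; rewrite andbT.
case/orP: av => [->|] //; rewrite it ltnS leq_eqVlt => /orP[/eqP E|->].
  have Ea : opp a = u by rewrite -[RHS]oppK -(index_wd_inj wst E).
  by rewrite Ea eqxx in uy.
by rewrite orbT.
Qed.

Lemma step_mu : (mu st' < mu st)%N.
Proof.
have na : next (wd st') a = u.
  by have := flip_rot_y wst d1; rewrite step_y => <-; exact: next_srot.
have [o1 o2] := opp_ne12 (u_d1 wst d1) (u_d2 wst d1).
have q : (opp u \in Bt st') = (opp u \in Bt st) by rewrite !inE step_btw.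
have d1in : d1 \in Bt st by rewrite inE.
rewrite /mu na q.
have sub : Bt st' \subset (if (opp u \in Bt st) && (d2 != d1) then [set d1] else set0)
            :|: (Bt st :\ d1 :\ d2).
  apply/subsetP => d; rewrite inE => bd; rewrite inE !inE.
  case: (eqVneq d d2) => [E|e2]; first by move: bd; rewrite E (negPf step_d2_out).
  case: (eqVneq d d1) => [E|e1].
    rewrite E in bd e2 *; rewrite step_d1_in // (eq_sym d2) e2 /=.
    by rewrite inE eqxx.
  by rewrite -(step_btw e1 e2) bd orbT.
have := subset_leq_card sub; set c := #|Bt st'|.
have c1 : #|Bt st| = #|Bt st :\ d1|.+1 by rewrite (cardsD1 d1 (Bt st)) d1in.
have c2 : (#|Bt st :\ d1| = (d2 \in Bt st :\ d1) + #|Bt st :\ d1 :\ d2|)%N.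
  exact: cardsD1.
rewrite c1 c2 !inE => /leq_trans/(_ (leq_card_setU _ _).1).
pose X : {set D} := if btw (wd st) (opp u) && (d2 != d1) then [set d1] else set0.
have -> : #|X| = (btw (wd st) (opp u) && (d2 != d1)) :> nat.
  by rewrite /X; case: ifP => _; rewrite ?cards1 ?cards0.
by move/clean_arith; apply => /eqP ->.
Qed.

End Step.

(** Induction on [mu], flipping the side right after [a] each time. *)
Lemma clean st : wf st -> (forall d, btw (wd st) d -> ~~ P d) ->
  (a == B) || (index a (wd st) < index b (wd st))%N ->
  exists st', [/\ wf st', frame P st st' & next (wd st') a = b].
Proof.
move: {2}_.+1 (ltnSn (mu st)) => m; elim: m st => // m IH st lt_mu wst free ab.
case: (eqVneq (next (wd st) a) b) => [E|ne].
  by exists st; split=> //; exact: frame_refl.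
have bn := btw_next wst ab ne.
have d1B := step_d1B free bn.
have [a1 a2] := step_ne free bn Pa; have [b1 b2] := step_ne free bn Pb.
have fr : frame P st (flip st (next (wd st) a)).
  by apply: frame_flip => //; [exact: step_P1 | exact: step_P2].
have [||||st' [wst' fr' E]] := IH (flip st (next (wd st) a)).
- exact: leq_trans (step_mu wst free bn) lt_mu.
- exact: wf_flip.
- move=> d; case: (eqVneq d (next (wd st) a)) => [->|e1]; first by
    move=> _; exact: step_P1.
  case: (eqVneq d (opp (next (wd st) a))) => [->|e2]; first by
    move=> _; exact: step_P2.
  by rewrite step_btw // => /free.
- by rewrite step_index.
by exists st'; split=> //; exact: frame_trans fr fr'.
Qed.

End Clean.

End Flips.

(** * Skeletons of triangulations *)

Section SkeletonWords.

Variable D : eqType.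
Implicit Types (s : seq D) (P : pred D) (a b e p q : D).

Lemma index_next_last s x0 : uniq s -> s != [::] ->
  index (next s (last x0 s)) s = 0%N.
Proof.
case: s => // a s Us _.
pose l := last x0 (a :: s).
have sl : l \in a :: s by rewrite /l /= mem_last.
case: (eqVneq (prev (a :: s) a) l) => [E|ne].
  by rewrite -/l -E next_prev // /= eqxx.
have := index_next Us (a := prev (a :: s) a); rewrite mem_prev mem_head.
by move/(_ isT ne); rewrite next_prev //= eqxx.
Qed.

Lemma next_filter_adj P s p q : uniq s -> p \in s -> P p -> P q ->
  next s p = q -> next (filter P s) p = q.
Proof.
move=> Us sp Pp Pq; have [i s' def_s] := rot_to sp.
have [j] := filter_rot_ex P i s.
rewrite -(next_rot i Us) -(next_rot j (filter_uniq _ Us)) => <-.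
rewrite def_s /= Pp /= ; case: s' {def_s} => [|b s'] /=; first by rewrite eqxx.
by rewrite eqxx => ->; rewrite Pq /= eqxx.
Qed.

Lemma next_filter_skip P s p e q : uniq s -> p \in s -> P p -> ~~ P e -> P q ->
  next s p = e -> next s e = q -> next (filter P s) p = q.
Proof.
move=> Us sp Pp Pe Pq; have [i s' def_s] := rot_to sp.
have [j] := filter_rot_ex P i s.
rewrite -!(next_rot i Us) -(next_rot j (filter_uniq _ Us)) => <-.
rewrite def_s /= Pp /=; case: s' {def_s} => [|b s'] /=.
  by rewrite eqxx => pe; rewrite -pe Pp in Pe.
rewrite eqxx => ->; rewrite (negPf Pe).
have /negPf -> : e != p by apply: contraNneq Pe => ->.
case: s' => [|c s'] /=; first by rewrite !eqxx.
by rewrite eqxx => ->; rewrite Pq /= eqxx.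
Qed.

Lemma next_split s p e : uniq s -> p \in s -> p != last p s -> next s p = e ->
  exists s1 s2, s = s1 ++ p :: e :: s2.
Proof.
move=> Us sp; case/splitPr: sp Us => s1 [|b s2] Us.
  by rewrite last_cat /= eqxx.
move=> _.
have := next_rot (size s1) Us p; rewrite rot_size_cat => <- /=.
by rewrite eqxx => <-; exists s1, s2.
Qed.

Lemma has_cons a s s1 : has (mem s1) (a :: s) = (a \in s1) || has (mem s1) s.
Proof. by []. Qed.

Lemma filter_predU1_notin P e s : e \notin s ->
  filter (predU1 e P) s = filter P s.
Proof.
move=> es; apply: eq_in_filter => a sa /=; case: eqVneq => // E.
by rewrite -E sa in es.
Qed.

Lemma filter_add_before P s e q : uniq s -> e \in s -> e != last e s ->
  next s e = q -> P q -> ~~ P e ->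
  filter (predU1 e P) s = insb e q (filter P s).
Proof.
move=> Us se le ne Pq Pe; have [s1 [s2 E]] := next_split Us se le ne.
move: Us; rewrite {}E cat_uniq !has_cons !cons_uniq !inE !negb_or -!andbA.
case/and5P=> _ e1 q1 _ /and3P[eq e2 _].
rewrite !filter_cat /= eqxx (negPf Pe) Pq orbT !filter_predU1_notin //.
by rewrite insb_cat // mem_filter negb_and q1 orbT.
Qed.

Lemma filter_add_after P s e p : uniq s -> p \in s -> p != last p s ->
  next s p = e -> P p -> ~~ P e ->
  filter (predU1 e P) s = insa p e (filter P s).
Proof.
move=> Us sp lp ne Pp Pe; have [s1 [s2 E]] := next_split Us sp lp ne.
move: Us; rewrite {}E cat_uniq !has_cons !cons_uniq !inE !negb_or -!andbA.
case/and5P=> _ p1 e1 _ /and4P[pe p2 e2 _].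
rewrite !filter_cat /= eqxx (negPf Pe) Pp orbT !filter_predU1_notin //.
by rewrite insa_cat // mem_filter negb_and p1 orbT.
Qed.

Lemma perm_insa p e s : p \in s -> perm_eq (insa p e s) (e :: s).
Proof.
elim: s => //= h s IH; rewrite inE eq_sym; case: eqP => [->|_] /=.
  by move=> _; apply/permP => r /=; rewrite addnCA.
move=> /IH; rewrite -(perm_cons h) => /perm_trans; apply.
by apply/permP => r /=; rewrite addnCA.
Qed.

Lemma filter_insa P p e s : ~~ P e -> filter P (insa p e s) = filter P s.
Proof.
move=> /negPf Pe; elim: s => //= h s IH; case: ifP => _ /=; first by rewrite Pe.
by rewrite IH.
Qed.

End SkeletonWords.

Section SkeletonMaps.

Variables (C D : eqType) (c : C -> D).

Lemma next_map_in s k : uniq s -> {in s &, injective c} -> k \in s ->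
  next (map c s) (c k) = c (next s k).
Proof.
move=> Us cI sk; have [i s' def_s] := rot_to sk.
have Um : uniq (map c s) by rewrite map_inj_in_uniq.
rewrite -(next_rot i Us) -(next_rot i Um) -map_rot def_s.
by case: s' def_s => [|b s'] _ /=; rewrite !eqxx.
Qed.

Lemma map_insb s e v : (forall a, a \in s -> c a = c v -> a = v) ->
  map c (insb e v s) = insb (c e) (c v) (map c s).
Proof.
elim: s => //= a s IH cI; rewrite (_ : (c a == c v) = (a == v)).
  by case: ifP => //= _; rewrite IH // => b bs; apply: cI; rewrite inE bs orbT.
by apply/eqP/eqP => [|-> //]; apply: cI; rewrite inE eqxx.
Qed.

Lemma map_insa s p e : (forall a, a \in s -> c a = c p -> a = p) ->
  map c (insa p e s) = insa (c p) (c e) (map c s).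
Proof.
elim: s => //= a s IH cI; rewrite (_ : (c a == c p) = (a == p)).
  by case: ifP => //= _; rewrite IH // => b bs; apply: cI; rewrite inE bs orbT.
by apply/eqP/eqP => [|-> //]; apply: cI; rewrite inE eqxx.
Qed.

Lemma index_map_in s k : {in s &, injective c} -> k \in s ->
  index (c k) (map c s) = index k s.
Proof.
elim: s => //= a s IH cI; rewrite inE.
case: (eqVneq a k) => [->|ak]; first by rewrite eqxx.
move=> /= ks.
rewrite IH //; last by move=> p q ps qs; apply: cI; rewrite inE ?ps ?qs orbT.
case: eqP => // E; case/eqP: ak; apply: cI; rewrite ?inE ?eqxx ?ks ?orbT //.
Qed.

End SkeletonMaps.

(** * Chords, forgetting and new arcs in skeletons *)

Section Skeletons.

Local Open Scope ring_scope.

Variables (n : nat) (T : triangulation n) (B : dart T).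
Hypothesis boundaryE : forall d : dart T, boundary d = (d == B).
Local Notation D := (dart T).
Local Notation opp := (@Defs.opp n T).
Local Notation K := (ambient n).
Local Notation A := (cluster_algebra (principal_seed (exchange_matrix T))).
Local Notation wf := (wf B).

(* Sides are coded by numbers: 0 is the boundary segment, and 2i-1, 2i are the
   two sides carrying the i-th arc. *)
Definition cop k := if k is k'.+1 then (if odd k' then k' else k'.+2) else 0%N.

Lemma copK : involutive cop.
Proof.
case=> [|k] //; rewrite /cop; case ok: (odd k) => /=; last by rewrite ok.
by case: k ok => //= k /negPf ->.
Qed.

(* A skeleton records what remains of a state when only the sides coded in [s]
   are remembered: their order, values, crossing numbers, the partial sums of
   the corners up to them, and lower bounds for the exponents of the corners
   between consecutive ones. *)
Definition skel (s : seq nat) (X P : nat -> K) (Bd I : nat -> 'I_n -> nat) :=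
  exists st c, [/\ wf st /\ c 0%N = B,
    uniq s /\ {in s &, injective c},
    forall k, k \in s -> cop k \in s /\ c (cop k) = opp (c k),
    filter (mem (map c s)) (wd st) = map c s
    & forall k, k \in s -> [/\ X k = xl st (c k), P k = psum B st (c k),
        I k =1 cross st (c k) & low B st (c (prev s k)) (c k) (Bd k)]].

(** The boundary segment stands for both ends of the list: as the left end of a gap it has partial
    sum 0, whereas [P 0] is the whole loop. *)
Definition P0 (P : nat -> K) k := if k == 0%N then 0 else P k.

Section Order.

Variables (s : seq nat) (st : state T) (c : nat -> D).
Hypotheses (wst : wf st) (c0 : c 0%N = B) (Us : uniq s) (s0 : 0%N \in s).
Hypotheses (cI : {in s &, injective c})
  (fs : filter (mem (map c s)) (wd st) = map c s).

Lemma skel_index p q : p \in s -> q \in s ->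
  (index (c p) (wd st) < index (c q) (wd st))%N = (index p s < index q s)%N.
Proof.
move=> sp sq; have m k : k \in s -> mem (map c s) (c k) by move=> ?; exact: map_f.
rewrite -(index_filter_lt (wd st) (m _ sp) (m _ sq)) fs.
by rewrite !index_map_in.
Qed.

Lemma skel_last x0 : last x0 s = 0%N.
Proof.
have sl : last x0 s \in s by case: s s0 => //= a s' _; exact: mem_last.
have := last_map c s x0.
have : last (c x0) (map c s) = B.
  have [w E] : exists w, wd st = rcons w B.
    have := wf_last wst B; have := wf_all wst B.
    by case/lastP: (wd st) => // w b _; rewrite last_rcons => ->; exists w.
  by rewrite -fs E filter_rcons -{1}c0 /= map_f // last_rcons.
by move=> -> /esym E; apply: cI => //; rewrite c0.
Qed.

Lemma skel_prev k : k \in s ->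
  if prev s k == 0%N then index k s = 0%N
  else index k s = (index (prev s k) s).+1.
Proof.
move=> sk; have nk := next_prev Us k.
have sp : prev s k \in s by rewrite mem_prev.
case: eqP => [p0|/eqP p0].
  have sn : s != [::] by apply: contraTneq sk => ->.
  by have := index_next_last 0 Us sn; rewrite skel_last -{1}p0 nk.
by rewrite -{1}nk index_next // skel_last.
Qed.

(** The corners between the predecessor of [k] and [k], described without [prev] and without an
    exception for [B], so that gaps of different words can be compared. *)
Definition gap k d := (index d (wd st) <= index (c k) (wd st))%N &&
  all (fun j => (index j s < index k s) ==>
        (index (c j) (wd st) < index d (wd st)))%N s.

Lemma skel_gap k d : k \in s -> rin B (wd st) (c (prev s k)) (c k) d = gap k d.
Proof.
move=> sk; have sp : prev s k \in s by rewrite mem_prev.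
have := skel_prev sk; rewrite /rin /gap andbC -c0 (inj_in_eq cI) //.
case: ifP => [_ k0|p0 kp]; congr (_ && _).
  by apply/esym/allP => j _; rewrite k0.
apply/idP/allP => /= [pd j sj|/(_ _ sp)]; last by rewrite kp ltnSn.
apply/implyP; rewrite kp ltnS leq_eqVlt => /orP[/eqP E|]; last first.
  by rewrite -skel_index // => /ltn_trans; apply.
suff -> : j = prev s k by [].
by have := nth_index 0 sj; rewrite E nth_index.
Qed.

End Order.

Lemma low_self s st (c : nat -> D) k b : wf st -> c 0%N = B -> uniq s ->
  0%N \in s -> {in s &, injective c} ->
  filter (mem (map c s)) (wd st) = map c s -> k \in s ->
  low B st (c (prev s k)) (c k) b -> forall j, (b j <= th st (c k) j)%N.
Proof.
move=> wst c0 Us s0 cI fs sk; apply; rewrite (skel_gap wst c0 Us s0 cI fs) //.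
rewrite /gap leqnn /=; apply/allP => j sj; apply/implyP.
by rewrite (skel_index cI fs).
Qed.

Lemma chord_value (F : fieldType) (xa xb xm t e : F) : xa != 0 -> xb != 0 ->
  xa * xb * (t * xm / (xb * xa)) / e = xm * (t / e).
Proof.
move=> a0 b0; have -> : t * xm / (xb * xa) = t * xm * (xa^-1 * xb^-1).
  by rewrite invfM [xb^-1 * _]mulrC.
rewrite -[LHS]mulrA; transitivity
  ((xa * xa^-1) * (xb * xb^-1) * (t * xm) * e^-1); first by ring.
by rewrite !mulfV // !mul1r mulrA [t * xm]mulrC.
Qed.

Lemma real_ca st d : wf st -> A (xl st d).
Proof.
move=> wst; rewrite /xl; case: (side d) => [k|]; last exact: ca_one.
have [S [rS clS _ _]] := wf_real wst; rewrite -clS; exact: ca_variable.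
Qed.

(** Flips of forgotten sides make [c a] and [c b] adjacent, and by [frame] the new state realizes
    the same skeleton. *)
Lemma skel_clean s X P Bd I a b : skel s X P Bd I ->
  0%N \in s -> a \in s -> b \in s -> next s a = b -> cop a != b ->
  exists st c, [/\ [/\ wf st, c 0%N = B, uniq s & {in s &, injective c}],
    forall k, k \in s -> cop k \in s /\ c (cop k) = opp (c k),
    filter (mem (map c s)) (wd st) = map c s,
    next (wd st) (c a) = c b
    & forall k, k \in s -> [/\ X k = xl st (c k), P k = psum B st (c k),
        I k =1 cross st (c k) & low B st (c (prev s k)) (c k) (Bd k)]].
Proof.
move=> [st [c [[wst c0] [Us cI] oc fs vs]]] s0 sa sb nab oab.
pose Q : pred D := mem (map c s).
have Qc k : k \in s -> Q (c k) by move=> ?; exact: map_f.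
have Qo1 d : Q d -> Q (opp d).
  by case/mapP => k sk ->; have [sk' <-] := oc k sk; exact: Qc.
have Qo d : Q (opp d) = Q d.
  by apply/idP/idP => [/Qo1|/Qo1 //]; rewrite oppK.
have QB : Q B by rewrite -c0 Qc.
have oab' : opp (c a) != c b.
  by have [oa <-] := oc a sa; rewrite (inj_in_eq cI).
have iab : (a == 0%N) || (index b s == (index a s).+1).
  case: (eqVneq a 0%N) => //= a0; rewrite -nab index_next //.
  by rewrite (skel_last wst c0 s0 cI fs).
have ab : (c a == B) || (index (c a) (wd st) < index (c b) (wd st))%N.
  rewrite -c0 (inj_in_eq cI) // (skel_index cI fs) //.
  by case/orP: iab => [->|/eqP->] //; rewrite ltnSn orbT.
have ib0 : index (next s 0%N) s = 0%N.
  have sn : s != [::] by apply: contraTneq sa => ->.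
  by have := index_next_last 0 Us sn; rewrite (skel_last wst c0 s0 cI fs).
have free d : btw B (c a) (c b) (wd st) d -> ~~ Q d.
  move=> bd; apply/negP => /mapP[k sk E]; move: bd; rewrite {}E /btw.
  rewrite -c0 (inj_in_eq cI) // !(skel_index cI fs) //.
  case/andP=> ak kb; case/orP: iab => [/eqP a0|/eqP E].
    by rewrite -nab a0 ib0 in kb.
  case/orP: ak => [/eqP a0|ak]; last by rewrite E ltnS leqNgt ak in kb.
 by rewrite -nab a0 ib0 in kb.
have [st' [wst' [fF fX fP fL fC] nst']] :=
  clean boundaryE QB Qo (Qc _ sa) (Qc _ sb) oab' wst free ab.
exists st', c; split=> //; first by rewrite -/Q fF.
move=> k sk; have [vX vP vI vL] := vs k sk; split.
- by rewrite fX ?Qc.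
- by rewrite fP ?Qc.
- by move=> j; rewrite fC ?Qc // vI.
- by apply: fL; rewrite ?Qc ?mem_prev.
Qed.

(** When [a] and [b] are adjacent, [P b - P0 P a] is one corner. Multiplied by its two sides it
    becomes the third side of the triangle times a monomial that [ymon e] divides. *)
Lemma skel_chord s X P Bd I a b (e : 'I_n -> nat) : skel s X P Bd I ->
  0%N \in s -> a \in s -> b \in s -> next s a = b -> cop a != b ->
  (forall j, e j <= Bd b j)%N ->
  A (X a * X b * (P b - P0 P a) / ymon e).
Proof.
move=> sk s0 sa sb nab oab eb.
have [st [c [[wst c0 Us cI] oc fs nst vs]]] :=
  skel_clean sk s0 sa sb nab oab.
have [r1 r2 r3] := xl_next wst nst.
have [Xa Pa _ _] := vs a sa; have [Xb Pb _ Lb] := vs b sb.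
have -> : P b - P0 P a = corner st (c b).
  by rewrite -r3 Pb /P0 Pa -c0 (inj_in_eq cI).
have lb := low_self wst c0 Us s0 cI fs sb Lb.
have le_e j : (e j <= th st (c b) j)%N by exact: leq_trans (eb j) (lb j).
rewrite Xa Xb /corner r2 xl_opp chord_value ?(xl_neq0 wst) //.
by rewrite -(ymonB le_e); apply: ca_mul; [exact: real_ca | exact: ca_ymon].
Qed.

(** Pairs [(k, r)] that cover all cases of a gap of [s] meeting a gap of the subword [s']. On
    concrete words the list computes, and [bounds_le] unfolds to finitely many inequalities. *)
Definition gap_pairs (s s' : seq nat) : seq (nat * nat) :=
  [seq (k, r) | k <- s', r <- [seq r <- s | (index r s <= index k s)%N &&
     all (fun j => (index j s < index k s) ==> (index j s < index r s))%N s']].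

Fixpoint bounds_le (Bd' Bd : nat -> 'I_n -> nat) (l : seq (nat * nat)) : Prop :=
  if l is kr :: l' then
    (forall j, Bd' kr.1 j <= Bd kr.2 j)%N /\ bounds_le Bd' Bd l'
  else True.

Lemma bounds_leP Bd' Bd l kr : bounds_le Bd' Bd l -> kr \in l ->
  forall j, (Bd' kr.1 j <= Bd kr.2 j)%N.
Proof.
elim: l => //= k0 l IH [H0 H1]; rewrite inE => /orP[/eqP->|] //; exact: IH.
Qed.

Lemma skel_forget s (q : pred nat) X P Bd Bd' I : skel s X P Bd I ->
  0%N \in s -> q 0%N -> all (fun k => q k ==> q (cop k)) s ->
  bounds_le Bd' Bd (gap_pairs s (filter q s)) ->
  skel (filter q s) X P Bd' I.
Proof.
move=> [st [c [[wst c0] [Us cI] oc fs vs]]] s0 q0 qc bnd.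
set s' := filter q s in bnd *.
have ss k : k \in s' -> k \in s by rewrite mem_filter => /andP[].
have Us' : uniq s' by exact: filter_uniq.
have cI' : {in s' &, injective c} by move=> i k /ss si /ss sk; exact: cI.
have s0' : 0%N \in s' by rewrite mem_filter q0.
have fs' : filter (mem (map c s')) (wd st) = map c s'.
  have E : map c s' = filter (mem (map c s')) (map c s).
    rewrite filter_map; congr map; apply: eq_in_filter => k sk /=.
    apply/idP/mapP => [qk|[k' k's' ck]].
      by exists k => //; rewrite mem_filter qk sk.
    have -> : k = k' by apply: cI => //; exact: ss.
    by move: k's'; rewrite mem_filter => /andP[].
  rewrite [RHS]E -fs -filter_predI; apply: eq_filter => d /=.
  by apply/esym/andb_idr => /mapP[k ks' ->]; apply: map_f; exact: ss.
exists st, c; split=> //.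
  move=> k; rewrite !mem_filter => /andP[qk sk]; have [sk' ->] := oc k sk.
  by split=> //; rewrite sk' andbT; move/allP: qc => /(_ k sk); rewrite qk.
move=> k ks'; have sk := ss k ks'; have [vX vP vI _] := vs k sk; split=> //.
move=> d; rewrite (skel_gap wst c0 Us' s0' cI' fs') // => /andP[dk /allP bef] j.
(* The first remembered side at or after [d], hence the gap of [s] that contains [d]. *)
pose r := nth 0%N s (find (fun r => index d (wd st) <= index (c r) (wd st))%N s).
have hr : has (fun r => index d (wd st) <= index (c r) (wd st))%N s.
  by apply/hasP; exists k.
have dr : (index d (wd st) <= index (c r) (wd st))%N by exact: (nth_find 0%N hr).
have sr : r \in s by rewrite mem_nth // -has_find.
have befr i : i \in s -> (index i s < index r s)%N ->
    (index (c i) (wd st) < index d (wd st))%N.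
  move=> si; rewrite /r index_uniq // -?has_find // => lt_i.
  by rewrite ltnNge -[i](nth_index 0%N si) (before_find 0%N lt_i).
have gr : gap s st c r d.
  by rewrite /gap dr; apply/allP => i si; apply/implyP; exact: befr.
have [_ _ _ Lr] := vs r sr.
apply: leq_trans (Lr d _ j); last by rewrite (skel_gap wst c0 Us s0 cI fs).
apply: (bounds_leP (kr := (k, r)) bnd).
apply/allpairsPdep; exists k, r; split=> //; rewrite mem_filter sr andbT.
apply/andP; split.
  rewrite leqNgt; apply/negP => /(befr k sk); by rewrite ltnNge dk.
apply/allP => i is'; apply/implyP => lt_ik.
have P1 : q i by move: is'; rewrite mem_filter => /andP[].
have P2 : q k by move: ks'; rewrite mem_filter => /andP[].
have lt_id : (index (c i) (wd st) < index d (wd st))%N.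
  by have := bef i is'; rewrite (index_filter_lt s P1 P2) lt_ik.
rewrite -(skel_index cI fs) //; last exact: ss.
exact: leq_trans lt_id dr.
Qed.

Lemma cop_fresh m : odd m -> cop m = m.+1 /\ cop m.+1 = m.
Proof. by case: m => //= m om; rewrite om (negPf om). Qed.

Lemma corner_split (F : fieldType) (a b p q : F) : q - p = a / b ->
  q = p + a / b.
Proof. by move=> <-; rewrite addrC subrK. Qed.

Lemma subr_eq_split (F : fieldType) (p q r : F) : q - p = r -> q - r = p.
Proof. by move=> <-; rewrite opprB addrC subrK. Qed.

Lemma corner_value (F : fieldType) (xa xb xm t : F) : xa != 0 -> xb != 0 ->
  xm * t = xa * xb * (t * xm / (xb * xa)).
Proof.
move=> a0 b0; rewrite [xa * xb]mulrC [RHS]mulrC divfK ?mulf_neq0 //.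
by rewrite mulrC.
Qed.

Section Step.

Variables (s : seq nat) (X P : nat -> K) (Bd I : nat -> 'I_n -> nat).
Variables (a b m : nat) (Xm : K) (t : 'I_n -> nat).

(** The third side of the triangle on [a] and [b] gets the codes [m], which leaves just after
    [cop b], and [m.+1], just before [cop a]. [t] stands for the exponent of the corner between [a]
    and [b]; the other two corners of the triangle then have exponents [I b - t] and [I a - t]. *)
Definition step_word := insa (cop b) m (insb m.+1 (cop a) s).
Definition step_X k := if (k == m) || (k == m.+1) then Xm else X k.
Definition step_P k :=
  if k == m then P (cop b) + ymon (fun j => I b j - t j)%N * X a / (Xm * X b)
  else if k == m.+1 then
    P (cop a) - ymon (fun j => I a j - t j)%N * X b / (X a * Xm)
  else P k.
(** The gap before [m] is a single corner, whose exponent is known exactly; the gap before [m.+1] is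
    part of the former gap before [cop a] and inherits its bound. *)
Definition step_Bd k := if k == m then (fun j => I b j - t j)%N
  else if k == m.+1 then Bd (cop a) else Bd k.
Definition step_I k := if (k == m) || (k == m.+1)
  then (fun j => (I b j - t j) + (I a j - t j))%N else I k.

End Step.

(** The condition [next s (cop b) != cop a] prevents the third side from being folded, and the one
    with [all] prevents it from being remembered already; so it can receive two fresh codes. *)
Lemma skel_step s X P Bd I a b m : skel s X P Bd I ->
  [&& 0%N \in s, a \in s, b \in s, next s a == b & cop a != b] ->
  [&& b != 0%N, odd m, m \notin s, m.+1 \notin s & next s (cop b) != cop a] ->
  all (fun k => ~~ ((next s (cop b) == k) && (next s (cop k) == cop a))) s ->
  exists Xm t, [/\ A Xm, Xm != 0,
    forall j, [&& Bd b j <= t j, t j <= I b j & t j <= I a j]%N,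
    Xm * ymon t = X a * X b * (P b - P0 P a)
    & skel (step_word s a b m) (step_X X m Xm) (step_P X P I a b m Xm t)
        (step_Bd Bd I a b m t) (step_I I a b m t)].
Proof.
move=> sk /and5P[s0 sa sb /eqP nab oab] /and5P[b0 om ms m1s nba] ex.
have [st [c [[wst c0 Us cI] oc fs nst vs]]] :=
  skel_clean sk s0 sa sb nab oab.
have [r1 r2 r3] := xl_next wst nst.
have [Xa Pa Ia _] := vs a sa; have [Xb Pb Ib Lb] := vs b sb.
have [soa coa] := oc a sa; have [sob cob] := oc b sb.
have lb := low_self wst c0 Us s0 cI fs sb Lb.
pose e := srot st (c b); pose t := th st (c b).
pose Q : pred D := mem (map c s).
have Qc k : k \in s -> Q (c k) by move=> ?; exact: map_f.
have Uw := wf_uniq wst; have Aw := wf_all wst; have lw := wf_last wst.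
have n1 : next (wd st) (c (cop b)) = e by rewrite cob.
have n2 : next (wd st) (opp e) = c (cop a) by rewrite next_opp r2 coa.
have cnext k : k \in s -> next (map c s) (c k) = c (next s k).
  exact: next_map_in.
(* Neighbours in the full list remain neighbours in [s]: a remembered [e] with code [k] would follow
   [cop b], and [cop k] would precede [cop a]. *)
have Qe : ~~ Q e.
  apply/negP => /mapP[k ks ek]; move/allP: ex => /(_ k ks)/negP; apply.
  have [sok cok] := oc k ks.
  apply/andP; split; apply/eqP; apply: cI; rewrite ?mem_next //.
    rewrite -cnext // -fs; apply: next_filter_adj; rewrite ?Aw //; try exact: Qc.
    by rewrite n1.
  rewrite -cnext // -fs; apply: next_filter_adj; rewrite ?Aw //; try exact: Qc.
  by rewrite cok -ek n2.
have Qoe : ~~ Q (opp e).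
  apply/negP => /mapP[k ks ek]; have [sok cok] := oc k ks.
  by move/negP: Qe; apply; rewrite -[e]oppK ek -cok; exact: Qc.
have eB : e != B by apply: contraNneq Qe => ->; rewrite -c0; exact: Qc.
have oeB : opp e != B by rewrite oppB_eq.
(* A folded [e] would be the only side between [cop b] and [cop a], making these adjacent in [s]. *)
have oe : opp e != e.
  apply: contra nba => /eqP E; apply/eqP; apply: cI; rewrite ?mem_next //.
  rewrite -cnext // -fs; apply: (next_filter_skip (e := e));
    rewrite ?Aw //; try exact: Qc.
  by rewrite -{1}E n2.
have obB : c (cop b) != B.
  rewrite -c0 (inj_in_eq cI) //; apply: contra b0 => /eqP E.
  by rewrite -[b]copK E.
pose c' k := if k == m then e else if k == m.+1 then opp e else c k.
have cs k : k \in s -> c' k = c k.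
  move=> ks; rewrite /c'; case: eqP => [E|_]; first by rewrite -E ks in ms.
  by case: eqP => [E|_] //; rewrite -E ks in m1s.
have m1m : (m.+1 == m) = false by exact: gtn_eqF.
have cm : c' m = e by rewrite /c' eqxx.
have cm1 : c' m.+1 = opp e by rewrite /c' m1m eqxx.
have m0 : (m == 0%N) = false by case: (m) om.
set s' := step_word s a b m.
have s1P : perm_eq (insb m.+1 (cop a) s) (m.+1 :: s) by exact: perm_insb.
have sobi : cop b \in insb m.+1 (cop a) s by rewrite (perm_mem s1P) inE sob orbT.
have mem' k : (k \in s') = [|| k == m, k == m.+1 | k \in s].
  by rewrite (perm_mem (perm_insa _ sobi)) inE (perm_mem s1P) inE.
have Us' : uniq s'.
  have U1 : uniq (insb m.+1 (cop a) s) by rewrite (perm_uniq s1P) /= m1s.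
  rewrite (perm_uniq (perm_insa _ sobi)) /= U1 andbT (perm_mem s1P) inE.
  by rewrite eq_sym m1m.
have Qin k : k \in s -> (c k == e = false) * (c k == opp e = false).
  by move=> /Qc Qk; split; apply/eqP => E; rewrite E in Qk;
    [rewrite Qk in Qe | rewrite Qk in Qoe].
have cI' : {in s' &, injective c'}.
  move=> i k; rewrite !mem' => /or3P[/eqP->|/eqP->|is_] /or3P[/eqP->|/eqP->|ks] //;
    rewrite ?cm ?cm1.
  - by move=> E; rewrite -E eqxx in oe.
  - by rewrite cs // => E; have [] := Qin k ks; rewrite -E eqxx.
  - by move=> E; rewrite E eqxx in oe.
  - by rewrite cs // => E; have [] := Qin k ks; rewrite -E eqxx.
  - by rewrite cs // => E; have [] := Qin i is_; rewrite E eqxx.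
  - by rewrite cs // => E; have [] := Qin i is_; rewrite E eqxx.
  - by rewrite !cs //; exact: cI.
have fs' : filter (mem (map c' s')) (wd st) = map c' s'.
  have E1 : map c' s' = insa (c (cop b)) e (insb (opp e) (c (cop a)) (map c s)).
    rewrite /s' /step_word map_insa => [|k]; last first.
      rewrite (perm_mem s1P) inE => ks; rewrite (cs _ sob) => /eqP.
      case/orP: ks => [/eqP->|ks]; first by rewrite cm1 eq_sym (Qin _ sob).
      by rewrite cs // (inj_in_eq cI) // => /eqP.
    rewrite cm (cs _ sob) map_insb => [|k ks]; last first.
      by rewrite !cs // => /cI; apply.
    rewrite cm1 (cs _ soa); congr (insa _ _ (insb _ _ _)).
    by apply/eq_in_map => k ks; rewrite cs.
  have F1 : filter (predU1 (opp e) Q) (wd st)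
      = insb (opp e) (c (cop a)) (map c s).
    rewrite -fs; apply: filter_add_before => //; rewrite ?lw //.
    exact: Qc.
  have F2 : filter (predU1 e (predU1 (opp e) Q)) (wd st) = map c' s'.
    rewrite E1 -F1; apply: filter_add_after => //; rewrite ?lw //=.
      by rewrite -/(Q _) Qc ?orbT.
    by rewrite -/(Q _) (negPf Qe) orbF eq_sym.
  rewrite -[RHS]F2; apply: eq_filter => d /=.
  by rewrite -F2 mem_filter Aw andbT.
have oc' k : k \in s' -> cop k \in s' /\ c' (cop k) = opp (c' k).
  have [cpm cpm1] := cop_fresh om.
  rewrite mem' => /or3P[/eqP->|/eqP->|ks].
  - by rewrite cpm cm cm1 mem' eqxx orbT.
  - by rewrite cpm1 cm cm1 mem' eqxx oppK.
  - by have [ks' ck] := oc k ks; rewrite mem' ks' !orbT !cs // ck.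
have fsub k : k \in s -> (k != m) && (k != m.+1).
  by move=> ks; apply/andP; split; [apply: contraNneq ms | apply: contraNneq m1s]
    => <-.
have fss : filter (fun k => (k != m) && (k != m.+1)) s' = s.
  rewrite /s' /step_word filter_insa ?eqxx // filter_insb ?eqxx ?andbF //.
  by apply/all_filterP/allP => k; exact: fsub.
have idx i k : i \in s -> k \in s ->
    (index i s' < index k s')%N = (index i s < index k s)%N.
  move=> /fsub fi /fsub fk.
  by rewrite -(index_filter_lt s' (P := fun k => (k != m) && (k != m.+1)) fi fk)
    fss.
have c0' : c' 0%N = B by rewrite cs.
have s0' : 0%N \in s' by rewrite mem' s0 !orbT.
have thb j : I b j = (t j + th st e j)%N by rewrite Ib.
have tha j : I a j = (th st (c (cop a)) j + t j)%N.
  by rewrite Ia -(wf_cross wst) /cross -coa coa r1.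
have s'm : m \in s' by rewrite mem' eqxx.
have s'm1 : m.+1 \in s' by rewrite mem' eqxx orbT.
have s's k : k \in s -> k \in s' by move=> ks; rewrite mem' ks !orbT.
have idx' i k : i \in s' -> k \in s' ->
    (index i s' < index k s')%N = (index (c' i) (wd st) < index (c' k) (wd st))%N.
  by move=> is' ks'; rewrite (skel_index cI' fs').
have ie : index e (wd st) = (index (c (cop b)) (wd st)).+1.
  by rewrite -n1 (index_next_wd wst obB).
have ioe : index (c (cop a)) (wd st) = (index (opp e) (wd st)).+1.
  by rewrite -n2 (index_next_wd wst oeB).
exists (xl st e), t; split.
- exact: real_ca.
- exact: (xl_neq0 wst).
- by move=> j; rewrite lb thb tha leq_addr leq_addl.
- have -> : P b - P0 P a = corner st (c b).
    by rewrite -r3 Pb /P0 Pa -c0 (inj_in_eq cI).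
  by rewrite Xa Xb /corner r2 xl_opp -corner_value ?(xl_neq0 wst).
have [_ _ re] := xl_next wst n1; have [_ _ ra] := xl_next wst n2.
rewrite (negPf obB) in re; rewrite (negPf oeB) in ra.
have [_ Pob _ _] := vs _ sob; have [_ Poa _ Loa] := vs _ soa.
have gapP k d : k \in s' -> rin B (wd st) (c' (prev s' k)) (c' k) d =
    gap s' st c' k d by exact: skel_gap.
exists st, c'; split=> // k ks'; move: (ks'); rewrite mem' => /or3P[/eqP E|/eqP E|ks].
- rewrite /step_X /step_P /step_I /step_Bd {k ks'}E eqxx cm /=; split=> //.
  + rewrite Pob; apply: esym; apply: (@corner_split K); rewrite Xa Xb.
    have -> : ymon (fun j => I b j - t j)%N = ymon (th st e).
      by apply: eq_ymon => j; rewrite thb addKn.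
    by rewrite re /corner r2 r1 xl_opp.
  + by move=> j; rewrite /cross r2 thb tha coa addKn addnK.
  move=> d; rewrite -cm gapP // => /andP[de /allP lo] j.
  suff -> : d = e by rewrite thb addKn.
  apply: (index_wd_inj wst); apply/eqP; rewrite eqn_leq -cm de /= cm ie -cs //.
  apply/(implyP (lo _ (s's _ sob))); rewrite (idx' _ _ (s's _ sob) s'm) cm ie cs //.
- rewrite /step_X /step_P /step_I /step_Bd {k ks'}E m1m eqxx cm1 /=; split=> //.
  + by rewrite xl_opp.
  + have -> : ymon (fun j => I a j - t j)%N = ymon (th st (c (cop a))).
      by apply: eq_ymon => j; rewrite tha addnK.
    rewrite Poa Xa Xb; apply: (@subr_eq_split K); rewrite ra.
    by rewrite /corner coa r1 xl_opp.
  + move=> j; rewrite (wf_cross wst) /cross r2 thb tha coa.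
    by rewrite addKn addnK.
  move=> d; rewrite -cm1 gapP // => /andP[de /allP lo]; apply: Loa.
  rewrite (skel_gap wst c0 Us s0 cI fs) // /gap ioe -cm1 leqW //=.
  apply/allP => j sj; apply/implyP => lt_j; rewrite -(cs j) //.
  apply/(implyP (lo _ (s's _ sj))); rewrite (idx' _ _ (s's _ sj) s'm1).
  have : (index (c j) (wd st) < index (c (cop a)) (wd st))%N.
    by rewrite (skel_index cI fs).
  rewrite ioe ltnS leq_eqVlt => /orP[/eqP/(index_wd_inj wst) E|]; last first.
    by rewrite cs // cm1.
  by have [_] := Qin j sj; rewrite E eqxx.
have [k1 k2] := andP (fsub _ ks).
rewrite /step_X /step_P /step_I /step_Bd (negPf k1) (negPf k2) /= cs //.
have [Xk Pk Ik Lk] := vs k ks; split=> // d.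
rewrite -{1}cs // gapP // => /andP[de /allP lo]; apply: Lk.
rewrite (skel_gap wst c0 Us s0 cI fs) // /gap -cs // de /=.
apply/allP => j sj; apply/implyP => lt_j; rewrite -(cs j) //.
by apply/(implyP (lo _ (s's _ sj))); rewrite idx.
Qed.

End Skeletons.

(** * The initial triangulation *)

Section Initial.

Local Open Scope ring_scope.

Variables (n : nat) (T : triangulation n).
Local Notation D := (dart T).
Local Notation opp := (@Defs.opp n T).
Local Notation rot := (@Defs.rot n T).

Definition tau (d : D) : D := rot (opp d).

Lemma tau_inj : injective tau.
Proof.
by move=> d e /(can_inj (g := fun a => rot (rot a)) (@rot3 n T)) /opp_inj.
Qed.

(** The darts from which turning, stopped at boundary sides, reaches [B] are closed under [turn],
    hence are all darts. A boundary side cannot turn any further, so it reaches [B] only by being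
    [B]. *)
Lemma boundary_cycle : orbifold T -> marked_points T = 1%N ->
  exists B : D, (forall d : D, boundary d = (d == B)) /\
    forall d, fconnect tau d B.
Proof.
move=> [[D0 _] unp] m1.
have sym : connect_sym (@turn n T).
  by apply: sym_connect_sym => d e; rewrite /turn /= orbC.
have all_conn d e : connect (@turn n T) d e.
  rewrite -(root_connect sym); apply/eqP; have r a : fingraph.root (@turn n T) a \in
      [predI roots (@turn n T) & D] by rewrite inE /= andbT; exact: roots_root.
  have /card_le1_eqP E : (#|[predI roots (@turn n T) & D]| <= 1)%N.
    by rewrite -[X in (_ <= X)%N]m1; apply/eq_leq/eq_card.
  exact: E.
have /card_gt0P[d0 _] := D0.
have [B [bB _]] := unp d0.
pose f := [rel a b : D | ~~ boundary a && (b == tau a)].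
pose C := [pred d | connect f d B].
have clC : closed (@turn n T) C.
  have step d e : ~~ boundary d -> e = tau d -> (d \in C) = (e \in C).
    move=> nd ->; rewrite !inE; apply/idP/idP; last first.
      by apply: connect_trans; apply: connect1; rewrite /= nd eqxx.
    case/connectP => -[|a p] /=; first by move=> _ E; rewrite -E bB in nd.
    case/andP=> /andP[_ /eqP->] pp ->; apply/connectP; by exists p.
  move=> d e /orP[/andP[nd /eqP E]|/andP[ne /eqP E]]; first exact: step.
  by apply/esym/step.
have allC d : connect f d B.
  have := closed_connect clC (all_conn d B); rewrite !inE connect0.
  by [].
exists B; split=> [d|d].
  apply/idP/eqP => [bd|-> //].
  case/connectP: (allC d) => -[|a p] /=; first by [].
  by rewrite bd.
apply: connect_sub (allC d) => a b /andP[_ /eqP->]; exact: fconnect1.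
Qed.

Section InitialState.

Variable B : D.
Hypotheses (boundaryE : forall d : D, boundary d = (d == B))
  (tauB : forall d, fconnect tau d B).

Definition init_wd := orbit tau (rot B).
(** The elementary lamination of [j] starts at each side carrying [j] and turns through the corners
    back to the beginning of the list, so it crosses the corner of [d] once for every such side at
    or after [d]. Consecutive differences are then the principal coefficients. *)
Definition init_th (d : D) j :=
  (\sum_(e | index d init_wd <= index e init_wd) nind e j)%N.
Definition init := State init_wd (@xvar n) init_th.

Lemma init_uniq : uniq init_wd. Proof. exact: orbit_uniq. Qed.

Lemma init_all d : d \in init_wd.
Proof.
rewrite -fconnect_orbit (same_fconnect1_r tau_inj) fconnect_sym; last exact: tau_inj.
have -> : rot B = tau B by rewrite /tau (oppB boundaryE).
rewrite -(same_fconnect1_r tau_inj).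
by apply: connect_trans (fconnect1 _ _) _; exact: tauB.
Qed.

Lemma init_next d : next init_wd d = tau d.
Proof. by apply/esym/eqP/(next_cycle (cycle_orbit tau_inj _))/init_all. Qed.

Lemma init_rot d : srot init d = rot d.
Proof. by rewrite /srot init_next /tau oppK. Qed.

Lemma init_last d : last d init_wd = B.
Proof.
apply: tau_inj; rewrite -init_next /tau (oppB boundaryE).
have i0 : index (rot B) init_wd = 0%N.
  by rewrite /init_wd /orbit -orderSpred /= eqxx.
have n0 : init_wd != [::].
  by apply: contraTneq (init_all B) => ->.
have := index_next_last d init_uniq n0; rewrite -i0 => E.
by rewrite -[LHS](nth_index B (init_all _)) E nth_index ?init_all.
Qed.

Lemma init_th_step d : d != B ->
  forall j, init_th d j = (nind d j + init_th (tau d) j)%N.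
Proof.
move=> dB j; have i1 : index (tau d) init_wd = (index d init_wd).+1.
  rewrite -init_next index_next ?init_uniq ?init_all //.
  by rewrite init_last.
rewrite /init_th (bigD1 d) //=; congr (_ + _)%N; apply: eq_bigl => e.
have E : (index d init_wd == index e init_wd) = (e == d).
  apply/eqP/eqP => [E|-> //].
  by rewrite -(nth_index B (init_all e)) -E nth_index ?init_all.
by rewrite i1 ltn_neqAle E andbC.
Qed.

Lemma card_ind (f g : D -> option 'I_n) i j :
  #|[pred d | (f d == Some i) && (g d == Some j)]|%:Z =
  \sum_d (f d == Some i : nat)%:Z * (g d == Some j : nat)%:Z.
Proof.
rewrite -sum1_card -natz natr_sum big_mkcond; apply: eq_bigr => d _ /=.
by rewrite inE /=; do 2 case: (_ == _).
Qed.

Lemma adjE (i j : 'I_n) : adjacency T i j = adj (srot init) i j.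
Proof.
rewrite /adjacency /adj sumrB !card_ind; congr (_ - _); apply: eq_bigr => d _;
  by rewrite init_rot.
Qed.

Lemma wf_init : wf B init.
Proof.
split=> //.
- exact: init_uniq.
- exact: init_all.
- exact: init_last.
- by move=> d; rewrite !init_rot rot3.
- by move=> d; rewrite init_rot rot_neq.
- move=> d j; rewrite /cross !init_rot /=.
  have [->|dB] := eqVneq d B; first by rewrite (oppB boundaryE).
  have -> : rot d = tau (opp d) by rewrite /tau oppK.
  have oB : opp d != B by rewrite (oppB_eq boundaryE).
  rewrite (init_th_step dB) (init_th_step oB) /nind side_opp -/(tau d).
  by rewrite addnAC.
- by move=> k; exact: positive_xvar.
exists (principal_seed (exchange_matrix T)); split=> //.
- exact: reach_initial.
- move=> i k; rewrite /= col_mxEu mxE adjE /wgt.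
  by case: ifP; rewrite ?mulr1 // mulr_natr.
move=> j k d sd; rewrite /= col_mxEd mxE init_next.
have dB : d != B by rewrite -boundaryE /boundary sd.
rewrite (init_th_step dB) PoszD addrK /nind sd.
by rewrite (inj_eq Some_inj) eq_sym; case: (_ == _).
Qed.

Lemma init_psum : psum B init B = \sum_d corner init d.
Proof.
apply: eq_bigl => d; rewrite /rin eqxx /= leqNgt.
by rewrite (index_lt_B wf_init).
Qed.

Lemma init_mono d e : (index d init_wd <= index e init_wd)%N ->
  forall j, (init_th e j <= init_th d j)%N.
Proof.
move=> le_de j; rewrite /init_th [X in (_ <= X)%N](bigID
  (fun f => index e init_wd <= index f init_wd)%N) /=.
rewrite (eq_bigl (fun f => (index d init_wd <= index f init_wd)%N &&
  (index e init_wd <= index f init_wd)%N)) ?leq_addr // => f.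
by rewrite andb_idl // => /(leq_trans le_de).
Qed.

End InitialState.

End Initial.

(** * Good matchings of a band graph *)

Section Matchings.

Variables (n : nat) (T : triangulation n) (N : nat) (w : N.-tuple (dart T)).
Hypothesis N2 : (1 < N)%N.

(** The edge chosen in the i-th triangle: [r] is the direction of its turn, [a] and [b] tell whether
    G_(i-1) and G_i are enclosed. The shared edge is chosen when exactly one of them is. *)
Definition kind (r a b : bool) : option bool :=
  if a == b then Some (a == r) else None.

(* The matching in which the tile [G_i] is enclosed iff [q i]. *)
Definition matching (q : 'I_N -> bool) : {set edge N} :=
  [set e | e.2 == kind (right w e.1) (q (ord_pred e.1)) (q e.1)].

(** The order relation behind the lattice of matchings: at a right turn, enclosing G_(i-1) forces
    enclosing G_i, and at a left turn conversely. *)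
Definition allowed (q : 'I_N -> bool) :=
  [forall i, ~~ ((q (ord_pred i) == right w i) && (q i == ~~ right w i))].

Definition back i (k : option bool) := (k == Some true) (+) ~~ right w i.
Definition front i (k : option bool) := (k == Some false) (+) ~~ right w i.

Lemma endsE i k :
  ends w (i, k) = [set (ord_pred i, back i k); (i, front i k)].
Proof. by rewrite /ends /back /front; case: k => [[]|]; case: (right w i). Qed.

Lemma ord_pred_neq (i : 'I_N) : ord_pred i != i.
Proof.
apply/eqP => /(congr1 val) /=; case: i => [[|i] lt_i] /=.
  by case: (N) N2 lt_i => [|[|k]] // _ _; rewrite modn_small.
rewrite modnDr modn_small; last exact: ltnW.
by move/n_Sn.
Qed.

Lemma mem_endsE i k (v : vertex N) : (v \in ends w (i, k)) =
  (v == (ord_pred i, back i k)) || (v == (i, front i k)).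
Proof. by rewrite endsE !inE. Qed.

(** Of the two endpoints of each diagonal, one is covered from the triangle before it and the other
    from the triangle after it. *)
Lemma pm_fun (f : 'I_N -> option bool) :
  perfect_matching w [set e | e.2 == f e.1] ->
  forall i, front (ord_pred i) (f (ord_pred i)) != back i (f i).
Proof.
move=> /forallP pm i; apply/eqP => E.
have := pm (ord_pred i, back i (f i)); apply/negP; rewrite neq_ltn.
apply/orP; right; apply/card_gt1P.
exists (ord_pred i, f (ord_pred i)), (i, f i).
rewrite !inE !mem_endsE /= !eqxx /= E eqxx orbT; split=> //.
by apply: contra (ord_pred_neq i) => /eqP[->].
Qed.

Lemma fun_pm (f : 'I_N -> option bool) :
  (forall i, front (ord_pred i) (f (ord_pred i)) != back i (f i)) ->
  perfect_matching w [set e | e.2 == f e.1].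
Proof.
move=> fb; apply/forallP => -[j b]; apply/cards1P.
pose i := ordS j; have ij : ord_pred i = j by exact: ordSK.
have := fb i; rewrite ij => fbi.
exists (if front j (f j) == b then (j, f j) else (i, f i)).
apply/setP => -[k c]; rewrite !inE mem_endsE /= !xpair_eqE.
have -> : (j == ord_pred k) = (k == i).
  by apply/eqP/eqP => [E|->]; rewrite ?ij // /i E ord_predK.
rewrite [j == k]eq_sym.
case: (eqVneq c (f k)) => [->|ne] /=; last first.
  symmetry; apply: contraNF ne; case: ifP => _; rewrite xpair_eqE.
    by case/andP=> /eqP-> /eqP->.
  by case/andP=> /eqP-> /eqP->.
case: (eqVneq (front j (f j)) b) => [<-|nb]; rewrite xpair_eqE.
  case: (eqVneq k j) => [->|kj] /=; first by rewrite !eqxx orbT.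
  rewrite orbF; case: eqP => // ->; exact: negPf.
case: (eqVneq k i) => [->|ki] /=.
  rewrite eqxx; apply/orP; left.
  by move: fbi nb; case: (front _ _) (b) (back _ _) => -[] [].
by case: eqP => //= ->; rewrite eq_sym (negPf nb).
Qed.

(** A good matching has exactly one edge in every triangle: the shared edge meets each of the other
    two, and without it goodness selects exactly one of these. *)
Lemma good_fun M : good_matching w M -> exists f, M = [set e | e.2 == f e.1].
Proof.
case/andP=> /forallP pm /forallP gd.
have one v e1 e2 : e1 \in M -> e2 \in M -> v \in ends w e1 ->
    v \in ends w e2 -> e1 = e2.
  move=> M1 M2 v1 v2; have /cards1P[e E] := pm v.
  have : e1 \in [set e in M | v \in ends w e] by rewrite inE M1.
  have : e2 \in [set e in M | v \in ends w e] by rewrite inE M2.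
  by rewrite E !inE => /eqP-> /eqP->.
exists (fun i => if (i, None) \in M then None
  else Some ((i, Some true) \in M)).
apply/setP => -[i k]; rewrite inE /=; have := gd i.
have n1 b : (i, None) \in M -> (i, Some b) \notin M.
  move=> Mn; apply/negP => Mb.
  pose v := if b then (i, ~~ right w i) else (ord_pred i, ~~ right w i).
  have := @one v _ _ Mn Mb; rewrite !mem_endsE /v /back /front.
  by case: (b) => /=; rewrite eqxx ?orbT => /(_ isT isT).
case Mn: ((i, None) \in M) => /=.
  by case: k => [b|]; rewrite ?Mn // (negPf (n1 b Mn)).
case: k => [[]|] /=; rewrite ?Mn //;
  by case: ((i, Some true) \in M); case: ((i, Some false) \in M).
Qed.

Lemma matching_good q : allowed q -> good_matching w (matching q).
Proof.
move=> /forallP al; apply/andP; split.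
  apply: (fun_pm (f := fun i => kind (right w i) (q (ord_pred i)) (q i))) => i /=.
  have := al (ord_pred i); have := al i.
  rewrite /kind /front /back; move: (right w _) (right w _) (q _) (q _) (q _).
  by do 5 case.
apply/forallP => i; rewrite !inE /= /kind; move: (right w i) (q _) (q _).
by do 3 case.
Qed.

Lemma matching_enclosed q i : allowed q -> enclosed w (matching q) i = q i.
Proof.
move=> /forallP /(_ i); rewrite /enclosed !inE /= /kind.
by move: (right w i) (q _) (q _); do 3 case.
Qed.

Lemma good_matchingE M : good_matching w M ->
  allowed (enclosed w M) /\ M = matching (enclosed w M).
Proof.
move=> gM; have [f Mf] := good_fun gM; have [pm _] := andP gM.
rewrite Mf in pm; have fb := pm_fun pm.
have en i : enclosed w M i = ~~ front i (f i).
  by rewrite /enclosed Mf !inE /= /front; case: (right w i); case: (f i) => [[]|].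
split.
  apply/forallP => i; rewrite !en; have := fb i; move: (front (ord_pred i) _).
  by rewrite /front /back; case: (right w i); case: (f i) => [[]|] [].
rewrite {1}Mf; apply/setP => -[i k]; rewrite !inE /= !en; congr (_ == _).
have := fb i; move: (front (ord_pred i) _); rewrite /kind /front /back.
by case: (right w i); case: (f i) => [[]|] [].
Qed.

End Matchings.

(** * Descent of the expansion from the unfolding to the orbifold *)

Section Lift.

Local Open Scope ring_scope.

Variables (n : nat) (T : triangulation n) (N : nat) (w : N.-tuple (dart T)).

(** The expansion depends on the curve only through its turns and its labels, and the projection
    preserves both. *)
Lemma lift_laurentE (U : unfolding T) (v : N.-tuple (dart (unf_cover U))) :
  closed_lift w v -> lift_laurent v = band_expansion w (@xvar n) (@yvar n).
Proof.
case=> -[_ cv] vw.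
have pe i : unf_proj (exit v i) = exit w i by exact: vw.
have pn i : unf_proj (entry v i) = entry w i by rewrite /entry unf_proj_opp vw.
have rvw i : right v i = right w i.
  rewrite /right -pe -pn; have [_ [->|->]] := cv i; rewrite !unf_proj_rot.
    by rewrite !eqxx.
  apply/idP/idP => /eqP E.
    by have := rot_neq (Defs.rot (entry v i)); rewrite E eqxx.
  by have := rot_neq (Defs.rot (unf_proj (entry v i))); rewrite E eqxx.
have evw e : ends v e = ends w e.
  by case: e => i k; rewrite /ends rvw.
have pmE M : perfect_matching v M = perfect_matching w M.
  apply: eq_forallb => a; congr (_ == _); apply: eq_card => e.
  by rewrite !inE evw.
have gE M : good_matching v M = good_matching w M by rewrite /good_matching pmE.
have mE : minimal_matching v = minimal_matching w.
  by apply/setP => e; rewrite !inE rvw.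
have enE M i : enclosed v M i = enclosed w M i by rewrite /enclosed mE.
have se i : omap (@unf_proj_arc n T U) (side (exit v i)) = side (exit w i).
  by rewrite -unf_proj_side pe.
have sn i : omap (@unf_proj_arc n T U) (side (entry v i)) = side (entry w i).
  by rewrite -unf_proj_side pn.
have lE e : omap (@unf_proj_arc n T U) (label v e) = label w e.
  case: e => i [[]|] //=; rewrite -unf_proj_side /third rvw.
  by case: ifP => _; rewrite !unf_proj_rot pn.
rewrite /lift_laurent /band_expansion; congr (_ / _); last first.
  by apply: eq_bigr => i _; rewrite -se; case: (side _).
apply: eq_big => [M|M _]; first exact: gE.
congr (_ * _).
  by apply: eq_bigr => e _; rewrite -lE; case: (label _ _).
by apply: eq_big => [i|i _]; rewrite ?enE // -se; case: (side _).
Qed.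

End Lift.

Lemma label_shuffle (R : comRingType) (a g h x r : R) :
  (a * (g * h) * (x * r) = x * (r * g * h) * a)%R.
Proof. ring. Qed.

(** * The band graph of the boundary loop *)

Section Loop.

Local Open Scope ring_scope.

Variables (n : nat) (T : triangulation n) (N : nat) (w : N.-tuple (dart T)).
Hypothesis hw : essential_loop w.
Variable B : dart T.
Hypotheses (boundaryE : forall d : dart T, boundary d = (d == B))
  (tauB : forall d, fconnect (@tau n T) d B).

Local Notation D := (dart T).
Local Notation opp := (@Defs.opp n T).
Local Notation rot := (@Defs.rot n T).
Local Notation tau := (@tau n T).
Local Notation W := (init_wd B).
Local Notation pos d := (index d W).

Lemma exit_nB i : exit w i != B.
Proof. by have [[_ /(_ i)[+ _]] _ _] := hw; rewrite boundaryE. Qed.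

Lemma exit_inj : injective (exit w).
Proof.
have [_ U _] := hw => i j; rewrite /exit !(tnth_nth B) => /eqP.
by rewrite nth_uniq ?size_tuple // => /eqP/val_inj.
Qed.

(** Keeping the boundary on its right, the loop crosses the sides in the order in which they leave
    the marked point, jumping over [B]. *)
Lemma exit_step i : exit w i = tau (exit w (ord_pred i)) \/
  tau (exit w (ord_pred i)) = B /\ exit w i = rot B.
Proof.
have [_ _ /(_ i)[->|[+ ->]]] := hw; first by left.
by rewrite boundaryE => /eqP E; right; split=> //; rewrite E.
Qed.

Lemma tau_B : tau B = rot B. Proof. by rewrite /tau (oppB boundaryE). Qed.

(** The only left turn is in the triangle of [B], where the loop follows the boundary segment. *)
Lemma rightE i : right w i = (exit w i != rot B).
Proof.
rewrite /right -/(tau (exit w (ord_pred i))).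
have nB := exit_nB (ord_pred i).
case: (exit_step i) => [E|[E1 E2]].
  by rewrite E eqxx -tau_B (inj_eq (@tau_inj n T)) nB.
by rewrite E1 (negPf (exit_nB i)) E2 eqxx.
Qed.

Lemma exit_tau i : exit w i != rot B -> exit w i = tau (exit w (ord_pred i)).
Proof. by case: (exit_step i) => // -[_ ->]; rewrite eqxx. Qed.

Lemma exit_tau_B i : exit w i = rot B -> tau (exit w (ord_pred i)) = B.
Proof.
case: (exit_step i) => [-> | [-> _] //].
rewrite -tau_B => /(@tau_inj n T) E.
by have := exit_nB (ord_pred i); rewrite E eqxx.
Qed.

(** The crossed sides together with [B] are closed under [tau], which has a single orbit. *)
Lemma exit_onto d : d != B -> exists i, exit w i = d.
Proof.
pose C := [pred d | [exists i, exit w i == d]].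
have exC i : exit w i \in C by apply/existsP; exists i.
have N0 : (0 < N)%N by have [[]] := hw.
have stepC i : tau (exit w i) \in C \/ tau (exit w i) = B /\ rot B \in C.
  have := exit_step (ordS i); rewrite ordSK => -[<-|[-> <-]].
    by left.
  by right.
have rC : rot B \in C.
  case: (boolP (rot B \in C)) => // rC; exfalso.
  have clC : fclosed tau C.
    apply: intro_closed; first by apply: fconnect_sym; exact: tau_inj.
    move=> a b /eqP <- /existsP[i /eqP <-].
    by case: (stepC i) => // -[_]; rewrite (negPf rC).
  have := closed_connect clC (tauB (exit w (Ordinal N0))).
  rewrite exC => /esym/existsP[i /eqP E].
  by have := exit_nB i; rewrite E eqxx.
pose C' := [pred d | (d == B) || (d \in C)].
have clC : fclosed tau C'.
  apply: intro_closed; first by apply: fconnect_sym; exact: tau_inj.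
  move=> a b /eqP <- /orP[/eqP->|/existsP[i /eqP <-]].
    by rewrite inE /= tau_B rC orbT.
  by case: (stepC i) => [tC|[-> _]]; rewrite inE /= ?eqxx // tC orbT.
move=> dB; have := closed_connect clC (tauB d).
by rewrite !inE eqxx (negPf dB) /= => /existsP[i /eqP]; exists i.
Qed.

Lemma loop_gt1 : (1 < N)%N.
Proof.
have rB : rot B != B by exact: rot_neq.
have rrB : rot (rot B) != B.
  by apply: contra rB => /eqP E; rewrite -{1}E rot3.
have [i Ei] := exit_onto rB; have [j Ej] := exit_onto rrB.
have : i != j.
  apply: contra (rot_neq (rot B)) => /eqP E; by rewrite -Ej -Ei E.
case: (N) i j {Ei Ej} => [[]//|[|//]] i j; by rewrite !ord1 eqxx.
Qed.

Lemma pos_tau d : d != B -> pos (tau d) = (pos d).+1.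
Proof.
move=> dB; rewrite -(init_next boundaryE tauB).
exact: (index_next_wd (wf_init boundaryE tauB) dB).
Qed.

Lemma pos_rotB : pos (rot B) = 0%N.
Proof. by rewrite /init_wd /orbit -orderSpred /= eqxx. Qed.

Lemma pos_inj d e : pos d = pos e -> d = e.
Proof. exact: (index_wd_inj (wf_init boundaryE tauB)). Qed.

Lemma pos_leB d : (pos d <= pos B)%N.
Proof. by rewrite leqNgt (index_lt_B (wf_init boundaryE tauB)). Qed.

(* The matching attached to [d] encloses the tiles whose diagonal does not come
   before [d]; its weight is the corner preceding [d]. *)
Definition dq d (i : 'I_N) : bool := (pos d <= pos (exit w i))%N.

Lemma dq_allowed d : allowed w (dq d).
Proof.
apply/forallP => i; rewrite rightE /dq.
case: (eqVneq (exit w i) (rot B)) => [E|ne] /=.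
  rewrite E pos_rotB leqn0; apply/negP => /andP[/eqP/negbT + /eqP/eqP d0].
  have p1 := pos_tau (exit_nB (ord_pred i)); rewrite (exit_tau_B E) in p1.
  rewrite -ltnNge d0 ltn0 //.
have -> : pos (exit w i) = (pos (exit w (ord_pred i))).+1.
  by rewrite {1}(exit_tau ne) pos_tau ?exit_nB.
by apply/negP => /andP[/eqP le_d /eqP]; rewrite leqW.
Qed.

Local Notation xi := (xl (init B)).

(** The side labelling the edge that the matching of [d] has in the triangle left through [e]. At a
    right turn [rot e] is the third side and [rot (rot e)] the entry. At the left turn [e = rot B]
    these two are swapped, and the minimal matching, [d = B], uses the exit. *)
Definition corner_label (d e : D) :=
  if e == d then rot e
  else if (pos d < pos e)%N || (e == rot B) && (d == B) then e
  else rot (rot e).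

Lemma label_dq d i :
  side (corner_label d (exit w i)) =
  label w (i, kind (right w i) (dq d (ord_pred i)) (dq d i)).
Proof.
have entE : rot (entry w i) = tau (exit w (ord_pred i)) by [].
rewrite rightE /corner_label /dq.
case: (eqVneq (exit w i) (rot B)) => [E|ne] /=; last first.
  have Et := exit_tau ne; have rE : right w i by rewrite rightE.
  have pE : pos (exit w i) = (pos (exit w (ord_pred i))).+1.
    by rewrite {1}Et pos_tau ?exit_nB.
  have eE : rot (rot (exit w i)) = entry w i by rewrite Et -entE rot3.
  case: (eqVneq (exit w i) d) => [<-|nd].
    by rewrite leqnn pE ltnn /kind /= /third rE {1}Et -entE.
  rewrite orbF; case: ltnP => [lt_d|le_d].
    by rewrite (ltnW lt_d) -ltnS -pE lt_d.
  have lt_d : (pos (exit w i) < pos d)%N.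
    by rewrite ltn_neqAle le_d andbT; apply: contra nd => /eqP/pos_inj->.
  have lt_p : (pos (exit w (ord_pred i)) < pos d)%N by rewrite -pE ltnW.
  by rewrite [in RHS]leqNgt lt_p [X in kind _ _ X]leqNgt lt_d /= -eE.
have rE : right w i = false by rewrite rightE E eqxx.
have eB : rot (entry w i) = B by rewrite entE exit_tau_B.
have eE : entry w i = rot (rot B) by rewrite -eB rot3.
rewrite E pos_rotB ltn0 leqn0.
have le_p : (pos d <= pos (exit w (ord_pred i)))%N = (d != B).
  have pB : pos B = (pos (exit w (ord_pred i))).+1.
    by rewrite -{1}(exit_tau_B E) pos_tau ?exit_nB.
  rewrite -ltnS -pB ltn_neqAle pos_leB andbT; congr (~~ _).
  by apply/eqP/eqP => [/pos_inj|->].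
have p0 : (pos d == 0%N) = (rot B == d).
  by rewrite -pos_rotB; apply/eqP/eqP => [/pos_inj|<-].
rewrite le_p p0 /kind /=.
case: (eqVneq (rot B) d) => [<-|ne] /=.
  by rewrite rot_neq /= eE.
case: (eqVneq d B) => [_|nB] /=; first by [].
by rewrite /third rE eB rot3.
Qed.

Lemma xi_rot d : xi (rot (rot (tau d))) = xi d.
Proof. by rewrite /tau rot3 xl_opp. Qed.

(** Since [rot (rot (tau e)) = opp e], entries are exits shifted by one place along the list. *)
Lemma prefix_prod d :
  \prod_(e | (pos e <= pos d)%N) xi (rot (rot e)) = \prod_(e | (pos e < pos d)%N) xi e.
Proof.
rewrite (reindex_inj (@tau_inj n T)) /= (bigD1 B) /=; last first.
  by rewrite tau_B pos_rotB.
rewrite xi_rot (xlB boundaryE) mul1r; apply: eq_big => e; last by rewrite xi_rot.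
case: (eqVneq e B) => [->|eB]; first by rewrite andbF ltnNge pos_leB.
by rewrite andbT pos_tau.
Qed.

Lemma prod_exit (R : comRingType) (F : D -> R) :
  \prod_i F (exit w i) = \prod_(e | e != B) F e.
Proof.
rewrite -(big_map (exit w) xpredT) -[RHS]big_filter; apply: perm_big.
apply: uniq_perm; rewrite ?filter_uniq ?index_enum_uniq //.
  by rewrite map_inj_uniq ?index_enum_uniq //; exact: exit_inj.
move=> e; rewrite mem_filter mem_index_enum andbT; apply/mapP/idP => [[i _ ->]|].
  exact: exit_nB.
by move/exit_onto => [i <-]; exists i; rewrite ?mem_index_enum.
Qed.

(** Up to [d] included, the entries multiply to the exits before [d]. At [d] itself both entry and
    exit are missing and [rot d] takes their place, so that the quotient by all exits is the corner
    of [d]. *)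
Lemma prod_label d : (\prod_(e | e != B) xi (corner_label d e))
    * (xi d * xi (rot (rot d))) = (\prod_(e | e != B) xi e) * xi (rot d).
Proof.
have ltB e : (pos e < pos B)%N = (e != B).
  rewrite ltn_neqAle pos_leB andbT; congr (~~ _).
  by apply/eqP/eqP => [/pos_inj|->].
have rB : rot B != B by exact: rot_neq.
have [->|dB] := eqVneq d B.
  have <- : \prod_e xi (rot (rot e)) = \prod_(e | e != B) xi e.
    rewrite -(eq_bigl _ _ ltB) -prefix_prod; apply: eq_bigl => e.
    by rewrite pos_leB.
  rewrite (xlB boundaryE) mul1r (bigD1 (rot B)) //=.
  rewrite [in RHS](bigD1 B) //= [in RHS](bigD1 (rot B)) //= rot3.
  rewrite (xlB boundaryE) mul1r /corner_label (negPf rB) !eqxx orbT.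
  rewrite (eq_bigr (fun e => xi (rot (rot e)))) => [|e /andP[/negPf-> /negPf->]].
    by rewrite -mulrA mulrC; congr (_ * _); rewrite mulrC.
  by rewrite (index_lt_B (wf_init boundaryE tauB)).
have := prefix_prod d.
rewrite (bigD1 d) //=; set G := \prod_(e | _ && _) _ => prefE.
have lt_nd e : (pos e < pos d)%N -> (e != B) && (e != d).
  move=> lt_e; apply/andP; split; apply: contraTneq lt_e => ->.
    by rewrite (index_lt_B (wf_init boundaryE tauB)).
  by rewrite ltnn.
rewrite (bigD1 d) //= [in RHS](bigD1 d) //= {1}/corner_label eqxx.
rewrite (bigID (fun e => pos e < pos d)%N) /=.
rewrite [in RHS](bigID (fun e => pos e < pos d)%N) /=.

have e1 e : (e != B) && (e != d) && (pos e < pos d)%N = (pos e < pos d)%N.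
  by apply: andb_idl; exact: lt_nd.
have e2 e : (pos e <= pos d)%N && (e != d) = (pos e < pos d)%N.
  rewrite [RHS]ltn_neqAle andbC; congr (~~ _ && _).
  by apply/eqP/eqP => [->|/pos_inj].
rewrite (eq_bigl _ _ e1) [in RHS](eq_bigl _ _ e1) -prefE.
have -> : \prod_(e | (pos e < pos d)%N) xi (if e == d then rot e
   else if (pos d < pos e)%N || (e == rot B) && (d == B) then e
   else rot (rot e)) = G.
  rewrite /G (eq_bigl _ _ e2); apply: eq_bigr => e lt_e.
  have /andP[_ /negPf->] := lt_nd e lt_e.
  by rewrite (negPf dB) andbF orbF ltnNge (ltnW lt_e).
set G1 := \prod_(e | _) _; set G2 := \prod_(e | _) _.
have -> : G1 = G2.
  rewrite /G1 /G2 /corner_label; apply: eq_bigr => e /andP[/andP[_ ed] nlt].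
  have -> : (pos d < pos e)%N.
    rewrite ltn_neqAle leqNgt nlt andbT; apply: contra ed => /eqP/pos_inj->.
    exact: eqxx.
  by rewrite (negPf ed).
exact: label_shuffle.
Qed.

Definition dmatching d := matching w (dq d).

Lemma dmatching_good d : good_matching w (dmatching d).
Proof. by exact/matching_good/dq_allowed. Qed.

Lemma dmatching_enclosed d i : enclosed w (dmatching d) i = dq d i.
Proof. exact/matching_enclosed/dq_allowed. Qed.

Lemma dmatching_inj : injective dmatching.
Proof.
suff le d e : dmatching d = dmatching e -> (pos e <= pos d)%N.
  by move=> d e E; apply: pos_inj; apply/eqP; rewrite eqn_leq !le.
move=> E; have [->|dB] := eqVneq d B; first exact: pos_leB.
have [i id] := exit_onto dB.
by rewrite -id -[(_ <= _)%N]/(dq e i) -dmatching_enclosed -E dmatching_enclosed /dq id.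
Qed.

(** By [allowed] the enclosed tiles form a final segment of the list; [d] is its first side, with
    [B] serving for the empty segment. *)
Lemma dmatching_onto M : good_matching w M -> exists d, M = dmatching d.
Proof.
move=> gM; have [/forallP al ->] := good_matchingE loop_gt1 gM.
pose P d := (d == B) || [exists i, (exit w i == d) && enclosed w M i].
have PE i : P (exit w i) = enclosed w M i.
  rewrite /P (negPf (exit_nB i)); apply/existsP/idP => [[j /andP[/eqP]]|ei].
    by move/exit_inj->.
  by exists i; rewrite eqxx.
have stepP d : d != B -> P d -> P (tau d).
  move=> dB; have [i <-] := exit_onto dB; rewrite PE => ei.
  have [->|tB] := eqVneq (tau (exit w i)) B; first by rewrite /P eqxx.
  have Et : exit w (ordS i) = tau (exit w i).
    case: (exit_step (ordS i)); rewrite ordSK // => -[E].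
    by rewrite E eqxx in tB.
  have := al (ordS i); rewrite ordSK -Et PE ei rightE.
  have -> /= : exit w (ordS i) != rot B.
    by rewrite Et -tau_B (inj_eq (@tau_inj n T)) exit_nB.
  by case: (enclosed w M (ordS i)).
have [d Pd dmin] : exists2 d, P d & forall e, P e -> (pos d <= pos e)%N.
  have PB : P B by rewrite /P eqxx.
  by exists [arg min_(d < B | P d) pos d]; case: arg_minnP.
have Pge k e : (pos d + k)%N = pos e -> P e.
  elim: k e => [|k IH] e; first by rewrite addn0 => /pos_inj <-.
  rewrite addnS => pe; have pe' : (pos d + k < size W)%N.
    by apply: ltnW; rewrite pe index_mem init_all.
  pose f := nth B W (pos d + k).
  have pf : pos f = (pos d + k)%N by rewrite index_uniq ?init_uniq.
  have fB : f != B.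
    apply: contraTneq (pos_leB e) => E; by rewrite -pe -pf E -ltnNge.
  have -> : e = tau f by apply: pos_inj; rewrite pos_tau // pf pe.
  by apply: stepP => //; apply: IH.
exists d; rewrite /dmatching; apply/setP => e; rewrite !inE.
have qE i : dq d i = enclosed w M i.
  rewrite -PE /dq; apply/idP/idP => [le_d|/dmin //].
  by apply: (Pge (pos (exit w i) - pos d)%N); rewrite subnKC.
by rewrite !qE.
Qed.

Lemma prod_matching (F : edge N -> ambient n) (q : 'I_N -> bool) :
  \prod_(e in matching w q) F e
  = \prod_i F (i, kind (right w i) (q (ord_pred i)) (q i)).
Proof.
rewrite (reindex_onto (fun i => (i, kind (right w i) (q (ord_pred i)) (q i)))
  fst) => [|[i k]]; last by rewrite inE /= => /eqP->.
by apply: eq_bigl => i; rewrite !inE /= !eqxx.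
Qed.

Lemma ymon_init d : ymon (init_th B d) =
  \prod_(e | (pos d <= pos e)%N) if side e is Some k then yvar k else 1.
Proof.
rewrite /ymon (eq_bigr (fun j => \prod_(e | (pos d <= pos e)%N) yvar j ^+ nind e j)).
  by rewrite exchange_big /=; apply: eq_bigr => e _; rewrite prod_nind.
by move=> j _; rewrite -prodrXr.
Qed.

Lemma corner_cancel (F : fieldType) (t u v a b c : F) : a != 0 -> b != 0 ->
  c != 0 -> u * (a * b) = c * v -> u * t / c = t * v / (a * b).
Proof.
move=> a0 b0 c0 E; apply/eqP; rewrite eqr_div ?mulf_neq0 //.
by rewrite mulrAC E -mulrA mulrC [v * t]mulrC.
Qed.

Theorem band_value :
  band_expansion w (@xvar n) (@yvar n) = \sum_d corner (init B) d.
Proof.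
have wi := wf_init boundaryE tauB.
have xn0 d : xi d != 0 by exact: (xl_neq0 wi).
rewrite /band_expansion mulr_suml.
rewrite (reindex_onto dmatching (fun M => odflt B [pick d | M == dmatching d])) /=.
  apply: eq_big => [d|d _].
    rewrite dmatching_good /=; case: pickP => [e /eqP/dmatching_inj->|/(_ d)].
      by rewrite eqxx.
    by rewrite eqxx.
  rewrite /corner; have rE e : srot (init B) e = rot e.
    exact: (init_rot boundaryE tauB).
  rewrite !rE -/(xi d).
  have -> : \prod_(i | enclosed w (dmatching d) i)
      (if side (exit w i) is Some k then yvar k else 1) = ymon (init_th B d).
    rewrite ymon_init (eq_bigl _ _ (dmatching_enclosed d)) [RHS](bigD1 B) ?pos_leB //=.
    have -> : side B = None by apply/eqP; move: (boundaryE B); rewrite eqxx.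
    rewrite mul1r big_mkcond (prod_exit (fun e => if (pos d <= pos e)%N then
      (if side e is Some k then yvar k else 1) else 1)) -big_mkcondr.
    by apply: eq_bigl => e; rewrite andbC.
  apply: corner_cancel; rewrite ?xn0 //.
    by apply/prodf_neq0 => i _; exact: (xn0 (exit w i)).
  have -> : \prod_i (if side (exit w i) is Some k then xvar k else 1)
      = \prod_(e | e != B) xi e by rewrite -prod_exit.
  rewrite -prod_label -prod_exit; congr (_ * _).
  rewrite prod_matching; apply: eq_bigr => i _.
  by rewrite -label_dq.
move=> M /dmatching_onto[d ->]; case: pickP => [e /eqP<-//|/(_ d)].
by rewrite eqxx.
Qed.

End Loop.

(** * A triangle of the torus *)

Section Torus.

Local Open Scope ring_scope.

Variables (n : nat) (T : triangulation n) (B : dart T).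
Hypotheses (boundaryE : forall d : dart T, boundary d = (d == B))
  (tauB : forall d, fconnect (@tau n T) d B).
Local Notation D := (dart T).
Local Notation opp := (@Defs.opp n T).
Local Notation rot := (@Defs.rot n T).
Local Notation tau := (@tau n T).
Local Notation W := (init_wd B).
Local Notation pos d := (index d W).

(** An ordinary arc has one upward and one downward side, a pending arc only an upward one. *)
Definition upward d := (d != B) && (pos d <= pos (opp d))%N.
Definition downward d := (d != B) && (pos (opp d) < pos d)%N.

Lemma dart_cases d : (upward d + downward d + (d == B) = 1)%N.
Proof. by rewrite /upward /downward; case: eqP => //=; case: leqP. Qed.

Lemma sum_ndarts (P : pred D) : (#|P| = \sum_d (P d : nat))%N.
Proof.
rewrite -sum1_card big_mkcond; apply: eq_bigr => d _.
by rewrite -topredE /=; case: (P d).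
Qed.

Lemma card_upward : #|upward| = n.
Proof.
rewrite -[RHS]card_ord -[RHS]sum1_card sum_ndarts.
rewrite (eq_bigr (fun d => \sum_(k < n) (upward d && (side d == Some k) : nat))%N).
  rewrite exchange_big /=; apply: eq_bigr => k _.
  have [d sd] := side_onto T k.
  have dB : d != B by rewrite -boundaryE /boundary sd.
  pose e := if (pos d <= pos (opp d))%N then d else opp d.
  have se : side e = Some k by rewrite /e; case: ifP; rewrite ?side_opp.
  have eB : e != B by rewrite -boundaryE /boundary se.
  have ue : upward e.
    by rewrite /upward eB /e; case: (leqP (pos d)) => //; rewrite oppK => /ltnW.
  rewrite (bigD1 e) //= ue se eqxx big1 // => f fe.
  case: andP => // -[/andP[fB uf] /eqP sf].
  have [|E] := sideP boundaryE eB (etrans sf (esym se)).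
    by move=> E; rewrite E eqxx in fe.
  rewrite E oppK in uf; case/andP: ue => _ ue.
  have := pos_inj boundaryE tauB; case/eqP: fe.
  by rewrite E; apply: pos_inj => //; apply/eqP; rewrite eqn_leq ue uf.
move=> d _; rewrite /upward; case: (eqVneq d B) => [_|dB] /=.
  by rewrite big1.
have [k sk] := nB_side boundaryE dB; rewrite sk (bigD1 k) //= eqxx andbT.
rewrite big1 ?addn0 // => i ik; case: eqP => [[E]|]; last by rewrite andbF.
by rewrite E eqxx in ik.
Qed.

Definition folded d := (d != B) && (opp d == d).

Lemma card_folded : #|folded| = orbifold_points T.
Proof.
rewrite /orbifold_points -[RHS]sum1_card big_mkcond /= sum_ndarts.
rewrite (eq_bigr (fun d => \sum_(k < n) (folded d && (side d == Some k) : nat))%N).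
  rewrite exchange_big /=; apply: eq_bigr => k _.
  rewrite inE /= /pending; case: existsP => [[d /andP[/eqP sd /eqP od]]|nd]; last first.
    rewrite big1 // => d _; case: andP => // -[/andP[_ od] sd]; case: nd.
    by exists d; rewrite sd.
  have dB : d != B by rewrite -boundaryE /boundary sd.
  rewrite (bigD1 d) //= /folded dB od sd !eqxx big1 // => f fd.
  case: andP => // -[_ /eqP sf].
  have [|E] := sideP boundaryE dB (etrans sf (esym sd)).
    by move=> E; rewrite E eqxx in fd.
  by rewrite E od eqxx in fd.
move=> d _; rewrite /folded; case: (eqVneq d B) => [_|dB] /=.
  by rewrite big1.
have [k sk] := nB_side boundaryE dB; rewrite sk (bigD1 k) //= eqxx andbT.
rewrite big1 ?addn0 // => i ik; rewrite andbC; case: eqP => // -[E].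
by rewrite E eqxx in ik.
Qed.

Lemma card_upward_downward : (#|upward| = #|downward| + #|folded|)%N.
Proof.
rewrite !sum_ndarts [X in (_ = X + _)%N](reindex_inj (@opp_inj n T)) -big_split.
apply: eq_bigr => d _; rewrite /upward /downward /folded oppK (oppB_eq boundaryE).
case: (d != B) => //=; rewrite leq_eqVlt.
have -> : (pos d == pos (opp d)) = (opp d == d).
  by apply/eqP/eqP => [/(pos_inj boundaryE tauB)<-|->].
by case: eqP => [->|_]; rewrite ?ltnn ?addn0.
Qed.

Lemma card_darts : (#|D| = #|upward| + #|downward| + 1)%N.
Proof.
rewrite -sum1_card !sum_ndarts -[in RHS](card1 B) sum_ndarts -!big_split.
by apply: eq_bigr => d _; rewrite -[LHS](dart_cases d).
Qed.

Lemma boundary_counts : boundary_segments T = 1%N /\ boundary_components T = 1%N.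
Proof.
split.
  by rewrite -[RHS](card1 B); apply: eq_card => d; rewrite !inE boundaryE.
rewrite -[RHS](card1 B); apply: eq_card => d; rewrite !inE boundaryE.
apply: andb_idl => /eqP->; apply/eqP.
have cl : closed (@bnext n T) (pred1 B).
  by move=> a b /and3P[]; rewrite !inE !boundaryE => -> ->.
by have := closed_connect cl (connect_root (@bnext n T) B);
  rewrite !inE eqxx => /esym/eqP.
Qed.

(** With p pending arcs there are n - p downward sides, and the Euler characteristic in genus 1
    leaves n - p - 1 triangles; so some triangle has two downward sides. *)
Lemma triangle_exists : marked_points T = 1%N -> has_genus T 1 ->
  exists d, downward d /\ downward (rot d).
Proof.
move=> m1; rewrite /has_genus m1 => g1.
have [bs bc] := boundary_counts; rewrite bs bc in g1.
have cD := card_darts; have cU := card_upward; have cUD := card_upward_downward.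
rewrite card_folded in cUD.
(* [triangles] is a quotient rounded down, which still bounds [#|D|] strictly by three times its
   successor n - p. *)
have D3 : (#|D| < 3 * #|downward|)%N.
  move: g1; rewrite /triangles cD cU; move: cUD; rewrite cU.
  move: #|downward| (orbifold_points T) => a p; lia.
have rotI : injective rot := can_inj (g := fun a => rot (rot a)) (@rot3 n T).
case: (pickP (fun d => downward d && downward (rot d))) => [d /andP[]|none].
  by exists d.
suff : (3 * #|downward| <= #|D|)%N by rewrite leqNgt D3.
rewrite sum_ndarts -sum1_card mulSn mul2n -addnn.
rewrite {2}(reindex_inj rotI) /= {2}(reindex_inj (inj_comp rotI rotI)) /=.
rewrite -!big_split; apply: leq_sum => d _.
have := none d; have := none (rot d); have := none (rot (rot d)).
by rewrite rot3; case: (downward d); case: (downward (rot d));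
  case: (downward (rot (rot d))).
Qed.

(** Each side of a triangle leaves one place after the opposite of the preceding side. With [d] and
    [e] downward, this forces the order [opp e], [f], [opp d], [e], [opp f], [d]. *)
Lemma torus_triangle : marked_points T = 1%N -> has_genus T 1 ->
  exists d, let e := rot d in let f := rot e in
  [/\ d != B, e != B, f != B &
  [/\ pos e = (pos (opp d)).+1, pos f = (pos (opp e)).+1,
      pos d = (pos (opp f)).+1 &
   [/\ (pos f < pos (opp d))%N, (pos e < pos (opp f))%N & (pos d < pos B)%N]]].
Proof.
move=> m1 g1; have [d [/andP[dB dd] /andP[eB de]]] := triangle_exists m1 g1.
have wi := wf_init boundaryE tauB.
have pI := pos_inj boundaryE tauB.
exists d => e f; rewrite -/e in eB de.
have nxt a b : a != B -> rot a = b -> pos b = (pos (opp a)).+1.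
  by move=> aB <-; rewrite -pos_tau // ?(oppB_eq boundaryE) // /tau oppK.
have fB : f != B.
  apply/eqP => E; have dE : d = rot B by rewrite -E /f rot3.
  by move: dd; rewrite dE pos_rotB.
have p1 : pos e = (pos (opp d)).+1 by exact: nxt.
have p2 : pos f = (pos (opp e)).+1 by exact: nxt.
have p3 : pos d = (pos (opp f)).+1 by apply: nxt => //; rewrite /f rot3.
have sr a : srot (init B) a = rot a by exact: (init_rot boundaryE tauB).
have ne1 : opp d != f by have := opp_neq_srot2 wi d; rewrite !sr.
have ne2 : opp f != e.
  by have := opp_neq_srot2 wi f; rewrite !sr /f rot3.
have ne3 : e != d by exact: rot_neq.
split=> //; split=> //; split.
- have : (pos f <= pos (opp d))%N.
    rewrite p2; rewrite p1 ltnS in de; move: de; rewrite leq_eqVlt.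
    by case/orP=> // /eqP/pI/(@opp_inj n T) E; rewrite E eqxx in ne3.
  rewrite leq_eqVlt => /orP[/eqP/pI E|//]; by rewrite E eqxx in ne1.
- have : (pos e <= pos (opp f))%N.
    rewrite p1 -ltnS -p3; rewrite -p1; move: dd; rewrite -p1 leq_eqVlt.
    by case/orP=> // /eqP/pI E; rewrite E eqxx in ne3.
  rewrite leq_eqVlt => /orP[/eqP/pI E|//]; by rewrite E eqxx in ne2.
rewrite ltn_neqAle (pos_leB boundaryE tauB) andbT.
by apply: contra dB => /eqP/pI ->.
Qed.

End Torus.

(** * Cluster variables near the triangle *)

Section Elements.

Local Open Scope ring_scope.

Variables (n : nat) (T : triangulation n) (B : dart T).
Hypothesis boundaryE : forall d : dart T, boundary d = (d == B).
Local Notation K := (ambient n).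
Local Notation A := (cluster_algebra (principal_seed (exchange_matrix T))).
Local Notation skel := (skel B).

(** [step_P] with the chord relation substituted: the new partial sums no longer mention the new arc
    or its unknown exponent [t]. *)
Definition chord_P (P : nat -> K) (X : nat -> K) (I : nat -> 'I_n -> nat) a b m k :=
  if k == m then P (cop b) + ymon (I b) / (X b ^+ 2 * (P b - P0 P a))
  else if k == m.+1 then P (cop a) - ymon (I a) / (X a ^+ 2 * (P b - P0 P a))
  else P k.

Lemma chord_term (F : fieldType) (xa xb d xm t r i : F) : xm * t = xa * xb * d ->
  t != 0 -> xm != 0 -> i = r * t -> r * xa / (xm * xb) = i / (xb ^+ 2 * d).
Proof.
move=> E t0 m0 ->; have : xa * xb * d != 0 by rewrite -E mulf_neq0.
rewrite !mulf_eq0 !negb_or => /andP[/andP[a0 b0] d0].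
apply/eqP; rewrite eqr_div ?mulf_neq0 ?expf_neq0 //.
by apply/eqP; transitivity (r * xb * (xa * xb * d)); [ring | rewrite -E; ring].
Qed.

(** Of the monomial [t] of a new arc only a divisor [b] is known; after division of [nu] by [b] a
    surplus monomial [r] remains, which is harmless. *)
Lemma scale_low (F : fieldType) (Xm t r b nu q c : F) : Xm * t = nu -> t = r * b ->
  b != 0 -> nu * q / (b * c) = Xm * q / c * r.
Proof.
move=> <- -> b0; rewrite invfM.
transitivity (Xm * q * c^-1 * r * (b * b^-1)); first by ring.
by rewrite mulfV // mulr1.
Qed.

(** Division by the full crossing monomial [i] needs no knowledge of [t]: the cofactor [r] is the
    monomial of the next corner. *)
Lemma scale_cross (F : fieldType) (Xm t r i nu q : F) : Xm * t = nu -> i = r * t ->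
  t != 0 -> nu * q / i = Xm * q / r.
Proof.
move=> <- -> t0; rewrite invfM.
transitivity (Xm * q * r^-1 * (t * t^-1)); first by ring.
by rewrite mulfV // mulr1.
Qed.

Lemma skel_eqP s X P P' Bd I : {in s, P =1 P'} ->
  skel s X P Bd I -> skel s X P' Bd I.
Proof.
move=> PP' [st [c [w1 w2 w3 w4 vs]]]; exists st, c; split=> // k sk.
by rewrite -PP' //; exact: vs.
Qed.

Lemma skel_chord_step s X P Bd I a b m : skel s X P Bd I ->
  [&& 0%N \in s, a \in s, b \in s, next s a == b & cop a != b] ->
  [&& b != 0%N, odd m, m \notin s, m.+1 \notin s & next s (cop b) != cop a] ->
  all (fun k => ~~ ((next s (cop b) == k) && (next s (cop k) == cop a))) s ->
  exists Xm t, [/\ A Xm /\ Xm != 0,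
    forall j, [&& Bd b j <= t j, t j <= I b j & t j <= I a j]%N,
    Xm * ymon t = X a * X b * (P b - P0 P a)
    & skel (step_word s a b m) (step_X X m Xm) (chord_P P X I a b m)
        (step_Bd Bd I a b m t) (step_I I a b m t)].
Proof.
move=> sk c1 c2 c3; have [Xm [t [AX X0 bt Et sk']]] := skel_step boundaryE sk c1 c2 c3.
exists Xm, t; split=> //; apply: skel_eqP sk' => k _.
rewrite /step_P /chord_P; case: eqP => _.
  congr (_ + _); apply: (@chord_term K) Et (ymon_neq0 _) X0 _.
  by rewrite -ymonD; apply: eq_ymon => j; rewrite subnK //; case/and3P: (bt j).
case: eqP => // _; congr (_ - _); rewrite [X a * Xm]mulrC.
have Et' : Xm * ymon t = X b * X a * (P b - P0 P a) by rewrite Et [X a * _]mulrC.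
apply: (@chord_term K) Et' (ymon_neq0 _) X0 _.
by rewrite -ymonD; apply: eq_ymon => j; rewrite subnK //; case/and3P: (bt j).
Qed.

(** Codes 1, 2 carry x, codes 3, 4 carry y and codes 5, 6 carry z; the odd side of each arc, called
    x1, y1 or z1, comes first in the word. *)
Variables (X P : nat -> K) (Bd I : nat -> 'I_n -> nat).
Hypothesis sk0 : skel [:: 5; 3; 1; 6; 4; 2; 0]%N X P Bd I.
Hypotheses (X0 : X 0%N = 1) (X2 : X 2%N = X 1%N) (X4 : X 4%N = X 3%N)
  (X6 : X 6%N = X 5%N).
Hypothesis mono : forall j, [&& Bd 3 j <= Bd 5 j, Bd 1 j <= Bd 3 j,
  Bd 6 j <= Bd 1 j, Bd 4 j <= Bd 6 j, Bd 2 j <= Bd 4 j & Bd 0 j <= 0]%N.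
Hypotheses (I5 : forall j, I 5 j = (Bd 6 j + Bd 3 j)%N) (I6 : I 6 =1 I 5)
  (I3 : forall j, I 3 j = (Bd 3 j + Bd 2 j)%N) (I4 : I 4 =1 I 3).

Ltac bounds := do !split=> //; let i := fresh in intro i; move: (mono i); lia.

Local Notation x := (X 1%N).
Local Notation y := (X 3%N).
Local Notation z := (X 5%N).

Lemma chord_R : A (y * z * (P 4 - P 6) / ymon (Bd 4)).
Proof.
have := skel_chord boundaryE (a := 6%N) (b := 4%N) (e := Bd 4%N) sk0.
by rewrite X6 X4 [z * y]mulrC; apply.
Qed.

Lemma chord_Dx : A (x * (P 0 - P 2)).
Proof.
have := skel_chord boundaryE (a := 2%N) (b := 0%N) (e := fun=> 0%N) sk0.
have -> : ymon (fun=> 0%N) = 1 :> K by rewrite /ymon big1.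
by rewrite X0 X2 mulr1 divr1; apply.
Qed.

Lemma forget_xz : skel [:: 3; 4; 0]%N X P Bd I.
Proof.
apply: (skel_forget (q := fun k => k \in [:: 3; 4; 0]%N) sk0) => //=; bounds.
Qed.

Lemma forget_yz : skel [:: 1; 2; 0]%N X P Bd I.
Proof.
apply: (skel_forget (q := fun k => k \in [:: 1; 2; 0]%N) sk0) => //=; bounds.
Qed.

Lemma forget_x : skel [:: 5; 3; 6; 4; 0]%N X P Bd I.
Proof.
apply: (skel_forget (q := fun k => k \in [:: 5; 3; 6; 4; 0]%N) sk0) => //=; bounds.
Qed.

Lemma forget_z : skel [:: 3; 1; 4; 2; 0]%N X P Bd I.
Proof.
apply: (skel_forget (q := fun k => k \in [:: 3; 1; 4; 2; 0]%N) sk0) => //=; bounds.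
Qed.

Lemma chord_Dy : A (y * (P 0 - P 4)).
Proof.
have := skel_chord boundaryE (a := 4%N) (b := 0%N) (e := fun=> 0%N) forget_xz.
have -> : ymon (fun=> 0%N) = 1 :> K by rewrite /ymon big1.
by rewrite X0 X4 mulr1 divr1; apply.
Qed.

Lemma chord_D'y : A (y * P 3 / ymon (Bd 3)).
Proof.
have := skel_chord boundaryE (a := 0%N) (b := 3%N) (e := Bd 3%N) forget_xz.
by rewrite X0 mul1r subr0; apply.
Qed.

Lemma chord_D'x : A (x * P 1 / ymon (Bd 1)).
Proof.
have := skel_chord boundaryE (a := 0%N) (b := 1%N) (e := Bd 1%N) forget_yz.
by rewrite X0 mul1r subr0; apply.
Qed.

(** The arc from [B] to y1 is added with code 7; the chord from [B] to it is the cluster variable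
    y_1. *)
Lemma chord_y_1 : P 3 != 0 /\
  A (y * P 3 * (P 4 + ymon (I 3) / (y ^+ 2 * P 3)) / ymon (I 3)).
Proof.
have [Xm [t [[AX Xm0] bt Et sk]]] :=
  skel_chord_step (m := 7%N) (a := 0%N) (b := 3%N) forget_z isT isT isT.
rewrite X0 mul1r subr0 in Et.
split; first by move/eqP: Et; apply: contraTneq => ->; rewrite mulr0 mulf_neq0 ?ymon_neq0.
have {}sk : skel [:: 7; 8; 0]%N (step_X X 7 Xm) (chord_P P X I 0 3 7)
   (fun k => if k == 7 then fun j => (I 3 j - t j)%N else fun=> 0%N) (step_I I 0 3 7 t).
  apply: (skel_forget (q := fun k => k \in [:: 7; 8; 0]%N) sk) => //=.
  do !split=> //; move=> j; rewrite /step_Bd /=; move: (mono j) (bt j); rewrite I3; lia.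
have := skel_chord boundaryE (a := 0%N) (b := 7%N) (e := fun j => (I 3 j - t j)%N) sk.
rewrite /P0 /chord_P /step_X /= X0 mul1r !subr0.
rewrite (@scale_cross K _ _ (ymon (fun j => (I 3 j - t j)%N)) _ _ _ Et); first exact.
  rewrite -ymonD; apply: eq_ymon => j; rewrite subnK //; by case/and3P: (bt j).
exact: ymon_neq0.
Qed.

Lemma ymon_low u t : (forall j, (u j <= t j)%N) ->
  ymon t = ymon (fun j => (t j - u j)%N) * ymon u :> K.
Proof. by move=> le; rewrite -ymonD; apply: eq_ymon => j; rewrite subnK. Qed.

(* [x'] joins [y1] to [z2]. *)
Lemma chords_x' (nu := y * z * (P 6 - P 3))
    (p' := P 5 + ymon (I 5) / (z ^+ 2 * (P 6 - P 3)))
    (p'' := P 5 + ymon (I 5) / (z ^+ 2 * (P 6 - p'))) :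
  [/\ P 6 - P 3 != 0, A (nu / ymon (Bd 6)), A (nu * p' / ymon (I 5)),
    P 6 - p' != 0
    & A (nu * (z * (P 6 - p') * p'') / (ymon (Bd 6) * ymon (I 5)))].
Proof.
have [v [t [[Av v0] bt Et sk]]] :=
  skel_chord_step (m := 7%N) (a := 3%N) (b := 6%N) forget_x isT isT isT.
rewrite X6 -/nu /P0 /= in Et.
have btj j : (Bd 6 j <= t j)%N by case/and3P: (bt j).
have EI : ymon (I 5) = ymon (fun j => (I 5 j - t j)%N) * ymon t.
  by rewrite -ymon_low // => j; rewrite -I6; case/and3P: (bt j).
have nu0 : nu != 0 by rewrite -Et mulf_neq0 ?ymon_neq0.
have d0 : P 6 - P 3 != 0 by move: nu0; rewrite mulf_eq0 negb_or => /andP[].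
have skV : skel [:: 7; 8; 0]%N (step_X X 7 v) (chord_P P X I 3 6 7)
   (fun k => if k == 7 then fun j => (I 5 j - t j)%N else fun=> 0%N) (step_I I 3 6 7 t).
  apply: (skel_forget (q := fun k => k \in [:: 7; 8; 0]%N) sk) => //=.
  do !split=> //; move=> j; rewrite /step_Bd /=; move: (mono j) (bt j);
    rewrite I6 I5; lia.
have P7 : chord_P P X I 3 6 7 7 = p'.
  by rewrite /chord_P /= X6 (eq_ymon I6).
have skU : skel [:: 5; 7; 6; 8; 0]%N (step_X X 7 v) (chord_P P X I 3 6 7)
   (step_Bd Bd I 3 6 7 t) (step_I I 3 6 7 t).
  apply: (skel_forget (q := fun k => k \in [:: 5; 7; 6; 8; 0]%N) sk) => //=.
  do !split=> //; move=> j; rewrite /step_Bd /=; move: (mono j) (bt j);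
    rewrite I6 I5; lia.
(* A second new arc, from the first one (code 7) to z2, has partial sum [p'']. *)
have [v' [t' [[Av' v'0] bt' Et' sk']]] :=
  skel_chord_step (m := 9%N) (a := 7%N) (b := 6%N) skU isT isT isT.
have Pb6 : chord_P P X I 3 6 7 6 = P 6 by [].
have Pa7 : P0 (chord_P P X I 3 6 7) 7 = p' by rewrite /P0 -P7.
have X'7 : step_X X 7 v 7 = v by [].
have X'6 : step_X X 7 v 6 = z by rewrite /step_X /= X6.
rewrite Pb6 Pa7 X'7 X'6 in Et'.
have nu'0 : v * z * (P 6 - p') != 0 by rewrite -Et' mulf_neq0 ?ymon_neq0.
have d1 : P 6 - p' != 0 by move: nu'0; rewrite mulf_eq0 negb_or => /andP[].
split; [exact: d0 | | | exact: d1 |].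
- rewrite -Et (ymon_low btj) mulrA mulfK ?ymon_neq0 //.
  by apply: ca_mul; [exact: Av | exact: ca_ymon].
- have := skel_chord boundaryE (a := 0%N) (b := 7%N) (e := fun j => (I 5 j - t j)%N) skV.
  rewrite /P0 P7 /step_X /= X0 mul1r subr0.
  rewrite (@scale_cross K _ _ (ymon (fun j => (I 5 j - t j)%N)) _ _ _ Et EI
    (ymon_neq0 _)).
  by apply.
have EI' : ymon (I 5) = ymon (fun j => (I 5 j - t' j)%N) * ymon t'.
  by rewrite -ymon_low // => j; rewrite -I6; case/and3P: (bt' j).
have skW : skel [:: 9; 10; 0]%N (step_X (step_X X 7 v) 9 v')
   (chord_P (chord_P P X I 3 6 7) (step_X X 7 v) (step_I I 3 6 7 t) 7 6 9)
   (fun k => if k == 9 then fun j => (I 5 j - t' j)%N else fun=> 0%N)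
   (step_I (step_I I 3 6 7 t) 7 6 9 t').
  apply: (skel_forget (q := fun k => k \in [:: 9; 10; 0]%N) sk') => //=.
  do !split=> //; move=> j; move: (mono j) (bt' j);
    rewrite /step_Bd /step_I /= I6 I5; lia.
have P9 : chord_P (chord_P P X I 3 6 7) (step_X X 7 v) (step_I I 3 6 7 t) 7 6 9 9 = p''.
  by rewrite {1}/chord_P Pb6 Pa7 X'6 /= (eq_ymon I6).
rewrite (@scale_low K _ _ (ymon (fun j => (t j - Bd 6 j)%N)) _ _ _ _ Et (ymon_low btj)
  (ymon_neq0 _)); apply: ca_mul; last exact: ca_ymon.
have := skel_chord boundaryE (a := 0%N) (b := 9%N) (e := fun j => (I 5 j - t' j)%N) skW.
rewrite P9 /P0 /step_X /= X0 mul1r subr0 !mulrA.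
rewrite (@scale_cross K _ _ (ymon (fun j => (I 5 j - t' j)%N)) _ _ _ Et' EI'
  (ymon_neq0 _)).
by apply.
Qed.

(* [a] joins [B] to [z1]. *)
Section ArcA.

Let nu := z * P 5.
Let pa1 := P 6 + ymon (I 5) / (z ^+ 2 * P 5).
Let pa2 := P 0 - ymon (I 0) / P 5.
Let pX := P 3 + ymon (I 3) / (y ^+ 2 * (P 4 - pa1)).
Let pD := P 3 - ymon (I 3) / (y ^+ 2 * (pa2 - P 4)).

(** The arc [a] gets the codes 7, after z2, and 8, before [B], with partial sums [pa1] and [pa2].
    Every further element is a chord after forgetting or after one more step, and carries the factor
    [nu] coming from [a]. *)
Lemma chords_a :
  [/\ P 5 != 0, A (nu / ymon (Bd 5)), A (nu * pa1 / ymon (I 5)),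
     A (nu * (x * (P 2 - pa1)) / (ymon (Bd 5) * ymon (Bd 2)))
   & [/\ P 4 - pa1 != 0, A (nu * (y * (P 4 - pa1)) / (ymon (Bd 5) * ymon (Bd 4))),
      A (nu * (y * (P 4 - pa1) * (z * (P 6 - pX)))
         / (ymon (Bd 5) * (ymon (Bd 4) * ymon (Bd 6)))),
      pa2 - P 4 != 0
    & A (nu * (y * (pa2 - P 4) * pD) / (ymon (Bd 5) * ymon (Bd 3)))]].
Proof.
have [v [t [[Av v0] bt Et sk]]] :=
  skel_chord_step (m := 7%N) (a := 0%N) (b := 5%N) sk0 isT isT isT.
rewrite X0 mul1r /P0 /= subr0 -/nu in Et.
have btj j : (Bd 5 j <= t j)%N by case/and3P: (bt j).
have EI : ymon (I 5) = ymon (fun j => (I 5 j - t j)%N) * ymon t.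
  by rewrite -ymon_low // => j; case/and3P: (bt j).
have nu0 : nu != 0 by rewrite -Et mulf_neq0 ?ymon_neq0.
have d0 : P 5 != 0 by move: nu0; rewrite mulf_eq0 negb_or => /andP[].
pose Xa := step_X X 7 v; pose Pa := chord_P P X I 0 5 7.
pose Ba := step_Bd Bd I 0 5 7 t; pose Ia := step_I I 0 5 7 t.
have P7 : Pa 7%N = pa1 by rewrite /Pa /chord_P /P0 /= subr0.
have P8 : Pa 8%N = pa2 by rewrite /Pa /chord_P /P0 /= X0 expr1n mul1r subr0.
have X7 : Xa 7%N = v by [].
have X8 : Xa 8%N = v by [].
have low q c : A (v * q / c) -> A (nu * q / (ymon (Bd 5) * c)).
  move=> Aq; rewrite (@scale_low K _ _ (ymon (fun j => (t j - Bd 5 j)%N)) _ _ _ _ Et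
    (ymon_low btj) (ymon_neq0 _)); apply: ca_mul; [exact: Aq | exact: ca_ymon].
pose s := [:: 5; 3; 1; 6; 7; 4; 2; 8; 0]%N.
have fgt l : filter (fun k => k \in l) s = l -> 0%N \in l ->
    all (fun k => (k \in l) ==> (cop k \in l)) s ->
    bounds_le Ba Ba (gap_pairs s l) ->
    skel l Xa Pa Ba Ia.
  by move=> E l0 la lb; rewrite -E in lb *; exact: (skel_forget sk).
have skW : skel [:: 1; 7; 2; 8; 0]%N Xa Pa Ba Ia.
  apply: fgt => //=.
  do !split=> //; move=> j; move: (mono j) (bt j); rewrite /Ba /step_Bd /= I5; lia.
have skZ : skel [:: 7; 8; 0]%N Xa Pa Ba Ia.
  apply: fgt => //=.
  do !split=> //; move=> j; move: (mono j) (bt j); rewrite /Ba /step_Bd /= I5; lia.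
have skX : skel [:: 5; 3; 6; 7; 4; 8; 0]%N Xa Pa Ba Ia.
  apply: fgt => //=.
  do !split=> //; move=> j; move: (mono j) (bt j); rewrite /Ba /step_Bd /= I5; lia.
have skD : skel [:: 3; 7; 4; 8; 0]%N Xa Pa Ba Ia.
  apply: fgt => //=.
  do !split=> //; move=> j; move: (mono j) (bt j); rewrite /Ba /step_Bd /= I5; lia.
(* Code 9 is the arc from [a] to y2, code 11 the arc from y2 to the other side of [a]. *)
have [vX [tX [[_ vX0] btX EtX skX']]] :=
  skel_chord_step (m := 9%N) (a := 7%N) (b := 4%N) skX isT isT isT.
have [vD [tD [[_ vD0] btD EtD skD']]] :=
  skel_chord_step (m := 11%N) (a := 4%N) (b := 8%N) skD isT isT isT.
have Xa4 : Xa 4%N = y by rewrite /Xa /step_X /= X4.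
have P04 : P0 Pa 4%N = P 4 by [].
have P07 : P0 Pa 7%N = pa1 by rewrite /P0 -P7.
have Pa4 : Pa 4%N = P 4 by [].
rewrite X7 Xa4 P07 Pa4 in EtX.
rewrite X8 Xa4 P04 P8 in EtD.
have eX0 : v * y * (P 4 - pa1) != 0.
  rewrite -EtX.
  by apply: mulf_neq0; [exact: vX0 | exact: ymon_neq0].
have eD0 : y * v * (pa2 - P 4) != 0.
  rewrite -EtD.
  by apply: mulf_neq0; [exact: vD0 | exact: ymon_neq0].
have dX0 : P 4 - pa1 != 0 by move: eX0; rewrite mulf_eq0 negb_or => /andP[].
have dD0 : pa2 - P 4 != 0 by move: eD0; rewrite mulf_eq0 negb_or => /andP[].
split; [exact: d0 | | | |].
- rewrite -Et (ymon_low btj) mulrA mulfK ?ymon_neq0 //.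
  by apply: ca_mul; [exact: Av | exact: ca_ymon].
- have := skel_chord boundaryE (a := 0%N) (b := 7%N) (e := fun j => (I 5 j - t j)%N) skZ.
  rewrite P7 X7 /P0 /= subr0 {1}/Xa /step_X /= X0 mul1r.
  rewrite (@scale_cross K _ _ (ymon (fun j => (I 5 j - t j)%N)) _ _ _ Et EI
    (ymon_neq0 _)).
  by apply.
- apply: low; rewrite mulrA.
  have Pa2 : Pa 2%N = P 2 by [].
  have Xa2 : Xa 2%N = x by rewrite /Xa /step_X /= X2.
  have := skel_chord boundaryE (a := 7%N) (b := 2%N) (e := Bd 2%N) skW.
  rewrite P07 X7 Xa2 Pa2; by apply.
split; [exact: dX0 | | | exact: dD0 |].
- apply: low; rewrite mulrA.
  have := skel_chord boundaryE (a := 7%N) (b := 4%N) (e := Bd 4%N) skX.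
  rewrite P07 X7 Xa4 Pa4; by apply.
- apply: low.
  have btXj j : (Bd 4 j <= tX j)%N by case/and3P: (btX j).
  have skU : skel [:: 5; 9; 6; 10; 0]%N (step_X Xa 9 vX) (chord_P Pa Xa Ia 7 4 9)
     (fun k => if k == 6 then Bd 6 else fun=> 0%N) (step_I Ia 7 4 9 tX).
    by apply: (skel_forget (q := fun k => k \in [:: 5; 9; 6; 10; 0]%N) skX').
  have P9 : chord_P Pa Xa Ia 7 4 9 9 = pX.
    rewrite {1}/chord_P Xa4 P07 Pa4 /= /pX.
    have -> : ymon (Ia 4) = ymon (I 3) :> K by exact: eq_ymon.
    by [].
  have P06 : chord_P Pa Xa Ia 7 4 9 6 = P 6 by [].
  have P09 : P0 (chord_P Pa Xa Ia 7 4 9) 9 = pX by rewrite /P0 -P9.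
  have := skel_chord boundaryE (a := 9%N) (b := 6%N) (e := Bd 6%N) skU.
  have -> : step_X Xa 9 vX 6 = z by rewrite /Xa /step_X /= X6.
  have -> : step_X Xa 9 vX 9 = vX by [].
  rewrite P09 P06 [v * _]mulrA [v * _]mulrA.
  rewrite (@scale_low K _ _ (ymon (fun j => (tX j - Bd 4 j)%N)) _ _ _ _ EtX
    (ymon_low btXj) (ymon_neq0 _)) mulrA => H.
  by apply: ca_mul; [apply: H | exact: ca_ymon].
apply: low.
have skE : skel [:: 12; 11; 0]%N (step_X Xa 11 vD) (chord_P Pa Xa Ia 4 8 11)
   (fun k => if k == 12 then Bd 3 else fun=> 0%N) (step_I Ia 4 8 11 tD).
  by apply: (skel_forget (q := fun k => k \in [:: 12; 11; 0]%N) skD').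
have P12 : chord_P Pa Xa Ia 4 8 11 12 = pD.
  rewrite {1}/chord_P Xa4 P04 P8 /= /pD.
  have -> : ymon (Ia 4) = ymon (I 3) :> K by exact: eq_ymon.
  by [].
have := skel_chord boundaryE (a := 0%N) (b := 12%N) (e := Bd 3%N) skE.
have -> : step_X Xa 11 vD 12 = vD by [].
have -> : step_X Xa 11 vD 0 = 1 by rewrite /Xa /step_X /= X0.
rewrite P12 /P0 /= subr0 mul1r => H.
have tD1 : ymon tD = ymon tD * 1 by rewrite mulr1.
have -> : v * (y * (pa2 - P 4) * pD) / ymon (Bd 3) = vD * pD / ymon (Bd 3) * ymon tD.
  rewrite -(@scale_low K _ _ _ _ _ pD (ymon (Bd 3)) EtD tD1) ?oner_neq0 // mul1r.
  by congr (_ / _); rewrite !mulrA [v * y]mulrC.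
by apply: ca_mul; [apply: H | exact: ca_ymon].
Qed.

End ArcA.

End Elements.

(** * The loop as a polynomial in cluster variables *)

Section FinalAlgebra.

Local Open Scope ring_scope.

Variables (F : fieldType) (A : F -> Prop).
Hypotheses (AB : forall a b, A a -> A b -> A (a - b))
  (AM : forall a b, A a -> A b -> A (a * b)).

Lemma closedD a b : A a -> A b -> A (a + b).
Proof.
move=> Aa Ab; have A0 : A 0 by rewrite -(subrr a); exact: AB.
by rewrite -[b]opprK; apply: (AB Aa); rewrite -sub0r; exact: AB.
Qed.

Variables x y z cx cy cz h m n eps a R p0 p1 p2 p3 p4 p5 p6 : F.
Variables tx1 tx2 ty1 ty2 tz1 tz2 Iz Iy I0 : F.
Hypotheses (x0 : x != 0) (y0 : y != 0) (z0 : z != 0) (cx0 : cx != 0)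
  (cy0 : cy != 0) (cz0 : cz != 0) (h0 : h != 0) (m0 : m != 0) (n0 : n != 0)
  (a0 : a != 0).
Hypotheses (tx2E : tx2 = h * cx) (ty2E : ty2 = tx2 * cy)
  (tz2E : tz2 = ty2 * m * cz) (tx1E : tx1 = tz2 * cx)
  (ty1E : ty1 = tx1 * n * cy) (tz1E : tz1 = ty1 * cz)
  (IzE : Iz = tz2 * ty1) (IyE : Iy = ty1 * tx2) (I0E : I0 = eps * tz1).
Hypotheses (p5E : p5 = tz1 * a / z) (p3E : p3 = p5 + ty1 * x / (z * y))
  (p6E : p6 = p1 + tz2 * y / (x * z)) (p4E : p4 = p6 + ty2 * R / (y * z))
  (p2E : p2 = p4 + tx2 * z / (x * y)).

(* These are the values of the arcs computed in [chords_a] and [chords_x'] and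
   of the chords at [B]; [zz], [zy] and [Zh] are the arcs that remain to be
   generated, together with the loop [p0]. *)
Let pa1 := p6 + Iz / (z ^+ 2 * p5).
Let pa2 := p0 - I0 / p5.
Let X' := y * z * (p6 - p3) / tz2.
Let pX' := p5 + Iz / (z ^+ 2 * (p6 - p3)).
Let V := y * z * (p6 - p3) * pX' / Iz.
Let pX'' := p5 + Iz / (z ^+ 2 * (p6 - pX')).
Let V'' := y * z * (p6 - p3) * z * (p6 - pX') * pX'' / (tz2 * Iz).
Let X := z * p5 * y * (p4 - pa1) / (tz1 * ty2).
Let W := z * p5 * x * (p2 - pa1) / (tz1 * tx2).
Let pX := p3 + Iy / (y ^+ 2 * (p4 - pa1)).
Let U := z * p5 * y * (p4 - pa1) * z * (p6 - pX) / (tz1 * ty2 * tz2).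
Let pD := p3 - Iy / (y ^+ 2 * (pa2 - p4)).
Let U2 := z * p5 * y * (pa2 - p4) * pD / (tz1 * ty1).
Let D'y := y * p3 / ty1.
Let D'x := x * p1 / tx1.
Let Dx := x * (p0 - p2).
Let Dy := y * (p0 - p4).
Let z_1 := z * p5 * pa1 / Iz.
Let y_1 := y * p3 * (p4 + Iy / (y ^+ 2 * p3)) / Iy.

Hypotheses (nX' : p6 - p3 != 0) (nX'' : p6 - pX' != 0) (nX : p4 - pa1 != 0)
  (nD : pa2 - p4 != 0) (n3 : p3 != 0).

(** Expanding gives [zz = z (p6 - p5) / tz2] and [zy = y (p4 - p3) / ty2], the sums between the two
    sides of one arc, which [skel_chord] does not cover. [Zh] is the solution of
    [Dy * D'y = y * Zh + h * cx]. *)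
Let zz := (X' + cx * cy * n * x) / y.
Let zy := (R + m * cz * X') / z.
Let Zh := (Dy * D'y - h * cx) / y.

Let e5 : z * p5 = tz1 * a.
Proof. by rewrite p5E mulrC divfK. Qed.

Let e53 : p5 = p3 - ty1 * x / (z * y).
Proof. by rewrite p3E addrK. Qed.

(** In this and the next five lemmas, a product of a missing element with an arc is a combination of
    known arcs without denominators. *)
Lemma zeta_y_a : zy * a = X + m * V.
Proof.
have eX : p4 - pa1 = ty2 * R / (y * z) - Iz / (z * (tz1 * a)).
  rewrite -e5 p4E /pa1; have -> : z * (z * p5) = z ^+ 2 * p5 by rewrite mulrA.
  by rewrite [p6 + _]addrC addrKA.
rewrite /zy /X eX e5 /V /pX' /X' p5E IzE tz1E ty1E tx1E tz2E ty2E tx2E.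
move: (p6 - p3) nX' => q q0.
by field; rewrite ?q0 ?z0 ?y0 ?cx0 ?cy0 ?cz0 ?h0 ?m0 ?n0 ?a0.
Qed.

Lemma zeta_z_X : zz * X = U + cx * n * W.
Proof.
have e1 : p6 - pX = (p6 - p3) - Iy / (y ^+ 2 * (p4 - pa1)).
  by rewrite /pX opprD addrA.
have e2 : p2 - pa1 = (p4 - pa1) + tx2 * z / (x * y) by rewrite p2E addrAC.
rewrite /zz /X /U /W e1 e2 e5 /X' IyE tz1E ty1E tx1E tz2E ty2E tx2E.
move: (p6 - p3) nX' (p4 - pa1) nX => q q0 r r0.
by field; rewrite ?q0 ?r0 ?x0 ?z0 ?y0 ?cx0 ?cy0 ?cz0 ?h0 ?m0 ?n0 ?a0.
Qed.

Lemma zeta_z_V : zz * V = V'' + cx * cy * n * D'y.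
Proof.
have eV : V'' = y * z * (p6 - p3) * z * ((p6 - pX') * p5 + Iz / z ^+ 2) / (tz2 * Iz).
  rewrite /V'' /pX''; move: (p6 - pX') nX'' => r r0; congr (_ / _).
  rewrite -mulrA; congr (_ * _); rewrite mulrDr; congr (_ + _).
  by rewrite invfM mulrC -!mulrA mulVf ?mulr1.
have e1 : p6 - pX' = (p6 - p3) + ty1 * x / (z * y) - Iz / (z ^+ 2 * (p6 - p3)).
  by rewrite /pX' e53 !opprD opprK !addrA.
have e3 : p3 = p5 + ty1 * x / (z * y) by [].
rewrite /D'y e3 eV e1 /zz /V /pX' /X' IzE.
move: (p6 - p3) nX' p5 => q q0 p; rewrite tz2E ty1E tx1E tz2E ty2E tx2E.
by field; rewrite ?q0 ?z0 ?y0 ?cx0 ?cy0 ?cz0 ?h0 ?m0 ?n0 ?a0.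
Qed.

Lemma zeta_z_D'y : zz * D'y = V + cx * D'x.
Proof.
have e1 : p1 = (p6 - p3) + p3 - tz2 * y / (x * z) by rewrite subrK p6E addrK.
rewrite /zz /D'y /V /pX' /D'x {1}e1 /X' e53.
move: (p6 - p3) nX' => q q0; move: p3 => p; rewrite IzE ty1E tx1E tz2E ty2E tx2E.
by field; rewrite ?q0 ?x0 ?z0 ?y0 ?cx0 ?cy0 ?cz0 ?h0 ?m0 ?n0 ?a0.
Qed.

Lemma Zh_z : Zh * z = Dx + cz * a * Dy.
Proof.
have e1 : p0 - p2 = (p0 - p4) - tx2 * z / (x * y) by rewrite p2E opprD addrA.
rewrite /Zh /Dx e1 /Dy /D'y p3E p5E; move: (p0 - p4) => g.
rewrite tz1E ty1E tx1E tz2E ty2E tx2E.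
by field; rewrite ?x0 ?z0 ?y0 ?cx0 ?cy0 ?cz0 ?h0 ?m0 ?n0 ?a0.
Qed.

Lemma Zh_a : Zh * a = eps * z * D'y + U2.
Proof.
have t1 : tz1 != 0 by rewrite tz1E ty1E tx1E tz2E ty2E tx2E !mulf_neq0.
have e1 : pa2 - p4 = (p0 - p4) - eps * z / a.
  rewrite /pa2 addrAC; congr (_ - _); rewrite I0E p5E.
  by field; rewrite ?z0 ?a0.
have -> : U2 = tz1 * a * y * ((pa2 - p4) * p3 - Iy / y ^+ 2) / (tz1 * ty1).
  rewrite /U2 /pD e5; move: (pa2 - p4) nD => r r0; congr (_ / _).
  rewrite -[LHS]mulrA; congr (_ * _); rewrite mulrBr; congr (_ - _).
  by rewrite invfM mulrC -!mulrA mulVf ?mulr1.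
rewrite /Zh e1 /Dy /D'y; move: (p0 - p4) p3 => g p.
rewrite IyE tz1E ty1E tx1E tz2E ty2E tx2E.
by field; rewrite ?x0 ?z0 ?y0 ?cx0 ?cy0 ?cz0 ?h0 ?m0 ?n0 ?a0.
Qed.

Let u := cx * cy * cz * n.
Let uy := m * cz * cx * n * cy.

(** Here [cz * a = z * p5 / ty1] and [zz + u * a = z * p6 / tz2]. The 1 comes from the summand
    [Iz / (z ^+ 2 * p5)] of [pa1], as [z_1] is divided by the full crossing monomial [Iz]. *)
Lemma z_z_1 : z * z_1 = 1 + cz * a * (zz + u * a).
Proof.
have e1 : p6 = (p6 - p3) + tz1 * a / z + ty1 * x / (z * y).
  by rewrite -addrA -p5E -p3E subrK.
have p50 : p5 != 0.
  by rewrite p5E tz1E ty1E tx1E tz2E ty2E tx2E !mulf_neq0 ?invr_neq0.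
have -> : z * z_1 = z * (z * p5) * p6 / Iz + 1.
  rewrite /z_1 /pa1; move: p50 p6; rewrite IzE ty1E tx1E tz2E ty2E tx2E.
  move: p5 => p q r.
  by field; rewrite ?q ?x0 ?z0 ?y0 ?cx0 ?cy0 ?cz0 ?h0 ?m0 ?n0 ?a0.
rewrite e5 {1}e1 /zz /X'; move: (p6 - p3) => q.
rewrite /u IzE tz1E ty1E tx1E tz2E ty2E tx2E.
by field; rewrite ?x0 ?z0 ?y0 ?cx0 ?cy0 ?cz0 ?h0 ?m0 ?n0 ?a0.
Qed.

Lemma zeta_y_sum : zy + uy * D'y = y * p4 / ty2.
Proof.
have e1 : p4 = (p6 - p3) + p3 + ty2 * R / (y * z) by rewrite subrK.
rewrite e1 /zy /X' /D'y; move: (p6 - p3) p3 => q p.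
rewrite /uy ty1E tx1E tz2E ty2E tx2E.
by field; rewrite ?x0 ?z0 ?y0 ?cx0 ?cy0 ?cz0 ?h0 ?m0 ?n0 ?a0.
Qed.

Lemma y_y_1 : y * y_1 = 1 + cy * D'y * (zy + uy * D'y).
Proof.
rewrite zeta_y_sum /y_1 /D'y; move: p3 n3 p4 => p q r.
rewrite IyE ty1E tx1E tz2E ty2E tx2E.
by field; rewrite ?q ?x0 ?z0 ?y0 ?cx0 ?cy0 ?cz0 ?h0 ?m0 ?n0 ?a0.
Qed.

(** With [E = zy + uy * D'y = y * p4 / ty2], the product [y_1 * Dy] is [p0 - p4] plus
    [cy * E * D'y * (p0 - p4)]. The term in [Zh] removes the latter, and its part [h * cx / y]
    restores [p4]. *)
Lemma total_sum : p0 = y_1 * Dy - cy * (zy + uy * D'y) * Zh.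
Proof.
have -> : y_1 = (1 + cy * D'y * (zy + uy * D'y)) / y.
  by rewrite -y_y_1 mulrAC mulfV ?mul1r.
rewrite zeta_y_sum /Dy /Zh /Dy; move: D'y p4 => q r.
rewrite ty2E tx2E.
by field; rewrite ?x0 ?z0 ?y0 ?cx0 ?cy0 ?cz0 ?h0 ?m0 ?n0 ?a0.
Qed.

Hypotheses (Ax : A x) (Az : A z) (Acx : A cx) (Acy : A cy)
  (Acz : A cz) (Am : A m) (An : A n) (Aeps : A eps) (Aa : A a)
  (AR : A R) (AX' : A X') (AV : A V) (AV'' : A V'') (AX : A X) (AW : A W)
  (AU : A U) (AU2 : A U2) (AD'y : A D'y) (AD'x : A D'x) (ADx : A Dx)
  (ADy : A Dy) (Az_1 : A z_1) (Ay_1 : A y_1).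

Ltac mem := repeat first [assumption | apply: AB | apply: closedD | apply: AM].

Lemma loop_in_subring : A p0.
Proof.
have Au : A u by rewrite /u; mem.
have Auy : A uy by rewrite /uy; mem.
have split_z q : A (q * z) -> A (q * a * (zz + u * a)) -> A q.
  move=> qz qa; have -> : q = q * z * z_1 - cz * (q * a * (zz + u * a)).
    by rewrite -mulrA z_z_1; ring.
  mem.
have split_y q : A (q * y) -> A (q * D'y) -> A (zy + uy * D'y) -> A q.
  move=> qy qD Ae; have -> : q = q * y * y_1 - cy * (q * D'y * (zy + uy * D'y)).
    by rewrite -mulrA y_y_1; ring.
  mem.
have Azy : A zy.
  apply: split_z; first by rewrite /zy divfK //; mem.
  have -> : zy * a * (zz + u * a) = zz * X + m * (zz * V) + u * a * (X + m * V).
    by rewrite zeta_y_a; ring.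
  rewrite zeta_z_X zeta_z_V; mem.
have Ae : A (zy + uy * D'y) by mem.
have Azz : A zz.
  apply: split_y => //; first by rewrite /zz divfK //; mem.
  rewrite zeta_z_D'y; mem.
have AZh : A Zh.
  apply: split_z; first by rewrite Zh_z; mem.
  rewrite Zh_a; mem.
rewrite total_sum; mem.
Qed.

End FinalAlgebra.

(** * The initial triangulation as a skeleton, and the conclusion *)

Section SortedWords.

Variable D : eqType.

Lemma filter_sorted (s W : seq D) : uniq W -> {subset s <= W} ->
  sorted (fun a b => index a W < index b W)%N s -> filter (mem s) W = s.
Proof.
move=> UW sW ss; pose r := (fun a b => index a W < index b W)%N.
have tr : transitive r by move=> a b c; exact: ltn_trans.
have ir : irreflexive r by move=> a; exact: ltnn.
apply: (irr_sorted_eq tr ir) => //.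
  apply: sorted_filter => //; case EW: W => [|x0 W'] //; rewrite -EW.
  by apply/(sortedP x0) => i lt_i; rewrite /r !index_uniq // ltnW.
by move=> a; rewrite mem_filter /= andb_idr // => /sW.
Qed.

Lemma uniq_map_inj (C : eqType) (c : C -> D) (s : seq C) : uniq (map c s) ->
  {in s &, injective c}.
Proof.
move=> U i k si sk E; rewrite -(nth_index i si) -[RHS](nth_index i sk).
congr nth; apply/eqP; rewrite -(nth_uniq (c i) _ _ U) ?size_map ?index_mem //.
by rewrite !(nth_map i) ?index_mem // !nth_index // E.
Qed.

End SortedWords.

Section Main.

Local Open Scope ring_scope.

Variables (n : nat) (T : triangulation n) (B : dart T).
Hypotheses (boundaryE : forall d : dart T, boundary d = (d == B))
  (tauB : forall d, fconnect (@tau n T) d B).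
Local Notation D := (dart T).
Local Notation opp := (@Defs.opp n T).
Local Notation rot := (@Defs.rot n T).
Local Notation tau := (@tau n T).
Local Notation W := (init_wd B).
Local Notation pos d := (index d W).
Local Notation st := (init B).
Local Notation K := (ambient n).
Local Notation A := (cluster_algebra (principal_seed (exchange_matrix T))).
Local Notation th := (init_th B).

Section Triangle.

Variable d : D.
Local Notation e := (rot d).
Local Notation f := (rot (rot d)).
Hypotheses (dB : d != B) (eB : e != B) (fB : f != B).
Hypotheses (pe : pos e = (pos (opp d)).+1) (pf : pos f = (pos (opp e)).+1)
  (pd : pos d = (pos (opp f)).+1).
Hypotheses (fd : (pos f < pos (opp d))%N) (ef : (pos e < pos (opp f))%N)
  (dlB : (pos d < pos B)%N).

(** In the triangle [d] carries x, [f] carries y and [e] carries z; an odd code is the side of its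
    arc that leaves the marked point first. *)
Definition code k := match k with
  | 0 => B | 1 => opp d | 2 => d | 3 => f | 4 => opp f | 5 => opp e | _ => e end%N.

Let P k := psum B st (code k).
Let X k := xl st (code k).
Let Bd k := th (code k).
Let I k := cross st (code k).
Let s0 := [:: 5; 3; 1; 6; 4; 2; 0]%N.

Let wi : wf B st. Proof. exact: wf_init. Qed.

Lemma init_skel : skel B s0 X P Bd I.
Proof.
have so : sorted (fun a b => pos a < pos b)%N (map code s0).
  by rewrite /= fd ef dlB pf pe pd !ltnSn.
have Ui : uniq (map code s0).
  apply: (sorted_uniq _ _ so); [|by move=> a; exact: ltnn].
  by move=> a b c; exact: ltn_trans.
have cI := uniq_map_inj Ui.
exists st, code; split=> //.
- move=> k; rewrite !inE => /or4P[|||/or4P[]] /eqP-> //=; rewrite ?oppK //.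
  by rewrite (oppB boundaryE).
- by apply: filter_sorted => //; [exact: init_uniq | move=> a _; exact: init_all].
move=> k sk; split=> // a /andP[_ le_a]; exact: init_mono.
Qed.

Lemma init_th_le a b : (pos a <= pos b)%N -> forall j, (th b j <= th a j)%N.
Proof. exact: init_mono. Qed.

Lemma th_step a j : a != B -> th a j = (nind a j + th (tau a) j)%N.
Proof. by move=> aB; rewrite init_th_step. Qed.

Lemma corner_init a : corner st a =
  ymon (th a) * xl st (rot a) / (xl st a * xl st (rot (rot a))).
Proof. by rewrite /corner !init_rot. Qed.

Lemma psum_step a b : a != B -> tau a = b ->
  psum B st b = psum B st a + corner st b.
Proof.
move=> aB ab; have nab : next (wd st) a = b by rewrite (init_next boundaryE tauB).
have [_ _] := xl_next wi nab; rewrite (negPf aB) => <-.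
by rewrite addrC subrK.
Qed.

(** From the end of the list backwards, exponents grow by the sides passed: [cx], [cy], [cz] are the
    coefficients of the three arcs of the triangle, and [h], [m], [nn], [eps] collect the sides in
    the gaps between them and at both ends. *)
Lemma loop_sum_ca : A (psum B st B).
Proof.
have tau_opp a : tau (opp a) = rot a by rewrite /tau oppK.
have odB : opp d != B by rewrite (oppB_eq boundaryE).
have oeB : opp e != B by rewrite (oppB_eq boundaryE).
have ofB : opp f != B by rewrite (oppB_eq boundaryE).
have no a : nind (opp a) =1 nind a by move=> j; rewrite /nind side_opp.
have Bd5 j : Bd 5 j = (Bd 3 j + nind e j)%N.
  by rewrite /Bd /= th_step // tau_opp no addnC.
have Bd1 j : Bd 1 j = (Bd 6 j + nind d j)%N.
  by rewrite /Bd /= th_step // tau_opp no addnC.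
have Bd4 j : Bd 4 j = (Bd 2 j + nind f j)%N.
  by rewrite /Bd /= th_step // tau_opp no addnC rot3.
have Bd3 j : (Bd 1 j + nind f j <= Bd 3 j)%N.
  rewrite /Bd /= [X in (_ <= X)%N]th_step // addnC leq_add2l; apply: init_th_le.
  by rewrite (pos_tau boundaryE tauB).
have Bd6 j : (Bd 4 j + nind e j <= Bd 6 j)%N.
  rewrite /Bd /= [X in (_ <= X)%N]th_step // addnC leq_add2l; apply: init_th_le.
  by rewrite (pos_tau boundaryE tauB).
have Bd2 j : (nind d j <= Bd 2 j)%N by rewrite /Bd /= th_step // leq_addr.
have I0 j : (Bd 5 j <= I 0 j)%N.
  rewrite /I /cross /= (init_rot boundaryE tauB); apply: leq_trans (leq_addl _ _).
  by apply: init_th_le; rewrite pos_rotB.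
have Bd0 j : Bd 0 j = 0%N.
  rewrite /Bd /= /init_th big1 // => a.
  rewrite leqNgt ltn_neqAle (pos_leB boundaryE tauB) andbT negbK.
  move=> /eqP/(pos_inj boundaryE tauB)->.
  by rewrite /nind; move: (boundaryE B); rewrite eqxx /boundary => /eqP->.
have mono j : [&& Bd 3 j <= Bd 5 j, Bd 1 j <= Bd 3 j,
    Bd 6 j <= Bd 1 j, Bd 4 j <= Bd 6 j, Bd 2 j <= Bd 4 j & Bd 0 j <= 0]%N.
  by move: (Bd5 j) (Bd1 j) (Bd4 j) (Bd3 j) (Bd6 j) (Bd0 j); lia.
have srE a : srot st a = rot a by exact: (init_rot boundaryE tauB).
have I5 j : I 5 j = (Bd 6 j + Bd 3 j)%N.
  by rewrite /I /= (wf_cross wi) /cross srE.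
have I6 : I 6 =1 I 5 by move=> j; rewrite [RHS](wf_cross wi).
have I3 j : I 3 j = (Bd 3 j + Bd 2 j)%N by rewrite /I /cross /= srE rot3.
have I4 : I 4 =1 I 3 by move=> j; rewrite [LHS](wf_cross wi).
have X0 : X 0 = 1 by exact: xlB.
have X2 : X 2 = X 1 by rewrite [RHS]xl_opp.
have X4 : X 4 = X 3 by rewrite [LHS]xl_opp.
have X6 : X 6 = X 5 by rewrite [RHS]xl_opp.
have sk := init_skel.
have [P3n Ay1] := chord_y_1 boundaryE sk X0 mono I3.
have [nx' Ax' AV nx'' AV''] := chords_x' boundaryE sk X0 X6 mono I5 I6.
have [P5n Aa Az1 AW [nX AX AU nD AU2]] := chords_a boundaryE sk X0 X2 X4 X6 mono I5 I4.
have AR := chord_R boundaryE sk X4 X6.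
have ADx := chord_Dx boundaryE sk X0 X2.
have ADy := chord_Dy boundaryE sk X0 X4 mono.
have AD'y := chord_D'y boundaryE sk X0 mono.
have AD'x := chord_D'x boundaryE sk X0 mono.
have Xn k : X k != 0 by exact: (xl_neq0 wi).
have yn v : ymon v != 0 :> K by exact: ymon_neq0.
pose cx : K := ymon (nind d); pose cy : K := ymon (nind f).
pose cz : K := ymon (nind e).
pose h : K := ymon (fun j => Bd 2 j - nind d j)%N.
pose m : K := ymon (fun j => Bd 6 j - (Bd 4 j + nind e j))%N.
pose nn : K := ymon (fun j => Bd 3 j - (Bd 1 j + nind f j))%N.
pose eps : K := ymon (fun j => I 0 j - Bd 5 j)%N.
have E2 : ymon (Bd 2) = h * cx.
  by rewrite /h /cx -ymonD; apply: eq_ymon => j; rewrite subnK.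
have E4 : ymon (Bd 4) = ymon (Bd 2) * cy by rewrite -ymonD; exact: eq_ymon.
have E6 : ymon (Bd 6) = ymon (Bd 4) * m * cz.
  rewrite -!ymonD; apply: eq_ymon => j; by move: (Bd6 j) => H; rewrite addnAC addnC subnK.
have E1 : ymon (Bd 1) = ymon (Bd 6) * cx by rewrite -ymonD; exact: eq_ymon.
have E3 : ymon (Bd 3) = ymon (Bd 1) * nn * cy.
  rewrite -!ymonD; apply: eq_ymon => j; by move: (Bd3 j) => H; rewrite addnAC addnC subnK.
have E5 : ymon (Bd 5) = ymon (Bd 3) * cz by rewrite -ymonD; exact: eq_ymon.
have EIz : ymon (I 5) = ymon (Bd 6) * ymon (Bd 3) by rewrite -ymonD; exact: eq_ymon.
have EIy : ymon (I 3) = ymon (Bd 3) * ymon (Bd 2) by rewrite -ymonD; exact: eq_ymon.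
have EI0 : ymon (I 0) = eps * ymon (Bd 5).
  by rewrite -ymonD; apply: eq_ymon => j; rewrite subnK.
have Q3 : P 3 = P 5 + ymon (Bd 3) * X 1 / (X 5 * X 3).
  rewrite /P /X /= (psum_step oeB (tau_opp e)) corner_init !xl_opp rot3.
  by rewrite [xl st f * _]mulrC.
have Q6 : P 6 = P 1 + ymon (Bd 6) * X 3 / (X 1 * X 5).
  rewrite /P /X /= (psum_step odB (tau_opp d)) corner_init !xl_opp rot3.
  by rewrite [xl st e * _]mulrC.
have Q2 : P 2 = P 4 + ymon (Bd 2) * X 5 / (X 1 * X 3).
  have tf : tau (opp f) = d by rewrite tau_opp rot3.
  by rewrite /P /X /= (psum_step ofB tf) corner_init !xl_opp.
have Q5 : P 5 = ymon (Bd 5) * (X 5 * P 5 / ymon (Bd 5)) / X 5.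
  by rewrite [ymon _ * _]mulrC (divfK (yn _)) [X 5 * _]mulrC (mulfK (Xn 5)).
have Q4 : P 4 = P 6 + ymon (Bd 4) * (X 3 * X 5 * (P 4 - P 6) / ymon (Bd 4)) / (X 3 * X 5).
  rewrite [ymon _ * _]mulrC (divfK (yn _)) [X 3 * _ * _]mulrC.
  by rewrite (mulfK (mulf_neq0 (Xn 3) (Xn 5))) addrC subrK.
have AX1 k : A (X k) := real_ca (code k) wi.
rewrite !mulrA in AV'' AX AW AU AU2.
have a0 : X 5 * P 5 / ymon (Bd 5) != 0.
  exact: mulf_neq0 (mulf_neq0 (Xn 5) P5n) (invr_neq0 (yn _)).
exact: (loop_in_subring (@ca_sub _ _) (@ca_mul _ _) (Xn 1) (Xn 3) (Xn 5)
  (yn _) (yn _) (yn _) (yn _) (yn _) (yn _) a0 E2 E4 E6 E1 E3 E5 EIz EIy EI0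
  Q5 Q3 Q6 Q4 Q2 nx' nx'' nX nD P3n (AX1 1) (AX1 5) (ca_ymon _ _) (ca_ymon _ _)
  (ca_ymon _ _) (ca_ymon _ _) (ca_ymon _ _) (ca_ymon _ _) Aa AR Ax' AV AV'' AX AW
  AU AU2 AD'y AD'x ADx ADy Az1 Ay1).
Qed.

End Triangle.

Lemma loop_ca : marked_points T = 1%N -> has_genus T 1 ->
  A (\sum_d corner st d).
Proof.
move=> m1 g1; rewrite -(init_psum boundaryE tauB).
have [d [dB eB fB [[pe pf pd] [fd ef dl]]]] := torus_triangle boundaryE tauB m1 g1.
exact: (@loop_sum_ca d).
Qed.

End Main.

Theorem theorem3p1 (n : nat) (T : triangulation n)
  (hT : orbifold T) (hmarked : marked_points T = 1%N) (hgenus : has_genus T 1)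
  (N : nat) (w : N.-tuple (dart T)) (hw : essential_loop w)
  (U : unfolding T) (v : N.-tuple (dart (unf_cover U)))
  (hv : closed_lift w v) :
  cluster_algebra (principal_seed (exchange_matrix T)) (lift_laurent v).
Proof.
have [B [boundaryE tauB]] := boundary_cycle hT hmarked.
rewrite (lift_laurentE hv) (band_value hw boundaryE tauB).
exact: loop_ca.
Qed.
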